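(* Let $0<\alpha<2$, let $N\ge1$ be an integer with $N>\alpha$, let $\nu:(0,\infty)\to[0,\infty)$ be a measurable function that is nonincreasing near the origin, let $V$ be a measurable function on $\mathbb{R}^N$, and let $u_0\in C_0(\mathbb{R}^N)$ be nonnegative and not identically equal to $0$. Let $(\{X_t\}_{t\ge0},\{P_x\}_{x\in\mathbb{R}^N})$ be an $N$-dimensional rotationally invariant $\alpha$-stable process. Suppose that $$\liminf_{r\to0+}r^{\alpha}\nu(r)>j_{\frac{N-2}{2},1}^{\alpha}$$ and that $V(x)\ge\nu(|x|)$ for a.e. $x\in\mathbb{R}^N$. Then $$E_x\left[u_0(X_t)\exp\left(\int_0^tV(X_s)\,ds\right)\right]=\infty$$ for any $x\in\mathbb{R}^N$ and $t>0$.
   Context: ''Nonincreasing near the origin'' means that there is $r_0>0$ such that $\nu$ is nonincreasing on $(0,r_0]$. For $\mu>-1$, $j_{\mu,1}$ denotes the first positive zero of the Bessel function $J_\mu$ of the first kind with index $\mu$. $C_0(\mathbb{R}^N)$ denotes the continuous functions on $\mathbb{R}^N$ with compact support. The rotationally invariant $\alpha$-stable process starting from $x$ is the (right-continuous) process such that under $P_x$ the process $X_t-x$, $t\ge0$, is a Lévy process with characteristic function $$E_x\left[\exp\{i\xi\cdot(X_t-x)\}\right]=e^{-t|\xi|^{\alpha}},\quad t\ge0,\ \xi\in\mathbb{R}^N;$$ its infinitesimal generator is $-(-\Delta)^{\alpha/2}$. $E_x$ is the expectation with respect to $P_x$. *)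

(* Defs.v *)
From mathcomp Require Import all_boot all_order all_algebra.
From mathcomp Require Import complex.
From mathcomp Require Import all_classical all_reals all_analysis.

Set Implicit Arguments.
Unset Strict Implicit.
Unset Printing Implicit Defensive.

Import Order.TTheory GRing.Theory Num.Theory.
Import numFieldNormedType.Exports.

Local Open Scope classical_set_scope.
Local Open Scope ring_scope.

Section Euclidean.
Context {R : realType} {N : nat}.
Implicit Types x y a b : 'rV[R]_N.

Definition dotp x y : R := \sum_(i < N) x 0 i * y 0 i.

(* The library norm [`|x|] on row vectors is the sup norm, so the Euclidean
   norm is defined here. Both norms induce the same topology. *)
Definition enorm x : R := Num.sqrt (dotp x x).

Definition box a b : set 'rV[R]_N :=
  [set x | forall i, a 0 i < x 0 i <= b 0 i].

Definition box_volume a b : R := \prod_(i < N) Num.max 0 (b 0 i - a 0 i).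

(* Lebesgue outer measure on R^N; its Caratheodory-measurable sets are the
   Lebesgue measurable sets. *)
Definition lebesgue_outer (A : set 'rV[R]_N) : \bar R :=
  ereal_inf [set v | exists a b : nat -> 'rV[R]_N,
    A `<=` \bigcup_k box (a k) (b k) /\
    v = (\sum_(0 <= k <oo) (box_volume (a k) (b k))%:E)%E].

Definition compactly_supported (u : 'rV[R]_N -> R) : Prop :=
  compact (closure [set x | u x != 0]).

End Euclidean.

(* Measurability with respect to the completed (Lebesgue) sigma-algebra. On the
   real line take [mu := lebesgue_measure], whose underlying set function is
   the outer measure on all subsets of R. *)
Definition lebesgue_measurable_fun {R : realType} {T : Type}
    (mu : set T -> \bar R) (D : set T) (f : T -> R) : Prop :=
  forall B : set R, measurable B -> mu.-caratheodory (D `&` f @^-1` B).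

Definition borel_rV (R : realType) (N : nat) :=
  g_sigma_algebraType (@open 'rV[R]_N).

Section Bessel.
Context {R : realType}.

(* Only used for 0 < x, where the integral converges. *)
Definition Gamma (x : R) : R :=
  \int[lebesgue_measure]_(t in `]0, +oo[) (t `^ (x - 1) * expR (- t)).

(* J_mu(z) for mu > -1 and z > 0. *)
Definition besselJ (mu z : R) : R :=
  limn (series (fun m : nat =>
    (-1) ^+ m / (m`!%:R * Gamma (m%:R + mu + 1)) *
      (z / 2) `^ (2 * m%:R + mu))).

Definition first_positive_zero (f : R -> R) (z : R) : Prop :=
  [/\ 0 < z, f z = 0 & forall w, 0 < w < z -> f w != 0].

(* j_{mu,1} *)
Definition bessel_zero1 (mu : R) : R :=
  xget 0 [set z | first_positive_zero (besselJ mu) z].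

End Bessel.

Definition nonincreasing_near_origin {R : realType} (nu : R -> R) : Prop :=
  exists2 r0 : R, 0 < r0 & {in `]0, r0] &, nonincreasing_fun nu}.

Section Processes.
Context {R : realType} {N : nat} {d : measure_display} {Omega : measurableType d}.
Implicit Types (P : probability Omega R) (Y : R -> Omega -> 'rV[R]_N).

(* Processes are indexed by R; only the times t >= 0 are meaningful. *)
Definition increment Y (s t : R) : Omega -> 'rV[R]_N :=
  fun w => Y t w - Y s w.

Definition independent_increments P Y : Prop :=
  forall (n : nat) (t : nat -> R) (B : nat -> set (borel_rV R N)),
    0 <= t 0%N -> (forall i, (i < n)%N -> t i <= t i.+1) ->
    (forall i, measurable (B i)) ->
    P (\bigcap_(i < n) increment Y (t i) (t i.+1) @^-1` B i) =
    (\prod_(i < n) P (increment Y (t i) (t i.+1) @^-1` B i))%E.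

Definition stationary_increments P Y : Prop :=
  forall (s t : R) (B : set (borel_rV R N)),
    0 <= s -> 0 <= t -> measurable B ->
    P (increment Y s (s + t) @^-1` B) = P (increment Y 0 t @^-1` B).

Definition stochastically_continuous P Y : Prop :=
  forall (t e : R), 0 <= t -> 0 < e ->
    P [set w | e < enorm (increment Y t s w)]
      @[s --> within [set s | 0 <= s] (nbhs t)] --> 0%E.

Definition is_levy_process P Y : Prop :=
  [/\ forall t : R, 0 <= t ->
        measurable_fun [set: Omega] (Y t : Omega -> borel_rV R N),
      {ae P, forall w, Y 0 w = 0},
      independent_increments P Y,
      stationary_increments P Y &
      stochastically_continuous P Y].

Definition right_continuous_paths P Y : Prop :=
  {ae P, forall w, forall t : R, 0 <= t -> Y s w @[s --> t^'+] --> Y t w}.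

(* E[exp(i xi . Z)], integrating real and imaginary parts separately *)
Definition char_fun P (Z : Omega -> 'rV[R]_N) (xi : 'rV[R]_N) : R[i] :=
  Complex (\int[P]_w cos (dotp xi (Z w))) (\int[P]_w sin (dotp xi (Z w))).

Definition is_rot_inv_stable_process (alpha : R)
    (X : R -> Omega -> 'rV[R]_N) (P : 'rV[R]_N -> probability Omega R) : Prop :=
  forall x : 'rV[R]_N,
    [/\ right_continuous_paths (P x) X,
        is_levy_process (P x) (fun t w => X t w - x) &
        forall (t : R) (xi : 'rV[R]_N), 0 <= t ->
          char_fun (P x) (fun w => X t w - x) xi =
          real_complex R (expR (- (t * enorm xi `^ alpha)))].

End Processes.

(* Main.v *)
From HB Require Import structures.
Require Import Defs.
From mathcomp Require Import all_boot all_order all_algebra.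
From mathcomp Require Import all_classical all_reals all_analysis.
From mathcomp Require Import measurable_realfun complex ring lra zify.

Set Implicit Arguments.
Unset Strict Implicit.
Unset Printing Implicit Defensive.

Import Order.TTheory GRing.Theory Num.Theory.
Import numFieldNormedType.Exports.

Local Open Scope classical_set_scope.
Local Open Scope ring_scope.

(** Small balls around the origin are enough to make the expectation infinite.
    Let [j] be the first zero of the Bessel function, and fix [m > j] such that
    [nu r >= (m / r) ^ alpha] for small [r]. Since [j ^ 2] is the first Dirichlet
    eigenvalue of the Laplacian in the unit ball, the stable process can stay in
    the ball of radius [r] around the origin during a time [T] with probability
    at least of the order of [exp (- T (lam' / r) ^ alpha)], for any [lam' > j]:
    the killed fractional Laplacian has a first eigenvalue at most equal to the
    corresponding power of that of the Laplacian. On this event the exponential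
    functional is at least [exp (T (m / ((1 + eta) r)) ^ alpha)]. If [lam'] and
    [eta] are so small that [lam' (1 + eta) < m], the product of the two is
    exponentially large in [r ^ - alpha]. Getting into the ball has a probability
    polynomial in [r] ([hit_cube]), and coming from the ball to a place where
    [u0] is positive has a probability bounded below; letting [r] tend to [0]
    gives the result ([exp_exp_unbounded]).

    The staying probability is obtained by discretization, so that neither
    killed semigroups nor their generators are needed. At [2 ^ k] equally spaced
    times, the increments are rounded to a lattice of small mesh; this gives a
    symmetric nonnegative kernel on the lattice points of the ball. Its Rayleigh
    quotient at the truncated radial eigenfunction ([test_function]) is nearly
    [exp (- tau lam ^ alpha)]: written with the discrete Fourier transform, it is
    an average of the characteristic function [exp (- tau |xi| ^ alpha)], which as
    a function of [q = |xi| ^ 2] lies above one of its tangent lines by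
    convexity, and the average of [q] is the Dirichlet energy
    ([symbol_tangent], [lattice_rayleigh]). By Cauchy-Schwarz the Rayleigh
    quotient of the power [2 ^ k] of the kernel is at least that power of the
    quotient, and by Schur's test some row sum of it is at least as large
    ([exists_large_rowsum]); a row sum is the probability that the walk started
    from some lattice point stays ([walk_prob], [stay_at_ge]). The resulting
    bound does not depend on [k], so it passes to all dyadic times and, by right
    continuity, to all times ([stay_right_continuous], [stay_ge]).

    Three facts about the stable law enter. It is determined by its
    characteristic function, whence self-similarity and isotropy. These force its
    support to be the whole space, which gives [hit_cube] by repeated halving of
    scales. Its density is bounded (tested against Fejer kernels); with Fubini's
    theorem, the inequality for the potential, valid almost everywhere in space,
    holds almost surely at almost every time ([ae_potential_ge]).

    Finally, the Gamma function at half-integers identifies the Bessel function,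
    up to a power of the variable, with an entire series [psi] that solves the
    radial eigenvalue equation ([besselJ_psi]), and a comparison argument shows
    that it has a first zero, where it changes sign ([psi_first_zero],
    [bessel_zero1_psi]). *)

Lemma cvg_seq_le {R : realType} (u : nat -> R) l M :
  u n @[n --> \oo] --> l -> (forall n, u n <= M) -> l <= M.
Proof.
move=> ul uM; rewrite -(cvg_lim (@Rhausdorff R) ul).
by apply: limr_le; [apply: cvgP; exact: ul|exact: nearW].
Qed.

(** * Expectations of bounded random variables *)

Section BoundedExpectation.
Context {R : realType} {d : measure_display} {Omega : measurableType d}.
Implicit Types (P : probability Omega R) (f g : Omega -> R).

Definition bmeas f :=
  measurable_fun [set: Omega] f /\ exists M : R, forall w, `|f w| <= M.

Lemma bmeas_cst c : bmeas (fun=> c).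
Proof. by split; [exact: measurable_cst|exists `|c|]. Qed.

Lemma bmeasD f g : bmeas f -> bmeas g -> bmeas (fun w => f w + g w).
Proof.
move=> [mf [M fM]] [mg [K gK]]; split; first exact: measurable_funD.
by exists (M + K) => w; rewrite (le_trans (ler_normD _ _))// lerD.
Qed.

Lemma bmeasM f g : bmeas f -> bmeas g -> bmeas (fun w => f w * g w).
Proof.
move=> [mf [M fM]] [mg [K gK]]; split; first exact: measurable_funM.
by exists (M * K) => w; rewrite normrM ler_pM.
Qed.

Lemma bmeasZ c f : bmeas f -> bmeas (fun w => c * f w).
Proof. exact: (bmeasM (bmeas_cst c)). Qed.

Lemma bmeasN f : bmeas f -> bmeas (fun w => - f w).
Proof.
by move=> /(bmeasZ (-1)); congr bmeas; apply/funext => w; rewrite mulN1r.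
Qed.

Lemma bmeasB f g : bmeas f -> bmeas g -> bmeas (fun w => f w - g w).
Proof. by move=> hf /bmeasN; exact: bmeasD. Qed.

Lemma bmeas_sum (I : Type) (r : seq I) (p : pred I) (F : I -> Omega -> R) :
  (forall i, p i -> bmeas (F i)) -> bmeas (fun w => \sum_(i <- r | p i) F i w).
Proof.
move=> hF; elim: r => [|i r IHr].
  by under eq_fun do rewrite big_nil; exact: bmeas_cst.
under eq_fun do rewrite big_cons.
case pi: (p i) => //; apply: bmeasD => //; exact: hF.
Qed.

Lemma bmeas_prod (I : Type) (r : seq I) (p : pred I) (F : I -> Omega -> R) :
  (forall i, p i -> bmeas (F i)) -> bmeas (fun w => \prod_(i <- r | p i) F i w).
Proof.
move=> hF; elim: r => [|i r IHr].
  by under eq_fun do rewrite big_nil; exact: bmeas_cst.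
under eq_fun do rewrite big_cons.
case pi: (p i) => //; apply: bmeasM => //; exact: hF.
Qed.

Lemma bmeas_indic (A : set Omega) : measurable A -> bmeas (\1_A : _ -> R).
Proof.
move=> mA; split; first exact: measurable_indic.
by exists 1 => w; rewrite indicE; case: (_ \in _); rewrite ?normr1 ?normr0.
Qed.

Lemma bmeas_integrable P f : bmeas f -> P.-integrable setT (EFin \o f).
Proof.
move=> [mf [M fM]]; apply: measurable_bounded_integrable => //.
  by rewrite (le_lt_trans (probability_le1 P measurableT))// ltry.
by exists M; split; [exact: num_real|move=> K MK w _]; exact: le_trans (fM w) (ltW MK).
Qed.

Lemma expD P f g : bmeas f -> bmeas g ->
  \int[P]_w (f w + g w) = \int[P]_w f w + \int[P]_w g w.
Proof. by move=> hf hg; apply: RintegralD => //; exact: bmeas_integrable. Qed.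

Lemma expZ P c f : bmeas f -> \int[P]_w (c * f w) = c * \int[P]_w f w.
Proof. by move=> hf; apply: RintegralZl => //; exact: bmeas_integrable. Qed.

Lemma expN P f : bmeas f -> \int[P]_w (- f w) = - \int[P]_w f w.
Proof.
move=> hf; rewrite -mulN1r -expZ//.
by apply: eq_Rintegral => w _; rewrite mulN1r.
Qed.

Lemma expB P f g : bmeas f -> bmeas g ->
  \int[P]_w (f w - g w) = \int[P]_w f w - \int[P]_w g w.
Proof. by move=> hf hg; rewrite expD ?expN//; exact: bmeasN. Qed.

Lemma exp_cst P c : \int[P]_w c = c.
Proof. by rewrite Rintegral_cst// (_ : fine _ = 1) ?mulr1//; have /= -> := probability_setT P. Qed.

Lemma exp_sum P (I : Type) (r : seq I) (p : pred I) (F : I -> Omega -> R) :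
  (forall i, p i -> bmeas (F i)) ->
  \int[P]_w (\sum_(i <- r | p i) F i w) = \sum_(i <- r | p i) \int[P]_w F i w.
Proof.
move=> hF; elim: r => [|i r IHr].
  by under eq_Rintegral do rewrite big_nil; rewrite exp_cst big_nil.
under eq_Rintegral do rewrite big_cons.
rewrite big_cons; case: ifP => // pi; rewrite expD ?IHr//; first exact: hF.
exact: bmeas_sum.
Qed.

Lemma le_exp P f g : bmeas f -> bmeas g -> (forall w, f w <= g w) ->
  \int[P]_w f w <= \int[P]_w g w.
Proof.
by move=> hf hg fg; apply: le_Rintegral => //; exact: bmeas_integrable.
Qed.

Lemma exp_indic P (A : set Omega) : measurable A ->
  \int[P]_w (\1_A w) = fine (P A).
Proof. by move=> mA; rewrite /Rintegral integral_indic// setIT. Qed.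

(** Bounded convergence. *)
Lemma exp_cvg P (F : nat -> Omega -> R) (f : Omega -> R) M :
  (forall n, measurable_fun setT (F n)) -> (forall n w, `|F n w| <= M) ->
  (forall w, F n w @[n --> \oo] --> f w) ->
  \int[P]_w F n w @[n --> \oo] --> \int[P]_w f w.
Proof.
move=> mF FM Ff.
have mf : measurable_fun setT f.
  by apply: (measurable_fun_cvg mF) => w _; exact: Ff.
have [|||||If _ cv] := @dominated_convergence _ _ _ P setT measurableT
    (fun n => EFin \o F n) (EFin \o f) (fun=> M%:E).
- by move=> n; apply/measurable_EFinP.
- exact/measurable_EFinP.
- by apply: aeW => w _; apply: cvg_EFin; [exact: nearW|exact: Ff].
- by apply: bmeas_integrable; exact: bmeas_cst.
- by apply: aeW => w n _ /=; rewrite lee_fin.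
apply: fine_cvg; rewrite fineK//.
exact: integrable_fin_num.
Qed.

End BoundedExpectation.

(** * Borel sets and laws on Euclidean space *)

Section BorelSpace.
Context {R : realType} {N : nat}.
Local Notation vec := 'rV[R]_N.

Definition ccube (c : vec) (w : R) : set vec :=
  [set x | forall i, `|x 0 i - c 0 i| <= w].

Definition ocube (c : vec) (w : R) : set vec :=
  [set x | forall i, `|x 0 i - c 0 i| < w].

Definition rat_cube (n : nat) : vec * R :=
  if @unpickle ('rV[rat]_N * rat)%type n is Some q
  then (map_mx ratr q.1, ratr q.2) else (0, 0).

Lemma rat_cube_dense (x : vec) (e : R) : 0 < e ->
  exists n, [/\ 0 < (rat_cube n).2,
    ccube (rat_cube n).1 (rat_cube n).2 x &
    ccube (rat_cube n).1 (rat_cube n).2 `<=` ocube x e].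
Proof.
move=> e0.
have [w] : exists q : rat, ratr q \in `]0, (e / 2)[.
  by apply: rat_in_itvoo; rewrite divr_gt0.
rewrite in_itv /= => /andP[w0 we].
have qx i : exists q : rat, `|x 0 i - ratr q| <= ratr w.
  have [|q] := @rat_in_itvoo _ (x 0 i - ratr w) (x 0 i + ratr w).
    by rewrite ltrBlDr -addrA ltrDl addr_gt0.
  rewrite in_itv /= => /andP[q1 q2]; exists q.
  rewrite ler_norml; apply/andP; split; lra.
pose c : 'rV[rat]_N := \row_i projT1 (cid (qx i)).
have cE : rat_cube (pickle ((c, w) : 'rV[rat]_N * rat)) = (map_mx ratr c, ratr w).
  by rewrite /rat_cube pickleK.
exists (pickle ((c, w) : 'rV[rat]_N * rat)); rewrite cE /=; split=> //.
  by move=> i; rewrite !mxE; case: cid.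
move=> y cy j; move: (cy j); rewrite mxE mxE; case: cid => q /= xq yq.
have -> : y 0 j - x 0 j = (y 0 j - ratr q) - (x 0 j - ratr q) by ring.
by rewrite (le_lt_trans (ler_normB _ _))//; lra.
Qed.

Lemma ocube_nbhs (U : set vec) (x : vec) : nbhs x U ->
  exists2 e : R, 0 < e & ocube x e `<=` U.
Proof.
move=> /nbhs_ballP[e /= e0 eU]; exists e => // y xy.
apply: eU; split => // i j; rewrite (ord1 i) /ball /= distrC; exact: xy.
Qed.

Lemma open_bigcup_ccube (U : set vec) : open U ->
  exists (D : set nat) (c : nat -> vec) (w : nat -> R),
    (forall n, D n -> 0 < w n) /\ U = \bigcup_(n in D) ccube (c n) (w n).
Proof.
move=> oU.
exists [set n | 0 < (rat_cube n).2 /\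
                ccube (rat_cube n).1 (rat_cube n).2 `<=` U],
  (fun n => (rat_cube n).1), (fun n => (rat_cube n).2).
split; first by move=> n [].
apply/seteqP; split => [x Ux|x [n /= [_ +]]]; last exact.
have [e e0 eU] := ocube_nbhs (open_nbhs_nbhs (conj oU Ux)).
have [n [n0 xn nx]] := rat_cube_dense x e0.
by exists n => //=; split => //; exact: subset_trans eU.
Qed.

(** Every open set is a countable union of rational cubes. *)
Lemma borel_sub_sigma (G : set (set vec)) :
  (forall c w, 0 < w -> <<s G >> (ccube c w)) ->
  forall A : set (borel_rV R N), measurable A -> <<s G >> A.
Proof.
move=> Gc; apply: smallest_sub; first exact: smallest_sigma_algebra.
move=> U /open_bigcup_ccube[D [c [w [w0 ->]]]].
have [s0 _ sU] : sigma_algebra setT <<s G >> by exact: smallest_sigma_algebra.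
rewrite bigcup_mkcond; apply: sU => n; case: ifPn => [/set_mem/w0 wn0|_]; last exact: s0.
exact: Gc.
Qed.

Section MeasurableVector.
Context {d : measure_display} {Omega : measurableType d}.

Lemma ccube_preimage_measurable (Z : Omega -> vec) c w :
  (forall i, measurable_fun setT (fun u => Z u 0 i)) ->
  measurable (Z @^-1` ccube c w).
Proof.
move=> mZ; have -> : Z @^-1` ccube c w =
    \bigcap_(i in [set: 'I_N]) (fun w => Z w 0 i) @^-1` `[c 0 i - w, c 0 i + w].
  apply/seteqP; split => u /= hu i; have := hu i.
    by move=> + _; rewrite /= in_itv /= ler_distl.
  by move=> /(_ Logic.I); rewrite /= in_itv /= ler_distl.
apply: fin_bigcap_measurable => // i _.
by rewrite -[X in measurable X]setTI; apply: mZ => //; exact: measurable_itv.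
Qed.

Lemma measurable_rV (Z : Omega -> vec) :
  (forall i, measurable_fun setT (fun w => Z w 0 i)) ->
  measurable_fun setT (Z : Omega -> borel_rV R N).
Proof.
move=> mZ; apply: (@measurability _ _ _ (borel_rV R N) setT Z (@open vec)) => //.
move=> _ [U oU <-]; rewrite setTI.
have [D [c [w [_ ->]]]] := open_bigcup_ccube oU.
rewrite preimage_bigcup; apply: bigcup_measurable => n _.
exact: ccube_preimage_measurable.
Qed.

End MeasurableVector.

Lemma continuous_borel_measurable (f : vec -> R) :
  continuous f -> measurable_fun setT (f : borel_rV R N -> R).
Proof.
move=> cf; apply: (measurability _ (RGenOpens.measurableE R)).
move=> _ [_ [a [b ->] <-]]; rewrite setTI.
apply: sub_sigma_algebra.
by apply: open_comp => //; exact: interval_open.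
Qed.

Lemma coord_measurable i :
  measurable_fun setT (fun x : borel_rV R N => (x : vec) 0 i).
Proof. by apply: continuous_borel_measurable; exact: coord_continuous. Qed.

Lemma box_measurable (a b : vec) : measurable (box a b : set (borel_rV R N)).
Proof.
rewrite (_ : box a b = \bigcap_(i in [set: 'I_N])
    (fun x : vec => x 0 i) @^-1` `]a 0 i, b 0 i]); last first.
  by apply/seteqP; split => w /= hw i; [move=> _|]; have := hw i;
    [|move=> /(_ Logic.I)]; rewrite /= in_itv.
apply: fin_bigcap_measurable => // i _; rewrite -[X in measurable X]setTI.
by apply: coord_measurable => //; exact: measurable_itv.
Qed.

Lemma ocube_measurable c w : measurable (ocube c w : set (borel_rV R N)).
Proof.
rewrite (_ : ocube c w = \bigcap_(i in [set: 'I_N])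
    (fun x : vec => x 0 i) @^-1` `]c 0 i - w, c 0 i + w[); last first.
  by apply/seteqP; split => x /= hx i; [move=> _|]; have := hx i;
    [|move=> /(_ Logic.I)]; rewrite /= in_itv /= ltr_distl.
apply: fin_bigcap_measurable => // i _; rewrite -[X in measurable X]setTI.
by apply: coord_measurable => //; exact: measurable_itv.
Qed.

Lemma ccube_measurable c w : measurable (ccube c w : set (borel_rV R N)).
Proof.
rewrite -[ccube c w]/((id : borel_rV R N -> vec) @^-1` ccube c w).
by apply: ccube_preimage_measurable => i; exact: coord_measurable.
Qed.

End BorelSpace.

(** * Characteristic functions determine laws *)

Lemma bernoulli_ineq {R : realFieldType} (x : R) n : -1 <= x ->
  1 + n%:R * x <= (1 + x) ^+ n.
Proof.
move=> x1; elim: n => [|n IHn]; first by rewrite mul0r addr0 expr0.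
rewrite exprS (le_trans _ (ler_wpM2l _ IHn))//; last lra.
have : 0 <= n%:R * (x * x) by rewrite mulr_ge0// -expr2 sqr_ge0.
by rewrite -natr1; lra.
Qed.

Lemma natmul_expr_cvg0 {R : realType} (q : R) : 0 <= q < 1 ->
  (n%:R * q ^+ n) @[n --> \oo] --> 0.
Proof.
move=> /andP[q0 q1].
have [->|q_neq0] := eqVneq q 0.
  apply: (@cvg_trans _ ((fun=> 0) @ \oo)); last exact: cvg_cst.
  apply: near_eq_cvg; near=> n.
  have n0 : (0 < n)%N by near: n; exact: nbhs_infty_gt.
  by rewrite expr0n gtn_eqF// mulr0.
have {q_neq0}q0 : 0 < q by rewrite lt_neqAle eq_sym q_neq0.
pose p := Num.sqrt q.
have p0 : 0 < p by rewrite sqrtr_gt0.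
have p1 : p < 1 by rewrite -sqrtr1 ltr_sqrt.
have pq : q = p ^+ 2 by rewrite sqr_sqrtr// ltW.
pose c := p^-1 - 1.
have c0 : 0 < c by rewrite subr_gt0 invf_gt1.
(* Bernoulli's inequality bounds n p^n by 1/c, leaving a geometric factor. *)
have bnd n : n%:R * p ^+ n <= c^-1.
  have := @bernoulli_ineq _ c n.
  rewrite (_ : 1 + c = p^-1) ?exprVn; last by rewrite /c; ring.
  move=> /(_ _)H; have {}H : n%:R * c <= p ^- n.
    have c1 : -1 <= c by rewrite (le_trans _ (ltW c0))// lerN10.
    by apply: le_trans (H c1); rewrite lerDr.
  by rewrite -ler_pdivlMr ?exprn_gt0// [leRHS]mulrC ler_pdivlMr.
apply: (@squeeze_cvgr _ _ _ _ (fun=> 0) (fun n => c^-1 * p ^+ n)).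
- apply: nearW => n; rewrite mulr_ge0 ?exprn_ge0 ?(ltW q0)//=.
  by rewrite pq -exprM mul2n -addnn exprD mulrA ler_wpM2r// exprn_ge0// ltW.
- exact: cvg_cst.
- rewrite -[X in _ --> X](mulr0 c^-1); apply: cvgM; first exact: cvg_cst.
  by apply: cvg_expr; rewrite gtr0_norm.
Unshelve. all: by end_near. Qed.

(** With [p = u ^+ n] and [m = n * 2 ^ n], the power [(1 - p) ^+ m] is about
    [exp (- n * (2 * u) ^+ n)], and [n * (2 * u) ^+ n] tends to infinity or to [0]
    according to whether [1 / 2 <= u]. The exact comparison uses Bernoulli's
    inequality twice. *)
Lemma threshold_cvg {R : realType} (u : R) : 0 <= u <= 1 ->
  (1 - (1 - u ^+ n) ^+ (n * 2 ^ n)) @[n --> \oo] --> ((2^-1 <= u)%R%:R : R).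
Proof.
move=> /andP[u0 u1].
have un01 n : 0 <= u ^+ n <= 1 by rewrite exprn_ge0//= exprn_ile1.
have [u2|u2] := leP 2^-1 u.
  rewrite -[X in _ --> X]subr0; apply: cvgB; first exact: cvg_cst.
  apply: (@squeeze_cvgr _ _ _ _ (fun=> 0) (fun n => n.+1%:R^-1)).
  - apply: nearW => n; have /andP[un0 un1] := un01 n.
    rewrite exprn_ge0 ?subr_ge0//=.
    have h1 : (1 - u ^+ n) ^+ (n * 2 ^ n) * (1 + u ^+ n) ^+ (n * 2 ^ n) <= 1.
      rewrite -exprMn -subr_sqr expr1n exprn_ile1//.
        by rewrite subr_ge0 -exprM exprn_ile1.
      by rewrite lerBlDr lerDl -exprM exprn_ge0.
    have h2 : n.+1%:R <= (1 + u ^+ n) ^+ (n * 2 ^ n).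
      have := @bernoulli_ineq _ (u ^+ n) (n * 2 ^ n) => /(_ _)H.
      rewrite (le_trans _ (H _))//; last lra.
      rewrite natrM -mulrA -nat1r lerD2l ler_peMr// natrX -exprMn.
      by rewrite exprn_ege1//; lra.
    rewrite -[leRHS]mul1r ler_pdivlMr//.
    apply: le_trans h1; rewrite ler_wpM2l// exprn_ge0// subr_ge0//.
  - exact: cvg_cst.
  - exact: cvg_harmonic.
rewrite -[X in _ --> X](subrr 1); apply: cvgB; first exact: cvg_cst.
apply: (@squeeze_cvgr _ _ _ _ (fun n => 1 - n%:R * (2 * u) ^+ n) (fun=> 1)).
- apply: nearW => n; have /andP[un0 un1] := un01 n.
  rewrite exprn_ile1 ?andbT; [|lra|lra].
  have := @bernoulli_ineq _ (- u ^+ n) (n * 2 ^ n) => /(_ _)H.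
  rewrite (le_trans _ (H _))//; last lra.
  by rewrite natrM natrX exprMn mulrN mulrA.
- rewrite -[X in _ --> X]subr0; apply: cvgB; first exact: cvg_cst.
  by apply: natmul_expr_cvg0; lra.
- exact: cvg_cst.
Qed.

Section DotProduct.
Context {R : realType} {N : nat}.
Implicit Types x y z : 'rV[R]_N.

Lemma dotpC x y : dotp x y = dotp y x.
Proof. by apply: eq_bigr => i _; rewrite mulrC. Qed.

Lemma dotpDl x y z : dotp (x + y) z = dotp x z + dotp y z.
Proof. by rewrite -big_split; apply: eq_bigr => i _; rewrite mxE mulrDl. Qed.

Lemma dotpZl a x z : dotp (a *: x) z = a * dotp x z.
Proof. by rewrite mulr_sumr; apply: eq_bigr => i _; rewrite mxE mulrA. Qed.

Lemma dotpNl x z : dotp (- x) z = - dotp x z.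
Proof. by rewrite -scaleN1r dotpZl mulN1r. Qed.

Lemma dotpBl x y z : dotp (x - y) z = dotp x z - dotp y z.
Proof. by rewrite dotpDl dotpNl. Qed.

Lemma dotpDr x y z : dotp x (y + z) = dotp x y + dotp x z.
Proof. by rewrite dotpC dotpDl !(dotpC x). Qed.

Lemma dotpZr a x z : dotp x (a *: z) = a * dotp x z.
Proof. by rewrite dotpC dotpZl dotpC. Qed.

Lemma dotpNr x z : dotp x (- z) = - dotp x z.
Proof. by rewrite dotpC dotpNl dotpC. Qed.

Lemma dotpBr x y z : dotp x (y - z) = dotp x y - dotp x z.
Proof. by rewrite dotpDr dotpNr. Qed.

Lemma dotp0l z : dotp 0 z = 0.
Proof. by rewrite -(scale0r 0) dotpZl mul0r. Qed.

Lemma dotp_delta a i x : dotp (a *: delta_mx 0 i) x = a * x 0 i.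
Proof.
rewrite dotpZl /dotp (bigD1 i)//= big1 ?addr0 ?mxE ?eqxx ?mul1r// => j ji.
by rewrite mxE (negbTE ji) andbF mul0r.
Qed.

Lemma dotp_ge0 x : 0 <= dotp x x.
Proof. by apply: sumr_ge0 => i _; rewrite -expr2 sqr_ge0. Qed.

Lemma enorm_sqr x : enorm x ^+ 2 = dotp x x.
Proof. by rewrite sqr_sqrtr ?dotp_ge0. Qed.

Lemma enorm_ge0 x : 0 <= enorm x.
Proof. exact: sqrtr_ge0. Qed.

Lemma enormZ a x : enorm (a *: x) = `|a| * enorm x.
Proof.
rewrite /enorm dotpZl dotpZr mulrA -expr2 sqrtrM ?sqr_ge0//.
by rewrite sqrtr_sqr.
Qed.

Lemma dotp_measurable (xi : 'rV[R]_N) :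
  measurable_fun setT (fun x : borel_rV R N => dotp xi x).
Proof.
apply: measurable_sum => i; apply: measurable_funM; first exact: measurable_cst.
exact: coord_measurable.
Qed.

Lemma cos_dotp_measurable (xi : 'rV[R]_N) th :
  measurable_fun setT (fun x : borel_rV R N => cos (dotp xi x + th)).
Proof.
apply: (measurableT_comp (@continuous_measurable_fun R cos _)).
  exact: continuous_cos.
by apply: measurable_funD; [exact: dotp_measurable|exact: measurable_cst].
Qed.

End DotProduct.

Lemma cos_mul_cos {R : realType} (a b : R) :
  cos a * cos b = 2^-1 * (cos (a + b) + cos (a - b)).
Proof. by rewrite cosD cosB; field. Qed.

Section BorelComposition.
Context {R : realType} {N : nat} {d : measure_display} {Omega : measurableType d}.
Implicit Types (Z : Omega -> 'rV[R]_N) (F : 'rV[R]_N -> R).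

Lemma bmeas_comp Z F : measurable_fun setT (Z : Omega -> borel_rV R N) ->
  @bmeas R _ (borel_rV R N) F -> bmeas (fun w => F (Z w)).
Proof.
move=> mZ [mF [M FM]]; split; last by exists M => w; exact: FM.
exact: (measurableT_comp mF mZ).
Qed.

End BorelComposition.

Lemma bmeas_cos {R : realType} {N : nat} (xi : 'rV[R]_N) th :
  @bmeas R _ (borel_rV R N) (fun x => cos (dotp xi x + th)).
Proof. by split; [exact: cos_dotp_measurable|exists 1 => w; exact: cos_max]. Qed.

(** The closed interval |x| <= w is cut out by the sets where
    cos (pi x / (2^(j+1) w)) is nonnegative: the j-th of these excludes the
    translates by odd multiples of 2^(j+1) w left over by the previous ones. *)
Lemma ccube_cos {R : realType} (x w : R) : 0 < w ->
  (`|x| <= w) <->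
  forall j : nat, 0 <= cos (pi / 2 / w / 2 ^+ j * x).
Proof.
move=> w0; have pi0 := pi_gt0 R.
have phi0 : 0 < pi / 2 :> R by rewrite divr_gt0.
have angle j : `|pi / 2 / w / 2 ^+ j * x| = pi / 2 * (`|x| / (2 ^+ j * w)).
  rewrite normrM gtr0_norm ?divr_gt0 ?exprn_gt0//.
  by field; rewrite gt_eqF//= expf_neq0.
split => [xw j|H].
  apply: cos_ge0_pihalf; rewrite -ler_norml angle ger_pMr//.
  rewrite ler_pdivrMr ?mulr_gt0 ?exprn_gt0// mul1r (le_trans xw)//.
  by rewrite ler_peMl ?(ltW w0)// exprn_ege1// ler1n.
rewrite leNgt; apply/negP => wx.
have [|j jx jmin] := @ex_minnP (fun j => `|x| <= 2 ^+ j.+1 * w).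
  exists (Num.truncn (`|x| / w)); rewrite -ler_pdivrMr//.
  apply: ltW; rewrite (lt_le_trans (truncnS_gt _))// -natrX ler_nat.
  exact: ltnW (ltn_expl _ _).
have {jmin}jx' : 2 ^+ j * w < `|x|.
  case: j jx jmin => [|j] _ jmin; first by rewrite expr0 mul1r.
  by rewrite ltNge; apply/negP => /jmin; rewrite ltnn.
have j0 : 0 < 2 ^+ j * w by rewrite mulr_gt0// exprn_gt0.
have := H j; rewrite -cos_norm angle leNgt => /negP; apply.
rewrite -[X in cos X](subrK pi) cosDpi oppr_lt0; apply: cos_gt0_pihalf.
have h1 : 1 < `|x| / (2 ^+ j * w) by rewrite ltr_pdivlMr// mul1r.
have h2 : `|x| / (2 ^+ j * w) <= 2 by rewrite ler_pdivrMr// mulrA -exprS.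
by nra.
Qed.

Section CharacteristicFunction.
Context {R : realType} {N : nat}.
Context {d1 d2 : measure_display}.
Context {T1 : measurableType d1} {T2 : measurableType d2}.
Variables (P1 : probability T1 R) (P2 : probability T2 R).
Variables (Z1 : T1 -> 'rV[R]_N) (Z2 : T2 -> 'rV[R]_N).
Hypotheses (mZ1 : measurable_fun setT (Z1 : T1 -> borel_rV R N))
           (mZ2 : measurable_fun setT (Z2 : T2 -> borel_rV R N)).

(** The cosine factor makes this class stable under products with cosines; it is
    also stable under linear combinations and bounded limits. *)
Let indist (F : 'rV[R]_N -> R) :=
  @bmeas R _ (borel_rV R N) F /\ forall xi th,
    \int[P1]_w (F (Z1 w) * cos (dotp xi (Z1 w) + th)) =
    \int[P2]_w (F (Z2 w) * cos (dotp xi (Z2 w) + th)).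

Let bFc F xi th : @bmeas R _ (borel_rV R N) F ->
  @bmeas R _ (borel_rV R N) (fun x => F x * cos (dotp xi x + th)).
Proof. by move=> bF; apply: bmeasM => //; exact: bmeas_cos. Qed.

Let indistD F G : indist F -> indist G -> indist (fun x => F x + G x).
Proof.
move=> [bF eF] [bG eG]; split=> [|xi th]; first exact: bmeasD.
under eq_Rintegral do rewrite mulrDl.
under [RHS]eq_Rintegral do rewrite mulrDl.
rewrite (expD _ (bmeas_comp mZ1 (bFc _ _ bF)) (bmeas_comp mZ1 (bFc _ _ bG))).
rewrite (expD _ (bmeas_comp mZ2 (bFc _ _ bF)) (bmeas_comp mZ2 (bFc _ _ bG))).
by rewrite eF eG.
Qed.

Let indistZ c F : indist F -> indist (fun x => c * F x).
Proof.
move=> [bF eF]; split=> [|xi th]; first exact: bmeasZ.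
under eq_Rintegral do rewrite -mulrA.
under [RHS]eq_Rintegral do rewrite -mulrA.
rewrite (expZ _ _ (bmeas_comp mZ1 (bFc _ _ bF))).
by rewrite (expZ _ _ (bmeas_comp mZ2 (bFc _ _ bF))) eF.
Qed.

Let indist_cos F xi th : indist F ->
  indist (fun x => F x * cos (dotp xi x + th)).
Proof.
move=> [bF eF]; split=> [|eta ph]; first exact: bFc.
have E x : F x * cos (dotp xi x + th) * cos (dotp eta x + ph) =
    2^-1 * (F x * cos (dotp (xi + eta) x + (th + ph)) +
            F x * cos (dotp (xi - eta) x + (th - ph))).
  rewrite -mulrA cos_mul_cos mulrCA -mulrDr dotpDl dotpBl.
  by congr (_ * (_ * (cos _ + cos _))); ring.
under eq_Rintegral do rewrite E.
under [RHS]eq_Rintegral do rewrite E.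
have bE (a b : 'rV[R]_N) (s t : R) : @bmeas R _ (borel_rV R N)
    (fun x => F x * cos (dotp a x + s) + F x * cos (dotp b x + t)).
  by apply: bmeasD; exact: bFc.
rewrite (expZ _ _ (bmeas_comp mZ1 (bE _ _ _ _))).
rewrite (expZ _ _ (bmeas_comp mZ2 (bE _ _ _ _))).
rewrite (expD _ (bmeas_comp mZ1 (bFc _ _ bF)) (bmeas_comp mZ1 (bFc _ _ bF))).
rewrite (expD _ (bmeas_comp mZ2 (bFc _ _ bF)) (bmeas_comp mZ2 (bFc _ _ bF))).
by rewrite !eF.
Qed.

Let indist_cvg (F_ : nat -> 'rV[R]_N -> R) F M :
  (forall n, indist (F_ n)) -> (forall n x, `|F_ n x| <= M) ->
  (forall x, F_ n x @[n --> \oo] --> F x) -> indist F.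
Proof.
move=> iF FM FF.
have mF n : measurable_fun setT (F_ n : borel_rV R N -> R) by have [[]] := iF n.
have mF' : measurable_fun setT (F : borel_rV R N -> R).
  by apply: (measurable_fun_cvg mF) => x _; exact: FF.
have FM' x : `|F x| <= M.
  have c : (fun n => `|F_ n x|) @ \oo --> `|F x| by apply: cvg_norm; exact: FF.
  exact: (cvg_seq_le c).
split=> [|xi th]; first by split => //; exists M.
have cvgI (d : measure_display) (T : measurableType d) (P : probability T R)
    (Z : T -> 'rV[R]_N) : measurable_fun setT (Z : T -> borel_rV R N) ->
    \int[P]_w (F_ n (Z w) * cos (dotp xi (Z w) + th)) @[n --> \oo] -->
    \int[P]_w (F (Z w) * cos (dotp xi (Z w) + th)).
  move=> mZ; apply: (@exp_cvg _ _ _ _ _ _ M).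
  - by move=> n; have [bF _] := iF n; have [] := bmeas_comp mZ (bFc xi th bF).
  - move=> n w; rewrite normrM -[leRHS]mulr1 ler_pM//.
    exact: cos_max.
  - by move=> w; apply: cvgM; [exact: FF|exact: cvg_cst].
have c1 := cvgI _ _ P1 Z1 mZ1; have c2 := cvgI _ _ P2 Z2 mZ2.
have E : (fun n => \int[P1]_w (F_ n (Z1 w) * cos (dotp xi (Z1 w) + th))) =
         (fun n => \int[P2]_w (F_ n (Z2 w) * cos (dotp xi (Z2 w) + th))).
  by apply/funext => n; have [_ ->] := iF n.
by rewrite E in c1; exact: (cvg_unique (@Rhausdorff R) c1 c2).
Qed.

Let indistX F xi th n : indist F ->
  indist (fun x => F x * ((1 + cos (dotp xi x + th)) / 2) ^+ n).
Proof.
move=> iF; elim: n => [|n IHn].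
  by under eq_fun do rewrite expr0 mulr1.
have -> : (fun x => F x * ((1 + cos (dotp xi x + th)) / 2) ^+ n.+1) =
  (fun x => 2^-1 * (F x * ((1 + cos (dotp xi x + th)) / 2) ^+ n) +
   2^-1 * ((F x * ((1 + cos (dotp xi x + th)) / 2) ^+ n) * cos (dotp xi x + th))).
  by apply/funext => x; rewrite exprSr; field.
by apply: indistD; apply: indistZ => //; exact: indist_cos.
Qed.

Let indist_halfspace F xi th : indist F ->
  indist (fun x => F x * (0 <= cos (dotp xi x + th))%R%:R).
Proof.
move=> iF; have [[mF [M FM]] _] := iF.
pose u x : R := (1 + cos (dotp xi x + th)) / 2.
have u01 x : 0 <= u x <= 1.
  have := cos_geN1 (dotp xi x + th); have := cos_le1 (dotp xi x + th).
  by rewrite /u => ? ?; apply/andP; split; lra.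
have iFn n m : indist (fun x => F x * (1 - u x ^+ n) ^+ m).
  elim: m => [|m IHm]; first by under eq_fun do rewrite expr0 mulr1.
  have -> : (fun x => F x * (1 - u x ^+ n) ^+ m.+1) =
    (fun x => F x * (1 - u x ^+ n) ^+ m +
     (-1) * (F x * (1 - u x ^+ n) ^+ m * u x ^+ n)).
    by apply/funext => x; rewrite exprSr; ring.
  by apply: indistD => //; apply: indistZ; exact: indistX.
apply: (@indist_cvg (fun n x => F x * (1 - (1 - u x ^+ n) ^+ (n * 2 ^ n))) _ M).
- move=> n.
  have -> : (fun x => F x * (1 - (1 - u x ^+ n) ^+ (n * 2 ^ n))) =
    (fun x => F x + (-1) * (F x * (1 - u x ^+ n) ^+ (n * 2 ^ n))).
    by apply/funext => x; ring.
  by apply: indistD => //; apply: indistZ.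
- move=> n x; rewrite normrM -[leRHS]mulr1 ler_pM//.
  have /andP[u0 u1] := u01 x.
  have /andP[v0 v1] : 0 <= 1 - u x ^+ n <= 1.
    by rewrite subr_ge0 exprn_ile1//= lerBlDr lerDl exprn_ge0.
  have w0 : 0 <= (1 - u x ^+ n) ^+ (n * 2 ^ n) by rewrite exprn_ge0.
  have w1 : (1 - u x ^+ n) ^+ (n * 2 ^ n) <= 1 by rewrite exprn_ile1.
  by rewrite ger0_norm; lra.
- move=> x; apply: cvgM; first exact: cvg_cst.
  have -> : (0 <= cos (dotp xi x + th))%R = (2^-1 <= u x) by rewrite /u; lra.
  exact: threshold_cvg.
Qed.

Let halfspaces (s : seq ('rV[R]_N * R)) : set 'rV[R]_N :=
  [set x | all (fun p => 0 <= cos (dotp p.1 x + p.2)) s].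

(** Finite intersections of sets [0 <= cos (xi . x + th)] form a pi-system; their
    indicators are limits of products of cosines ([threshold_cvg]), and they
    generate the Borel sets because they cut out closed cubes ([ccube_cos]). *)
Theorem char_fun_unique :
  (forall xi, \int[P1]_w cos (dotp xi (Z1 w)) = \int[P2]_w cos (dotp xi (Z2 w))) ->
  (forall xi, \int[P1]_w sin (dotp xi (Z1 w)) = \int[P2]_w sin (dotp xi (Z2 w))) ->
  forall B : set (borel_rV R N), measurable B ->
  P1 (Z1 @^-1` B) = P2 (Z2 @^-1` B).
Proof.
move=> ecos esin.
have bsin (xi : 'rV[R]_N) : @bmeas R _ (borel_rV R N) (fun x => sin (dotp xi x)).
  have := bmeas_cos xi (- (pi / 2)); congr bmeas; apply/funext => x.
  by rewrite cosBpihalf.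
have bcos (xi : 'rV[R]_N) : @bmeas R _ (borel_rV R N) (fun x => cos (dotp xi x)).
  by have := bmeas_cos xi 0; congr bmeas; apply/funext => x; rewrite addr0.
have ind1 : indist (fun=> 1).
  split=> [|xi th]; first exact: bmeas_cst.
  have E x : 1 * cos (dotp xi x + th) =
      cos th * cos (dotp xi x) - sin th * sin (dotp xi x).
    by rewrite mul1r cosD mulrC [X in _ - X]mulrC.
  under eq_Rintegral do rewrite E.
  under [RHS]eq_Rintegral do rewrite E.
  rewrite (expB _ (bmeasZ _ (bmeas_comp mZ1 (bcos xi))) (bmeasZ _ (bmeas_comp mZ1 (bsin xi)))).
  rewrite (expB _ (bmeasZ _ (bmeas_comp mZ2 (bcos xi))) (bmeasZ _ (bmeas_comp mZ2 (bsin xi)))).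
  rewrite (expZ _ _ (bmeas_comp mZ1 (bcos xi))) (expZ _ _ (bmeas_comp mZ2 (bcos xi))).
  rewrite (expZ _ _ (bmeas_comp mZ1 (bsin xi))) (expZ _ _ (bmeas_comp mZ2 (bsin xi))).
  by rewrite ecos esin.
have hE s x : (x \in halfspaces s) = all (fun p => 0 <= cos (dotp p.1 x + p.2)) s.
  by apply/idP/idP; rewrite inE.
have mH s : measurable (halfspaces s : set (borel_rV R N)).
  elim: s => [|p s IHs].
    by rewrite (_ : halfspaces _ = setT)//; apply/seteqP; split.
  rewrite (_ : halfspaces _ = (fun x => cos (dotp p.1 x + p.2)) @^-1` `[0, +oo[
    `&` halfspaces s).
    apply: measurableI => //; rewrite -[X in measurable X]setTI.
    exact: cos_dotp_measurable.
  by apply/seteqP; split => x /=; rewrite in_itv /= andbT => /andP.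
have indH s : indist (fun x => (x \in halfspaces s)%:R).
  elim: s => [|p s IHs].
    by move: ind1; congr indist; apply/funext => x; rewrite mem_set.
  have := indist_halfspace p.1 p.2 IHs; congr indist; apply/funext => x.
  by rewrite -natrM mulnb !hE /= andbC.
have m12 s : P1 (Z1 @^-1` halfspaces s) = P2 (Z2 @^-1` halfspaces s).
  have [_ /(_ 0 0)] := indH s.
  under eq_Rintegral do rewrite dotp0l addr0 cos0 mulr1.
  under [RHS]eq_Rintegral do rewrite dotp0l addr0 cos0 mulr1.
  have preE d (T : measurableType d) (P : probability T R) (Z : T -> 'rV[R]_N) :
      measurable_fun setT (Z : T -> borel_rV R N) ->
      P (Z @^-1` halfspaces s) = (\int[P]_w (Z w \in halfspaces s)%:R)%:E.
    move=> mZ; have mA : measurable (Z @^-1` halfspaces s).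
      by rewrite -[X in measurable X]setTI; exact: (mZ measurableT _ (mH s)).
    rewrite -[LHS]fineK ?fin_num_measure// -exp_indic//; congr (_%:E).
  by move=> e12; rewrite (preE _ _ P1)// (preE _ _ P2)// e12.
pose X1 : {mfun T1 >-> borel_rV R N} := HB.pack (Z1 : T1 -> borel_rV R N)
  (isMeasurableFun.Build _ _ _ _ _ mZ1).
pose X2 : {mfun T2 >-> borel_rV R N} := HB.pack (Z2 : T2 -> borel_rV R N)
  (isMeasurableFun.Build _ _ _ _ _ mZ2).
move=> B mB.
apply: (@g_sigma_algebra_measure_unique _ R (borel_rV R N) (range halfspaces)
  _ (fun=> setT) _ _ (distribution P1 X1) (distribution P2 X2)).
- by move=> _ [s _ <-]; exact: mH.
- by move=> _; exists [::] => //; apply/seteqP; split.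
- by apply/seteqP; split => // x _; exists 0%N.
- move=> _ _ [s _ <-] [s' _ <-]; exists (s ++ s') => //.
  by apply/seteqP; split => x; rewrite /halfspaces /= all_cat => /andP.
- by move=> _ [s _ <-]; exact: m12.
- by move=> _; rewrite (le_lt_trans (probability_le1 _ measurableT))// ltry.
apply: (borel_sub_sigma _ mB) => c v v0.
have [s0 sC sU] : sigma_algebra setT <<s range halfspaces >>.
  exact: smallest_sigma_algebra.
have sT : <<s range halfspaces >> setT.
  by apply: sub_sigma_algebra; exists [::] => //; apply/seteqP; split.
have sI (F : nat -> set 'rV[R]_N) :
    (forall n, <<s range halfspaces >> (F n)) ->
    <<s range halfspaces >> (\bigcap_n F n).
  move=> hF; rewrite -[X in <<s _ >> X]setCK setC_bigcap -setTD; apply: (sC).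
  by apply: (sU) => n; rewrite -setTD; exact: sC.
pose a j : R := pi / 2 / v / 2 ^+ j.
pose S j := [seq (a j *: (delta_mx 0 i : 'rV[R]_N), - (a j * c 0 i)) | i <- enum 'I_N].
rewrite (_ : ccube c v = \bigcap_j halfspaces (S j)).
  by apply: sI => j; apply: sub_sigma_algebra; exists (S j).
apply/seteqP; split => [x xc j _|x xS i].
  rewrite /halfspaces /= all_map; apply/allP => i _ /=.
  rewrite dotp_delta -mulrBr; have [H _] := @ccube_cos _ (x 0 i - c 0 i) v v0; exact: (H (xc i)).
have [_] := @ccube_cos _ (x 0 i - c 0 i) v v0; apply => j; have := xS j Logic.I.
rewrite /halfspaces /= all_map => /allP/(_ i).
by rewrite mem_enum => /(_ isT) /=; rewrite dotp_delta -mulrBr.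
Qed.

End CharacteristicFunction.

(** * The stable process *)

Lemma measure_ae_eq {R : realType} {d : measure_display} {T : measurableType d}
    (P : probability T R) (A B : set T) : measurable A -> measurable B ->
  {ae P, forall w, A w <-> B w} -> P A = P B.
Proof.
move=> mA mB [M [mM PM sub]].
have le C D : measurable C -> measurable D -> ~` [set w | C w <-> D w] `<=` M ->
    (P C <= P D)%E.
  move=> mC mD sCD; apply: (@le_trans _ _ (P (D `|` M))).
    rewrite le_measure ?inE//; first exact: measurableU.
    move=> w Cw; have [Mw|Mw] := pselect (M w); first by right.
    left; apply: contrapT => Dw; apply: Mw; apply: sCD => /= CD.
    by apply: Dw; apply/CD.
  by apply: (le_trans (measureU2 _ mD mM)); rewrite [X in (_ + X)%E]PM adde0.
apply/eqP; rewrite eq_le; apply/andP; split; apply: le => // w nw; apply: sub.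
by move=> /= AB; apply: nw => /=; split => [/AB|/AB].
Qed.

Section StableProcess.
Context {R : realType} {N : nat} {d : measure_display} {Omega : measurableType d}.
Variables (P : probability Omega R) (Y : R -> Omega -> 'rV[R]_N) (alpha : R).
Hypotheses (alpha0 : 0 < alpha) (levyY : is_levy_process P Y).
Hypothesis charY : forall (t : R) (xi : 'rV[R]_N), 0 <= t ->
  char_fun P (Y t) xi = real_complex R (expR (- (t * enorm xi `^ alpha))).

Let mY t : 0 <= t -> measurable_fun setT (Y t : Omega -> borel_rV R N).
Proof. by move=> t0; have [mY _ _ _ _] := levyY; exact: mY. Qed.

Lemma stable_cos t xi : 0 <= t ->
  \int[P]_w cos (dotp xi (Y t w)) = expR (- (t * enorm xi `^ alpha)).
Proof. by move=> t0; have [] := charY xi t0. Qed.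

Lemma stable_sin t xi : 0 <= t -> \int[P]_w sin (dotp xi (Y t w)) = 0.
Proof. by move=> t0; have [] := charY xi t0. Qed.

Lemma increment_measurable s t : 0 <= s -> 0 <= t ->
  measurable_fun setT (increment Y s t : Omega -> borel_rV R N).
Proof.
move=> s0 t0; apply: measurable_rV => i.
under eq_fun do rewrite mxE mxE.
apply: measurable_funB; exact: (measurableT_comp (coord_measurable i) (mY _)).
Qed.

Lemma increment_law s t (B : set (borel_rV R N)) : 0 <= s -> s <= t ->
  measurable B -> P (increment Y s t @^-1` B) = P (Y (t - s) @^-1` B).
Proof.
move=> s0 st mB; have ts0 : 0 <= t - s by rewrite subr_ge0.
have [_ Y0 _ statY _] := levyY.
rewrite -[X in increment Y s X](subrKC s) (statY _ _ _ s0 ts0 mB).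
apply: measure_ae_eq.
- rewrite -[X in measurable X]setTI.
  exact: (increment_measurable (lexx 0) ts0).
- by rewrite -[X in measurable X]setTI; exact: mY.
apply: filterS Y0 => w Yw0.
by rewrite /preimage /= /increment Yw0 subr0.
Qed.

(** Linear images of the process are recognised through their characteristic
    functions: this gives both self-similarity and isotropy. *)
Lemma stable_linear (A A' : 'rV[R]_N -> 'rV[R]_N) t s (B : set (borel_rV R N)) :
  0 <= t -> 0 <= s ->
  (forall xi x, dotp xi (A x) = dotp (A' xi) x) ->
  (forall xi, t * enorm (A' xi) `^ alpha = s * enorm xi `^ alpha) ->
  measurable_fun setT (A : borel_rV R N -> borel_rV R N) ->
  measurable B -> P ((fun w => A (Y t w)) @^-1` B) = P (Y s @^-1` B).
Proof.
move=> t0 s0 AA' nA' mA mB.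
apply: char_fun_unique => //; [exact: (measurableT_comp mA (mY t0))|exact: mY| |].
- move=> xi; under eq_Rintegral do rewrite AA'.
  by rewrite (stable_cos (A' xi) t0) (stable_cos xi s0) nA'.
- move=> xi; under eq_Rintegral do rewrite AA'.
  by rewrite (stable_sin (A' xi) t0) (stable_sin xi s0).
Qed.

Lemma scale_measurable (c : R) :
  measurable_fun setT (( *:%R c) : borel_rV R N -> borel_rV R N).
Proof.
apply: measurable_rV => i; under eq_fun do rewrite mxE.
by apply: measurable_funM; [exact: measurable_cst|exact: coord_measurable].
Qed.

Lemma stable_scaling c t (B : set (borel_rV R N)) : 0 <= t -> measurable B ->
  P ((fun w => c *: Y t w) @^-1` B) = P (Y (`|c| `^ alpha * t) @^-1` B).
Proof.
move=> t0 mB; apply: (@stable_linear _ ( *:%R c)) => //.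
- by rewrite mulr_ge0// powR_ge0.
- by move=> xi x; rewrite dotpZl dotpZr.
- by move=> xi; rewrite enormZ powRM ?enorm_ge0//; ring.
- exact: scale_measurable.
Qed.

Lemma stable_sym t (B : set (borel_rV R N)) : 0 <= t -> measurable B ->
  P ((fun w => - Y t w) @^-1` B) = P (Y t @^-1` B).
Proof.
move=> t0 mB; have -> : (fun w => - Y t w) = (fun w => -1 *: Y t w).
  by apply/funext => w; rewrite scaleN1r.
by rewrite (stable_scaling (-1) t0 mB) normrN1 powR1 mul1r.
Qed.

End StableProcess.

(** * Elementary inequalities *)

Section TrigInequalities.
Context {R : realType}.
Implicit Types x : R.

Lemma sin_le x : 0 <= x -> sin x <= x.
Proof.
rewrite le_eqVlt => /predU1P[<-|x0]; first by rewrite sin0.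
have [|c _] := @MVT _ (@sin R) (@cos R) _ _ x0 (fun y _ => is_derive_sin y).
  by apply: continuous_subspaceT; exact: continuous_sin.
rewrite sin0 !subr0 => ->.
by rewrite ger_pMl// cos_le1.
Qed.

Lemma onem_cosE x : 1 - cos x = 2 * sin (x / 2) ^+ 2.
Proof.
have {1}-> : x = (x / 2) *+ 2 by rewrite -mulr_natr divfK.
by rewrite cos_mulr2n cos2sin2; ring.
Qed.

Lemma onem_cos_le x : 1 - cos x <= x ^+ 2 / 2.
Proof.
wlog x0 : x / 0 <= x.
  move=> H; have [/H//|x0] := leP 0 x.
  by rewrite -cosN -sqrrN; apply: H; rewrite oppr_ge0 ltW.
rewrite onem_cosE; have h : `|sin (x / 2)| <= x / 2.
  have x20 : 0 <= x / 2 by rewrite divr_ge0.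
  have [s0|s0] := leP 0 (sin (x / 2)); first by rewrite ger0_norm// sin_le.
  rewrite ltr0_norm//.
  (* If the sine is negative then x / 2 > pi >= 2, which already exceeds 1. *)
  have xpi : pi < x / 2.
    rewrite ltNge; apply/negP => xpi; move: s0; rewrite ltNge sin_ge0_pi//.
    by rewrite x20.
  have := sin_geN1 (x / 2); have := pi_ge2 R; lra.
have : sin (x / 2) ^+ 2 <= (x / 2) ^+ 2.
  by rewrite -real_normK ?num_real// ler_pXn2r// ?nnegrE ?divr_ge0.
lra.
Qed.

Lemma sin_ge_cubic x : 0 <= x -> x - x ^+ 3 / 6 <= sin x.
Proof.
rewrite le_eqVlt => /predU1P[<-|x0]; first by rewrite sin0; lra.
pose g y : R := sin y - y + y ^+ 3 / 6.
pose g' y : R := cos y - 1 + y ^+ 2 / 2.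
have dg (y : R) : is_derive y (1 : R) g (g' y).
  rewrite /g /g'; apply: is_derive_eq.
  by rewrite /GRing.scale /=; field.
have cg : {within `[0, x], continuous g}.
  apply: continuous_subspaceT => y.
  by apply/differentiable_continuous/derivable1_diffP; have := dg y.
have [c _] := @MVT _ g g' _ _ x0 (fun y _ => dg y) cg.
have g0 : g 0 = 0 by rewrite /g sin0; lra.
rewrite g0 !subr0 => gx.
have : 0 <= g x.
  rewrite gx mulr_ge0 ?(ltW x0)// /g'; have := onem_cos_le c; lra.
by rewrite /g; lra.
Qed.

Lemma sqr_sub_cos_le x : x ^+ 2 - x ^+ 4 / 12 <= 2 - 2 * cos x.
Proof.
wlog x0 : x / 0 <= x.
  move=> H; have [/H//|x0] := leP 0 x.
  have -> : x ^+ 2 - x ^+ 4 / 12 = (- x) ^+ 2 - (- x) ^+ 4 / 12 by ring.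
  by rewrite -cosN; apply: H; rewrite oppr_ge0 ltW.
have [x4|x4] := leP x 4; last first.
  have := cos_le1 x; have : 16 < x ^+ 2 by rewrite expr2; nra.
  by move=> ? ?; rewrite (_ : x ^+ 4 = x ^+ 2 * x ^+ 2); [nra|ring].
have := @sin_ge_cubic (x / 2) _; have := onem_cosE x.
move: (sin (x / 2)) => s ce H; have {}H := H (divr_ge0 x0 (ler0n _ _)).
have h1 : 0 <= x / 2 - (x / 2) ^+ 3 / 6.
  have -> : x / 2 - (x / 2) ^+ 3 / 6 = x / 2 * (1 - x * x / 24) by field.
  by rewrite mulr_ge0 ?divr_ge0//; nra.
have h2 : (x / 2 - (x / 2) ^+ 3 / 6) ^+ 2 <= s ^+ 2.
  by rewrite ler_pXn2r// ?nnegrE// (le_trans h1).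
have e : (x / 2 - (x / 2) ^+ 3 / 6) ^+ 2 =
  x ^+ 2 / 4 - x ^+ 4 / 48 + ((x / 2) ^+ 3 / 6) ^+ 2 by field.
have := sqr_ge0 ((x / 2) ^+ 3 / 6); rewrite e in h2; lra.
Qed.

Lemma sqr_le_cos x : `|x| <= pi -> x ^+ 2 <= 12 * (2 - 2 * cos x).
Proof.
wlog x0 : x / 0 <= x.
  move=> H; have [/H//|x0] := leP 0 x.
  by rewrite -cosN -sqrrN -normrN; apply: H; rewrite oppr_ge0 ltW.
rewrite ger0_norm// => xpi.
have [x2|x2] := leP x 2.
  have := sqr_sub_cos_le x; have : x ^+ 4 <= 4 * x ^+ 2.
    rewrite (_ : x ^+ 4 = x ^+ 2 * x ^+ 2); last ring.
    by rewrite ler_wpM2r ?sqr_ge0// expr2; nra.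
  have := sqr_ge0 x; lra.
have pi4 : pi < 4 :> R by have := @pihalf_lt2 R; lra.
have : cos x <= 0.
  rewrite -[x](subrK pi) cosDpi oppr_le0; apply: cos_ge0_pihalf.
  by apply/andP; split; lra.
by rewrite expr2; nra.
Qed.

End TrigInequalities.

Lemma expRN_le_powN {R : realType} (n : nat) (y : R) : 0 < y ->
  expR (- y) <= (n%:R / y) ^+ n.
Proof.
move=> y0; case: n => [|n]; first by rewrite expr0 -expR0 ler_expR; lra.
have n0 : 0 < n.+1%:R :> R by rewrite ltr0n.
have -> : - y = n.+1%:R * - (y / n.+1%:R) by field; rewrite gt_eqF.
rewrite expRM_natl ler_pXn2r ?nnegrE ?expR_ge0 ?divr_ge0 ?(ltW y0)//.
rewrite expRN -[leRHS]invf_div lef_pV2 ?posrE ?expR_gt0 ?divr_gt0//.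
by rewrite (le_trans _ (expR_ge1Dx _))// lerDr.
Qed.

(** Stretched exponentials are summable over the integers. *)
Lemma sum_expR_powR_bounded {R : realType} (c alpha : R) :
  0 < c -> 0 < alpha ->
  exists C, 0 < C /\ forall m : nat, \sum_(j < m) expR (- (c * j%:R `^ alpha)) <= C.
Proof.
move=> c0 a0.
pose n := (Num.truncn (2 / alpha)).+1.
have na : 2 <= alpha * n%:R.
  by rewrite mulrC -ler_pdivrMr// ltW// truncnS_gt.
pose K := (n%:R / c) ^+ n.
have K0 : 0 < K by rewrite exprn_gt0// divr_gt0// ltr0n.
have tail (j : nat) : expR (- (c * j.+1%:R `^ alpha)) <= K * (j.+1%:R ^+ 2)^-1.
  have j0 : 0 < j.+1%:R :> R by rewrite ltr0n.
  apply: (le_trans (expRN_le_powN n _)); first by rewrite mulr_gt0// powR_gt0.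
  rewrite invfM mulrA exprMn -/K ler_wpM2l ?(ltW K0)//.
  rewrite exprVn lef_pV2 ?posrE ?exprn_gt0 ?powR_gt0//.
  rewrite -[leLHS]powR_mulrn ?ler0n// -[leRHS]powR_mulrn ?powR_ge0// -powRrM.
  by apply: ler_powR => //; rewrite ler1n.
(* Telescoping: 1 / (j+1)^2 <= 2 / (j+1) - 2 / (j+2). *)
have sumV m : \sum_(j < m) ((j.+1%:R : R) ^+ 2)^-1 <= 2 - 2 / m.+1%:R.
  elim: m => [|m IHm]; first by rewrite big_ord0 divr1 subrr.
  rewrite big_ord_recr /= (le_trans (lerD IHm (lexx _)))//.
  have m1 : 1 <= m.+1%:R :> R by rewrite ler1n.
  rewrite -(natr1 m.+1); move: (m.+1%:R : R) m1 => u u1.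
  have u0 : 0 < u by lra.
  rewrite -subr_ge0.
  have -> : 2 - 2 / (u + 1) - (2 - 2 / u + (u ^+ 2)^-1) =
      (u - 1) / (u ^+ 2 * (u + 1)) by field; apply/andP; split; lra.
  by rewrite divr_ge0 ?mulr_ge0 ?sqr_ge0//; lra.
exists (1 + K * 2); split; first by nra.
case=> [|m]; first by rewrite big_ord0; nra.
rewrite big_ord_recl /= powR0 ?gt_eqF// mulr0 oppr0 expR0 lerD2l.
apply: (@le_trans _ _ (K * \sum_(j < m) ((j.+1%:R : R) ^+ 2)^-1)).
  by rewrite mulr_sumr ler_sum.
rewrite ler_wpM2l ?(ltW K0)// (le_trans (sumV m))// gerBl divr_ge0//.
Qed.

(** * Boundedness of the density *)

(** The Fejer kernel: nonnegative, of order [m] near the origin, and with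
    nonnegative Fourier coefficients. *)
Definition fejer {R : realType} (m : nat) (th : R) : R :=
  m%:R^-1 * \sum_(a < m) \sum_(b < m) cos ((a%:R - b%:R) * th).

Lemma fejerE {R : realType} (m : nat) (th : R) :
  fejer m th = m%:R^-1 * ((\sum_(a < m) cos (a%:R * th)) ^+ 2 +
                          (\sum_(a < m) sin (a%:R * th)) ^+ 2).
Proof.
rewrite /fejer; congr (_ * _); rewrite !expr2 !big_distrl -big_split/=.
apply: eq_bigr => a _; rewrite !big_distrr -big_split/=.
by apply: eq_bigr => b _; rewrite mulrBl cosB.
Qed.

Lemma fejer_ge0 {R : realType} (m : nat) (th : R) : 0 <= fejer m th.
Proof. by rewrite fejerE mulr_ge0 ?invr_ge0// addr_ge0// sqr_ge0. Qed.

Lemma fejer_near0 {R : realType} (m : nat) (th : R) :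
  (m.-1%:R * `|th| <= 1) -> m%:R <= 4 * fejer m th.
Proof.
move=> mth; have [->|m0] := posnP m; first by rewrite mulr_ge0// fejer_ge0.
have m0' : 0 < m%:R :> R by rewrite ltr0n.
have cosge a : (a < m)%N -> 2^-1 <= cos (a%:R * th).
  move=> am; have := onem_cos_le (a%:R * th).
  have : (a%:R * th) ^+ 2 <= 1.
    rewrite -real_normK ?num_real// exprn_ile1// normrM normr_nat.
    apply: le_trans mth; rewrite ler_wpM2r// ler_nat.
    by rewrite -ltnS prednK.
  lra.
have : m%:R * 2^-1 <= \sum_(a < m) cos (a%:R * th).
  have -> : m%:R * 2^-1 = \sum_(a < m) (2^-1 : R).
    by rewrite sumr_const card_ord mulr_natl.
  by apply: ler_sum => a _; exact: cosge.
set S := \sum_(a < m) _ => hS.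
have : (m%:R * 2^-1) ^+ 2 <= S ^+ 2.
  by rewrite ler_pXn2r ?nnegrE ?(le_trans _ hS)// mulr_ge0.
rewrite fejerE -/S => hS2; have := sqr_ge0 (\sum_(a < m) sin (a%:R * th)).
set T := _ ^+ 2 => T0.
rewrite mulrCA ler_pdivlMl//.
have -> : m%:R * m%:R = 4 * (m%:R * 2^-1) ^+ 2 :> R by field.
lra.
Qed.

Lemma sum_sym_diff_le {R : realType} (f : R -> R) (m : nat) C :
  (forall x, 0 <= f x) -> (forall x, f (- x) = f x) ->
  (forall n : nat, \sum_(j < n) f j%:R <= C) ->
  m%:R^-1 * (\sum_(a < m) \sum_(b < m) f (a%:R - b%:R)) <= 2 * C.
Proof.
move=> f0 fN fC.
have C0 : 0 <= C by have := fC 0%N; rewrite big_ord0.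
have [->|m0] := posnP m; first by rewrite big_ord0 mulr0 mulr_ge0.
rewrite ler_pdivrMl ?ltr0n//.
have -> : m%:R * (2 * C) = \sum_(a < m) (2 * C).
  by rewrite sumr_const card_ord mulr_natl.
apply: ler_sum => a _.
rewrite -(big_mkord xpredT (fun b => f (a%:R - b%:R))).
rewrite (@big_cat_nat _ _ _ a) ?(ltnW (ltn_ord a))//=.
have -> : 2 * C = C + C by ring.
apply: lerD.
  rewrite big_nat_rev /= add0n.
  apply: (le_trans _ (fC a.+1)); rewrite big_ord_recl -[leLHS]add0r.
  apply: lerD; first exact: f0.
  rewrite big_mkord ler_sum// => b _ /=.
  by rewrite -natrB ?leq_subr// subKn// /bump leq0n add1n.
apply: (le_trans _ (fC (m - a)%N)).
rewrite -{1}[nat_of_ord a]add0n big_addn big_mkord ler_sum// => b _.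
by rewrite natrD opprD addrCA subrr addr0 fN.
Qed.

Section StableVector.
Context {R : realType} {N : nat} {d : measure_display} {Omega : measurableType d}.
Variables (P : probability Omega R) (Z : Omega -> 'rV[R]_N) (alpha tau : R).
Hypotheses (alpha0 : 0 < alpha) (tau0 : 0 < tau).
Hypothesis mZ : measurable_fun setT (Z : Omega -> borel_rV R N).
Hypothesis cosZ : forall xi,
  \int[P]_w cos (dotp xi (Z w)) = expR (- (tau * enorm xi `^ alpha)).
Hypothesis sinZ : forall xi, \int[P]_w sin (dotp xi (Z w)) = 0.

Lemma exp_cos_shift xi th : \int[P]_w cos (dotp xi (Z w) + th) =
  cos th * expR (- (tau * enorm xi `^ alpha)).
Proof.
have bc : bmeas (fun w => cos (dotp xi (Z w))).
  have := bmeas_comp mZ (bmeas_cos xi 0); congr bmeas; apply/funext => w.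
  by rewrite addr0.
have bs : bmeas (fun w => sin (dotp xi (Z w))).
  have := bmeas_comp mZ (bmeas_cos xi (- (pi / 2))); congr bmeas.
  by apply/funext => w; rewrite cosBpihalf.
under eq_Rintegral do rewrite cosD ![cos _ * cos th]mulrC ![sin _ * sin th]mulrC.
rewrite (expB _ (bmeasZ _ bc) (bmeasZ _ bs)) !expZ//.
by rewrite cosZ sinZ mulr0 subr0.
Qed.

Let phi (x : R) := expR (- (tau / N.+1%:R * `|x| `^ alpha)).

Let phi_ge0 x : 0 <= phi x. Proof. exact: expR_ge0. Qed.

Let phiN x : phi (- x) = phi x. Proof. by rewrite /phi normrN. Qed.

Let exp_le_phi (xi : 'rV[R]_N) :
  expR (- (tau * enorm xi `^ alpha)) <= \prod_i phi (xi 0 i).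
Proof.
rewrite -expR_sum ler_expR sumrN lerN2.
have N0' : 0 < N.+1%:R :> R by rewrite ltr0n.
apply: (@le_trans _ _ (\sum_(i < N) (tau / N.+1%:R * enorm xi `^ alpha))).
  apply: ler_sum => i _; rewrite ler_wpM2l ?divr_ge0 ?(ltW tau0)//.
  rewrite ge0_ler_powR ?nnegrE ?enorm_ge0 ?(ltW alpha0)//.
  rewrite -sqrtr_sqr ler_sqrt ?dotp_ge0// /dotp (bigD1 i)//= -expr2 lerDl.
  by apply: sumr_ge0 => j _; rewrite -expr2 sqr_ge0.
rewrite sumr_const card_ord -[leLHS]mulr_natl.
have -> (e : R) : N%:R * (tau / N.+1%:R * e) = N%:R / N.+1%:R * (tau * e).
  by field; rewrite gt_eqF.
by rewrite ler_piMl ?mulr_ge0 ?(ltW tau0) ?powR_ge0// ler_pdivrMr// mul1r ler_nat.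
Qed.

Lemma fejer_measurable m (i : 'I_N) (c : R) :
  bmeas (fun w => fejer m (Z w 0 i - c)).
Proof.
apply: bmeasZ; apply: bmeas_sum => a _; apply: bmeas_sum => b _.
have := bmeas_comp mZ (bmeas_cos ((a%:R - b%:R) *: delta_mx 0 i)
  (- ((a%:R - b%:R) * c))).
by congr bmeas; apply/funext => w; rewrite dotp_delta mulrBr.
Qed.

(** Expanding the Fejer kernels into cosines, every resulting frequency
    contributes at most the product of the weights [phi] of its coordinates. *)
Let fejer_exp (C : R) (m : 'I_N -> nat) (c : 'rV[R]_N) (s : seq 'I_N) :
  (forall n : nat, \sum_(j < n) phi j%:R <= C) -> uniq s ->
  forall (xi : 'rV[R]_N) th, (forall i, i \in s -> xi 0 i = 0) ->
  `|\int[P]_w (cos (dotp xi (Z w) + th) *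
      \prod_(i <- s) fejer (m i) (Z w 0 i - c 0 i))| <=
  (2 * C) ^+ size s * \prod_(i | i \notin s) phi (xi 0 i).
Proof.
move=> hC; have C0 : 0 <= C by have := hC 0%N; rewrite big_ord0.
elim: s => [_ xi th _|i s IHs /= /andP[nis us] xi th xis].
  under eq_Rintegral do rewrite big_nil mulr1.
  rewrite exp_cos_shift expr0 mul1r (le_trans _ (exp_le_phi xi))//.
  by rewrite normrM (ger0_norm (expR_ge0 _)) ler_piMl ?expR_ge0// cos_max.
pose G w := \prod_(i <- s) fejer (m i) (Z w 0 i - c 0 i).
have bG : bmeas G by apply: bmeas_prod => j _; exact: fejer_measurable.
pose k a b : R := a%:R - b%:R.
pose e a b sg := xi + (sg * k a b) *: (delta_mx 0 i : 'rV[R]_N).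
pose T a b sg w := cos (dotp (e a b sg) (Z w) + (th - sg * k a b * c 0 i)) * G w.
have bT a b sg : bmeas (T a b sg).
  by apply: bmeasM => //; exact: (bmeas_comp mZ (bmeas_cos _ _)).
pose B := (2 * C) ^+ size s * \prod_(j | j \notin i :: s) phi (xi 0 j).
have B0 : 0 <= B by rewrite mulr_ge0 ?exprn_ge0 ?mulr_ge0// prodr_ge0.
have TB (a b : nat) sg : (sg == 1) || (sg == -1) ->
    `|\int[P]_w T a b sg w| <= B * phi (k a b).
  move=> sg1; apply: (le_trans (IHs us _ _ _)).
    move=> j js; rewrite mxE xis ?inE ?js ?orbT// !mxE eqxx /=.
    by case: eqVneq js nis => [->->//|_ _ _]; rewrite mulr0 addr0.
  rewrite /B -mulrA ler_wpM2l ?exprn_ge0 ?mulr_ge0//.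
  rewrite (bigD1 i)//= mulrC ler_pM ?prodr_ge0//.
    rewrite le_eqVlt; apply/orP; left; apply/eqP; apply: eq_big.
      by move=> j; rewrite inE negb_or andbC.
    move=> j /andP[_ ji]; rewrite !mxE eqxx /= (negbTE ji).
    by rewrite mulr0 addr0.
  rewrite !mxE !eqxx xis ?mem_head// mulr1 add0r.
  by case/orP: sg1 => /eqP ->; rewrite ?mul1r ?mulN1r ?phiN.
have E w : cos (dotp xi (Z w) + th) *
    \prod_(j <- i :: s) fejer (m j) (Z w 0 j - c 0 j) =
    (m i)%:R^-1 * \sum_(a < m i) \sum_(b < m i)
      (2^-1 * (T a b 1 w + T a b (-1) w)).
  rewrite big_cons {1}/fejer !mulrA -/(G w) [cos _ * _]mulrC -!mulrA.
  congr (_ * _); rewrite mulrCA mulr_suml; apply: eq_bigr => a _.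
  rewrite mulr_suml; apply: eq_bigr => b _.
  rewrite /T -mulrDl [RHS]mulrA.
  transitivity (cos (dotp xi (Z w) + th) *
      cos ((a%:R - b%:R) * (Z w 0 i - c 0 i)) * G w); first by ring.
  congr (_ * _); rewrite cos_mul_cos /e !dotpDl !dotp_delta.
  by congr (_ * (cos _ + cos _)); rewrite /k; ring.
under eq_Rintegral do rewrite E.
have bTT a b : bmeas (fun w => 2^-1 * (T a b 1 w + T a b (-1) w)).
  by apply: bmeasZ; exact: bmeasD.
rewrite expZ; last by apply: bmeas_sum => a _; apply: bmeas_sum => b _.
rewrite exp_sum; last by move=> a _; apply: bmeas_sum => b _.
rewrite normrM ger0_norm ?invr_ge0//.
apply: (@le_trans _ _ ((m i)%:R^-1 *
    \sum_(a < m i) \sum_(b < m i) (B * phi (k a b)))).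
  rewrite ler_wpM2l ?invr_ge0// (le_trans (ler_norm_sum _ _ _))//.
  apply: ler_sum => a _; rewrite exp_sum//.
  rewrite (le_trans (ler_norm_sum _ _ _))//; apply: ler_sum => b _.
  rewrite expZ ?expD//; last exact: bmeasD.
  rewrite normrM ger0_norm ?invr_ge0// ler_pdivrMl//.
  rewrite (le_trans (ler_normD _ _))// mulr2n mulrDl mul1r.
  by rewrite lerD// TB// eqxx ?orbT.
have -> : (2 * C) ^+ size (i :: s) * \prod_(j | j \notin i :: s) phi (xi 0 j) =
    B * (2 * C) by rewrite /= exprS /B; ring.
under eq_bigr do rewrite -mulr_sumr.
rewrite -mulr_sumr mulrCA ler_wpM2l//.
exact: sum_sym_diff_le.
Qed.

(** The indicator of a box of side of order [1 / m] is at most a multiple of a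
    product of Fejer kernels of order [m], whose expectation is bounded because
    its Fourier coefficients are at most 1 and the characteristic function is
    summable over the integer lattice. *)
Lemma stable_density_bounded : exists C : R, 0 <= C /\
  forall a b : 'rV[R]_N, (P (Z @^-1` box a b) <= (C * box_volume a b)%:E)%E.
Proof.
have [C [C0 hC]] := sum_expR_powR_bounded
  (divr_gt0 tau0 (ltr0Sn R N)) alpha0.
have hC' (n : nat) : \sum_(j < n) phi j%:R <= C.
  by apply: le_trans (hC n); apply: ler_sum => j _; rewrite /phi normr_nat.
exists ((8 * C) ^+ N); split; first by rewrite exprn_ge0// mulr_ge0// ltW.
move=> a b; have vol0 : 0 <= box_volume a b.
  by apply: prodr_ge0 => i _; rewrite le_max lexx.
have [[i bai]|ab] := pselect (exists i, b 0 i <= a 0 i).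
  rewrite (_ : box a b = set0) ?preimage_set0 ?measure0; last first.
    apply/seteqP; split => // x /(_ i) /andP[h1 h2].
    by have := lt_le_trans h1 (le_trans h2 bai); rewrite ltxx.
  by rewrite lee_fin mulr_ge0// exprn_ge0// mulr_ge0// ltW.
have {}ab i : a 0 i < b 0 i by rewrite ltNge; apply/negP => ?; apply: ab; exists i.
pose c : 'rV[R]_N := 2^-1 *: (a + b).
have [v vE] : {v : 'I_N -> R | forall i, v i = (b 0 i - a 0 i) / 2} by eexists.
have v0 i : 0 < v i by rewrite vE divr_gt0// subr_gt0.
pose m i := (maxn 1 (Num.truncn (v i)^-1)).
have mv i : (m i)%:R^-1 <= b 0 i - a 0 i.
  rewrite (_ : b 0 i - a 0 i = 2 * v i); last by rewrite vE; field.
  rewrite -[leRHS]invrK lef_pV2 ?posrE ?invr_gt0 ?mulr_gt0 ?ltr0n ?leq_max//.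
  have := truncnS_gt (v i)^-1; rewrite -natr1 /m.
  case: (Num.truncn _) => [|k] kv; first by move: kv; rewrite invfM (_ : maxn 1 0 = 1%N)//; lra.
  have -> : maxn 1 k.+1 = k.+1 by apply/maxn_idPr.
  have : 1 <= k.+1%:R :> R by rewrite ler1n.
  by move: kv; rewrite invfM; lra.
have mB : measurable (Z @^-1` box a b).
  by rewrite -[X in measurable X]setTI; apply: mZ => //; exact: box_measurable.
pose F w := cos (dotp (0 : 'rV[R]_N) (Z w) + 0) *
  \prod_(i <- enum 'I_N) fejer (m i) (Z w 0 i - c 0 i).
have bF : bmeas F.
  apply: bmeasM; first exact: (bmeas_comp mZ (bmeas_cos _ _)).
  by apply: bmeas_prod => i _; exact: fejer_measurable.
have FE w : F w = \prod_i fejer (m i) (Z w 0 i - c 0 i).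
  by rewrite /F dotp0l addr0 cos0 mul1r big_enum.
have := @fejer_exp C m c (enum 'I_N) hC' (enum_uniq _) 0 0 (fun i _ => mxE _ _ _ _).
rewrite size_enum_ord big1 ?mulr1; last by move=> i; rewrite mem_enum.
move=> /(le_trans (ler_norm _)) EF.
rewrite -[leLHS]fineK ?fin_num_measure// lee_fin -exp_indic//.
apply: (@le_trans _ _ (\int[P]_w ((\prod_i (4 / (m i)%:R)) * F w))).
  apply: le_exp; [exact: bmeas_indic|exact: bmeasZ|move=> w].
  rewrite FE -big_split/= indicE; have [/set_mem wB|_] := boolP (w \in _); last first.
    by apply: prodr_ge0 => i _; rewrite mulr_ge0 ?fejer_ge0// divr_ge0.
  rewrite [leLHS](_ : _ = \prod_(i < N) (1 : R)); last by rewrite big1_eq.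
  apply: ler_prod => i _; rewrite ler01 mulrAC.
  rewrite ler_pdivlMr ?ltr0n ?leq_max// mul1r fejer_near0//.
  have /andP[h1 h2] := wB i.
  have h : `|Z w 0 i - c 0 i| <= v i.
    by rewrite vE /c !mxE ler_norml; apply/andP; split; lra.
  apply: (@le_trans _ _ ((m i).-1%:R * v i)); first by rewrite ler_wpM2l.
  rewrite /m; case: (leqP 1 (Num.truncn (v i)^-1)) => h3; last by rewrite mul0r.
  rewrite -ler_pdivlMr// mul1r.
  apply: (@le_trans _ _ (Num.truncn (v i)^-1)%:R).
    by rewrite ler_nat leq_pred.
  by rewrite truncn_le invr_ge0 ltW.
rewrite expZ//; apply: (@le_trans _ _ ((\prod_i (4 / (m i)%:R)) * (2 * C) ^+ N)).
  by rewrite ler_wpM2l// prodr_ge0// => i _; rewrite divr_ge0.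
have -> : (8 * C) ^+ N * box_volume a b =
    (\prod_i (4 * (b 0 i - a 0 i))) * (2 * C) ^+ N.
  rewrite big_split/= prodr_const card_ord mulrAC -exprMn; congr (_ * _).
    by congr (_ ^+ _); ring.
  by apply: eq_bigr => i _; rewrite max_r// subr_ge0 ltW.
rewrite ler_wpM2r ?exprn_ge0 ?mulr_ge0 ?(ltW C0)//.
by apply: ler_prod => i _; rewrite divr_ge0//= ler_wpM2l.
Qed.

End StableVector.

Section LebesgueNull.
Context {R : realType} {N : nat}.

(** The hull is an intersection of countable unions of boxes of small total
    volume; it depends only on [A], so that one hull serves all positive times. *)
Lemma lebesgue_null_hull (A : set 'rV[R]_N) : lebesgue_outer A = 0%E ->
  exists B : set (borel_rV R N), [/\ measurable B, A `<=` B &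
    forall (d : measure_display) (T : measurableType d) (P : probability T R)
      (Z : T -> 'rV[R]_N) (alpha tau : R), 0 < alpha -> 0 < tau ->
      measurable_fun setT (Z : T -> borel_rV R N) ->
      (forall xi, \int[P]_w cos (dotp xi (Z w)) =
                  expR (- (tau * enorm xi `^ alpha))) ->
      (forall xi, \int[P]_w sin (dotp xi (Z w)) = 0) ->
      P (Z @^-1` B) = 0%E].
Proof.
move=> A0.
have cover (n : nat) : exists ab : (nat -> 'rV[R]_N) * (nat -> 'rV[R]_N),
    A `<=` \bigcup_k box (ab.1 k) (ab.2 k) /\
    (\sum_(0 <= k <oo) (box_volume (ab.1 k) (ab.2 k))%:E <= (n.+1%:R^-1)%:E)%E.
  have : (lebesgue_outer A < (n.+1%:R^-1)%:E)%E.
    by rewrite A0 lte_fin invr_gt0 ltr0n.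
  by move=> /ereal_inf_lt[_ [a [b [Aab ->]]] /ltW ?]; exists (a, b).
pose ab n := projT1 (cid (cover n)).
pose U n := \bigcup_k box ((ab n).1 k) ((ab n).2 k) : set (borel_rV R N).
have mU n : measurable (U n).
  by apply: bigcup_measurable => k _; exact: box_measurable.
exists (\bigcap_n U n); split.
- exact: bigcapT_measurable.
- by move=> x Ax n _; have [+ _] := projT2 (cid (cover n)); exact.
move=> d T P Z alpha tau a0 t0 mZ cZ sZ.
have [C [C0 hC]] := stable_density_bounded a0 t0 mZ cZ sZ.
have mpre (B : set (borel_rV R N)) : measurable B -> measurable (Z @^-1` B).
  by move=> mB; rewrite -[X in measurable X]setTI; exact: mZ.
have bnd n : (P (Z @^-1` \bigcap_n U n) <= (C * n.+1%:R^-1)%:E)%E.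
  apply: (@le_trans _ _ (P (Z @^-1` U n))).
    rewrite le_measure ?inE//; [apply: mpre; exact: bigcapT_measurable|exact: mpre|].
    by move=> w; apply.
  rewrite preimage_bigcup.
  apply: (le_trans (@measure_sigma_subadditive _ _ _ P _
    (fun k => Z @^-1` box ((ab n).1 k) ((ab n).2 k)) _ _ _)).
  - by move=> k; apply: mpre; exact: box_measurable.
  - by apply: bigcup_measurable => k _; apply: mpre; exact: box_measurable.
  - exact: subset_refl.
  apply: (@le_trans _ _ (\sum_(0 <= k <oo)
      (C%:E * (box_volume ((ab n).1 k) ((ab n).2 k))%:E))%E).
    apply: lee_nneseries => [k _ _|k _]; first exact: measure_ge0.
    by rewrite -EFinM; exact: hC.
  have vol0 (a b : 'rV[R]_N) : 0 <= box_volume a b.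
    by apply: prodr_ge0 => i _; rewrite le_max lexx.
  rewrite nneseriesZl//; last by move=> k _; rewrite lee_fin.
  rewrite EFinM lee_wpmul2l ?lee_fin//.
  by have [] := projT2 (cid (cover n)).
apply/eqP; rewrite eq_le measure_ge0 andbT; apply/lee_addgt0Pr => e e0.
rewrite add0e; apply: (le_trans (bnd (Num.truncn (C / e)))).
rewrite lee_fin ler_pdivrMr ?ltr0n// mulrC -ler_pdivrMr//.
by rewrite ltW// truncnS_gt.
Qed.

End LebesgueNull.

(** * Support of the stable law and hitting of small cubes *)

Lemma powR_small {R : realType} (p e : R) : 0 < p -> 0 < e ->
  exists2 x0 : R, 0 < x0 & forall x, 0 < x <= x0 -> x `^ p <= e.
Proof.
move=> p0 e0; exists (e `^ p^-1); first exact: powR_gt0.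
move=> x /andP[x0 xe]; apply: (@le_trans _ _ ((e `^ p^-1) `^ p)).
  by rewrite ge0_ler_powR ?nnegrE ?powR_ge0 ?(ltW x0) ?(ltW p0).
by rewrite -powRrM mulVf ?gt_eqF// powRr1 ?(ltW e0).
Qed.

Lemma probability_union0 {R : realType} {d : measure_display}
    {T : measurableType d} (P : probability T R) (F : nat -> set T) :
  (forall n, measurable (F n)) -> (forall n, P (F n) = 0%E) ->
  P (\bigcup_n F n) = 0%E.
Proof.
move=> mF F0; apply/eqP; rewrite eq_le measure_ge0 andbT.
apply: (le_trans (@measure_sigma_subadditive _ _ _ P _ F mF _ _)) => //.
  exact: bigcup_measurable.
by rewrite eseries0// => i _ _; exact: F0.
Qed.

Section StableSupport.
Context {R : realType} {N : nat} {d : measure_display} {Omega : measurableType d}.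
Variables (P : probability Omega R) (Y : R -> Omega -> 'rV[R]_N) (alpha : R).
Hypotheses (alpha0 : 0 < alpha) (alpha2 : alpha < 2) (N0 : (0 < N)%N).
Hypothesis levyY : is_levy_process P Y.
Hypothesis charY : forall (t : R) (xi : 'rV[R]_N), 0 <= t ->
  char_fun P (Y t) xi = real_complex R (expR (- (t * enorm xi `^ alpha))).

Let mY t : 0 <= t -> measurable_fun setT (Y t : Omega -> borel_rV R N).
Proof. by move=> t0; have [mY _ _ _ _] := levyY; exact: mY. Qed.

Let mpre (Z : Omega -> 'rV[R]_N) (B : set (borel_rV R N)) :
  measurable_fun setT (Z : Omega -> borel_rV R N) -> measurable B ->
  measurable (Z @^-1` B).
Proof. by move=> mZ mB; rewrite -[X in measurable X]setTI; exact: mZ. Qed.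

Lemma increment_indep2 s t (A B : set (borel_rV R N)) : 0 <= s -> 0 <= t ->
  measurable A -> measurable B ->
  P (increment Y 0 s @^-1` A `&` increment Y s (s + t) @^-1` B) =
  (P (Y s @^-1` A) * P (Y t @^-1` B))%E.
Proof.
move=> s0 t0 mA mB; have [_ _ indY _ _] := levyY.
pose u (n : nat) := if n is n'.+1 then (if n' is _.+1 then s + t else s) else 0.
pose C (n : nat) : set (borel_rV R N) := if n is 0%N then A else B.
have := indY 2%N u C (lexx _).
rewrite !big_ord_recl big_ord0 mule1 /= (increment_law levyY) ?(increment_law levyY)//.
- rewrite subr0 [s + t - s]addrC addKr => <-.
  + congr (P _); apply/seteqP; split => w.
      by move=> [hA hB] [|[|//]] _.
    by move=> h; split; [exact: (h 0%N)|exact: (h 1%N)].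
  + by case=> [|[|//]] _ //=; rewrite lerDl.
  + by case.
- by rewrite lerDl.
Qed.

Definition supp t (y : 'rV[R]_N) :=
  forall e : R, 0 < e -> (0 < P (Y t @^-1` ocube y e))%E.

(** Countably many rational cubes of probability zero cover the complement of the
    support. *)
Lemma supp_full t (A : set (borel_rV R N)) : 0 <= t -> measurable A ->
  (forall y, supp t y -> A y) -> P (Y t @^-1` A) = 1%E.
Proof.
move=> t0 mA sA.
pose c n := (@rat_cube R N n).1; pose v n := (@rat_cube R N n).2.
pose F n := if P (Y t @^-1` ccube (c n) (v n)) == 0%E
            then Y t @^-1` ccube (c n) (v n) else set0.
have mF n : measurable (F n).
  by rewrite /F; case: ifP => // _; apply: mpre; [exact: mY|exact: ccube_measurable].
have F0 n : P (F n) = 0%E by rewrite /F; case: ifPn => [/eqP|]; rewrite ?measure0.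
have mA' := mpre (mY t0) mA.
have : (P (~` (Y t @^-1` A)) <= P (\bigcup_n F n))%E.
  rewrite le_measure ?inE//; [exact: measurableC|exact: bigcup_measurable|].
  move=> w nA; have : ~ supp t (Y t w) by move=> /sA.
  move=> /existsNP[e /not_implyP[e0 /negP]]; rewrite -leNgt => Pe.
  have [n [_ wn ne]] := rat_cube_dense (Y t w) e0.
  exists n => //; rewrite /F ifT//.
  rewrite eq_le measure_ge0 andbT (le_trans _ Pe)//.
  rewrite le_measure ?inE//; last by move=> x; exact: ne.
    by apply: mpre; [exact: mY|exact: ccube_measurable].
  by apply: mpre; [exact: mY|exact: ocube_measurable].
rewrite probability_union0// probability_setC//.
by rewrite leeBlDr ?fin_num_measure// add0e => h; apply/eqP; rewrite eq_le h probability_le1.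
Qed.

Lemma supp_nonempty t : 0 <= t -> exists y, supp t y.
Proof.
move=> t0; apply: contrapT => /forallNP ns.
have := supp_full t0 measurable0 (fun y sy => ns y sy).
by rewrite preimage_set0 measure0 => /eqP; rewrite eqe eq_sym oner_eq0.
Qed.

Lemma suppD s t y z : 0 <= s -> 0 <= t -> supp s y -> supp t z ->
  supp (s + t) (y + z).
Proof.
move=> s0 t0 sy tz e e0; have e20 : 0 < e / 2 by rewrite divr_gt0.
have st0 : 0 <= s + t by rewrite addr_ge0.
have : (0 < P (Y s @^-1` ocube y (e / 2)) * P (Y t @^-1` ocube z (e / 2)))%E.
  by apply: mule_gt0; [exact: sy|exact: tz].
rewrite -increment_indep2//; [|exact: ocube_measurable|exact: ocube_measurable].
move=> /lt_le_trans; apply.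
rewrite -[s + t in X in (_ <= X)%E]subr0 -(increment_law levyY)//; last first.
  exact: ocube_measurable.
rewrite le_measure ?inE//.
- by apply: measurableI; apply: mpre; try exact: ocube_measurable;
    apply: (increment_measurable levyY).
- by apply: mpre; [exact: (increment_measurable levyY)|exact: ocube_measurable].
move=> w [hy hz] i; move: (hy i) (hz i); rewrite /increment !mxE.
move: (Y (s + t) w 0 i) (Y s w 0 i) (Y 0 w 0 i) => a b c.
have -> : a - c - (y 0 i + z 0 i) = (b - c - y 0 i) + (a - b - z 0 i) by ring.
by move=> h1 h2; rewrite (le_lt_trans (ler_normD _ _))//; lra.
Qed.

Lemma suppZ c t y : c != 0 -> 0 <= t -> supp t y -> supp (`|c| `^ alpha * t) (c *: y).
Proof.
move=> c0 t0 ty e e0; rewrite -(stable_scaling levyY charY)//; last first.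
  exact: ocube_measurable.
have := ty (e / `|c|); rewrite divr_gt0 ?normr_gt0// => /(_ isT).
congr (0 < P _)%E; apply/seteqP; split => w hw i; move: (hw i); rewrite /= !mxE.
  by rewrite -mulrBr normrM ltr_pdivlMr ?normr_gt0// mulrC.
by rewrite -mulrBr normrM ltr_pdivlMr ?normr_gt0// mulrC.
Qed.

(** If [y] is in the support at time [t / 2], so is [- y] by symmetry, and the two
    halves of the time interval are independent. *)
Lemma supp0 t : 0 < t -> supp t 0.
Proof.
move=> t0; have t20 : 0 <= t / 2 by rewrite divr_ge0// ltW.
have [y ty] := supp_nonempty t20.
have ty' : supp (t / 2) (- y).
  have := @suppZ (-1) _ _ _ t20 ty.
  by rewrite oppr_eq0 oner_eq0 normrN1 powR1 mul1r scaleN1r; exact.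
have := suppD t20 t20 ty ty'; rewrite subrr; by rewrite -splitr.
Qed.

Definition reflect (u x : 'rV[R]_N) : 'rV[R]_N :=
  x - (2 * dotp u x / dotp u u) *: u.

(** Reflections preserve the law of the process, and one of them exchanges
    any two given vectors of the same length. *)
Lemma supp_isotropic t y z : 0 <= t -> enorm y = enorm z -> supp t z -> supp t y.
Proof.
move=> t0 yz tz; have [u uE] : {u | u = z - y} by eexists.
have [u0|u0] := eqVneq (dotp u u) 0.
  suff -> : y = z by [].
  apply/rowP => i; apply/eqP; rewrite eq_sym -subr_eq0 -sqrf_eq0; apply/eqP.
  move: u0; rewrite uE => /eqP; rewrite psumr_eq0 => [|j _]; last by rewrite -expr2 sqr_ge0.
  by move=> /allP/(_ i)/(_ (mem_index_enum _)) /eqP; rewrite !mxE expr2.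
have uu0 : 0 < dotp u u by rewrite lt_neqAle eq_sym u0 dotp_ge0.
have uz : 2 * dotp u z = dotp u u.
  have : enorm y ^+ 2 = enorm z ^+ 2 by rewrite yz.
  rewrite !enorm_sqr uE !dotpBl !dotpBr (dotpC z y) => h; lra.
have Oz : reflect u z = y.
  by rewrite /reflect uz divff// scale1r uE opprB addrC subrK.
pose K := 1 + 2 * (\sum_i `|u 0 i|) ^+ 2 / dotp u u.
have K0 : 0 < K by rewrite ltr_pwDl// divr_ge0 ?dotp_ge0// mulr_ge0 ?sqr_ge0.
have mO : measurable_fun setT (reflect u : borel_rV R N -> borel_rV R N).
  apply: measurable_rV => i; under eq_fun do rewrite !mxE.
  apply: measurable_funB; first exact: coord_measurable.
  apply: measurable_funM; last exact: measurable_cst.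
  apply: measurable_funM; last exact: measurable_cst.
  by apply: measurable_funM; [exact: measurable_cst|exact: dotp_measurable].
have OO xi x : dotp xi (reflect u x) = dotp (reflect u xi) x.
  rewrite /reflect (dotpBr xi) (dotpBl xi) dotpZr dotpZl (dotpC xi u).
  by field.
have nO xi : enorm (reflect u xi) = enorm xi.
  rewrite /enorm -OO /reflect !(dotpBr, dotpZr) (dotpC xi u).
  by congr Num.sqrt; field.
move=> e e0.
rewrite -(stable_linear levyY charY t0 t0 OO _ mO (ocube_measurable _ _)); last first.
  by move=> xi; rewrite nO.
apply: (lt_le_trans (tz _ (divr_gt0 e0 K0))).
rewrite le_measure ?inE//.
- by apply: mpre; [exact: mY|exact: ocube_measurable].
- apply: mpre; last exact: ocube_measurable.
  exact: (measurableT_comp mO (mY t0)).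
move=> w hw i; rewrite -Oz; move: hw; rewrite /=; move: (Y t w) => x hw.
have {hw}xz j : `|(x - z) 0 j| < e / K by rewrite !mxE; exact: hw.
have -> : reflect u x 0 i - reflect u z 0 i =
    (x - z) 0 i - 2 * dotp u (x - z) / dotp u u * u 0 i.
  by rewrite /reflect dotpBr !mxE; field.
have ux : `|dotp u (x - z)| <= (\sum_j `|u 0 j|) * (e / K).
  rewrite mulr_suml (le_trans (ler_norm_sum _ _ _))// ler_sum// => j _.
  by rewrite normrM ler_wpM2l// ltW.
have ui : `|u 0 i| <= \sum_j `|u 0 j|.
  by rewrite (bigD1 i)//= lerDl sumr_ge0.
have -> : e = e / K + (2 * (\sum_j `|u 0 j|) ^+ 2 / dotp u u) * (e / K).
  by rewrite -[X in X + _]mul1r -mulrDl -/K; field; rewrite gt_eqF.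
rewrite (le_lt_trans (ler_normB _ _))// ltr_leD//.
rewrite !normrM normfV (ger0_norm (dotp_ge0 u)) (ger0_norm (ler0n _ _)).
have -> : 2 * (\sum_j `|u 0 j|) ^+ 2 / dotp u u * (e / K) =
  2 * ((\sum_j `|u 0 j|) * (e / K)) / dotp u u * \sum_j `|u 0 j|.
  by field; rewrite u0 gt_eqF.
apply: ler_pM => //; first by rewrite !mulr_ge0 ?invr_ge0 ?dotp_ge0.
by rewrite ler_wpM2r ?invr_ge0 ?dotp_ge0// ler_wpM2l.
Qed.

(** The law is not compactly supported: otherwise 1 - exp (-t h^alpha) would
    be of order h^2 as h tends to 0. *)
Lemma supp_unbounded t M : 0 < t -> exists2 z, supp t z & M <= enorm z.
Proof.
move=> t0; apply: contrapT => nz.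
have nzM z : supp t z -> enorm z < M.
  by move=> tz; rewrite ltNge; apply/negP => Mz; apply: nz; exists z.
pose i0 := Ordinal N0; pose A := [set x : 'rV[R]_N | `|x 0 i0| <= M].
have mA : measurable (A : set (borel_rV R N)).
  rewrite (_ : A = (fun x : 'rV[R]_N => x 0 i0) @^-1` `[- M, M]).
    by rewrite -[X in measurable X]setTI; apply: coord_measurable => //;
      exact: measurable_itv.
  by apply/seteqP; split => x; rewrite /A /= in_itv /= ler_norml.
have PA : P (Y t @^-1` A) = 1%E.
  apply: supp_full => //; first exact: ltW.
  move=> y /nzM yM; rewrite /A /= (le_trans _ (ltW yM))//.
  rewrite -sqrtr_sqr ler_sqrt ?dotp_ge0// /dotp (bigD1 i0)//= -expr2 lerDl.
  by apply: sumr_ge0 => j _; rewrite -expr2 sqr_ge0.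
have M0 : 0 <= M.
  by have [y ty] := supp_nonempty (ltW t0); rewrite (le_trans _ (ltW (nzM _ ty)))// enorm_ge0.
have key h : 0 < h -> 1 - h ^+ 2 * M ^+ 2 / 2 <= expR (- (t * h `^ alpha)).
  move=> h0.
  have enh : enorm (h *: (delta_mx 0 i0 : 'rV[R]_N)) = h.
    rewrite enormZ gtr0_norm// -[RHS]mulr1 /enorm; congr (_ * _).
    by rewrite -[X in dotp X]scale1r dotp_delta mxE !eqxx mulr1 sqrtr1.
  have := stable_cos charY (h *: (delta_mx 0 i0 : 'rV[R]_N)) (ltW t0).
  rewrite enh => <-.
  have bc : bmeas (fun w => cos (dotp (h *: (delta_mx 0 i0 : 'rV[R]_N)) (Y t w))).
    have := bmeas_comp (mY (ltW t0)) (bmeas_cos (h *: delta_mx 0 i0) 0).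
    by congr bmeas; apply/funext => w; rewrite addr0.
  have mYA := mpre (mY (ltW t0)) mA.
  have -> : 1 - h ^+ 2 * M ^+ 2 / 2 = \int[P]_w
      ((2 - h ^+ 2 * M ^+ 2 / 2) * \1_(Y t @^-1` A) w - 1).
    rewrite expB; [|exact: bmeasZ (bmeas_indic mYA)|exact: bmeas_cst].
    rewrite expZ ?exp_indic ?exp_cst//; last exact: bmeas_indic.
    by rewrite PA /=; ring.
  apply: le_exp => //.
    by apply: bmeasB; [exact: bmeasZ (bmeas_indic mYA)|exact: bmeas_cst].
  move=> w; rewrite indicE; have [/set_mem wA|_] := boolP (w \in _); last first.
    by rewrite mulr0 sub0r cos_geN1.
  rewrite mulr1 dotp_delta.
  have := onem_cos_le (h * Y t w 0 i0); rewrite exprMn.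
  have : (Y t w 0 i0) ^+ 2 <= M ^+ 2.
    by rewrite -real_normK ?num_real// ler_pXn2r ?nnegrE.
  have := exprn_gt0 2 h0; nra.
have e1 : 0 < t^-1 by rewrite invr_gt0.
have e2 : 0 < t / (2 * (M ^+ 2 + 1)).
  by rewrite divr_gt0// mulr_gt0// ltr_wpDl// sqr_ge0.
have [x1 x10 hx1] := powR_small alpha0 e1.
have a20 : 0 < 2 - alpha by rewrite subr_gt0.
have [x2 x20 hx2] := powR_small a20 e2.
pose h := Num.min x1 x2.
have h0 : 0 < h by rewrite lt_min x10.
have h1 : h `^ alpha <= t^-1 by apply: hx1; rewrite h0 ge_min lexx.
have h2 : h `^ (2 - alpha) <= t / (2 * (M ^+ 2 + 1)).
  by apply: hx2; rewrite h0 ge_min lexx orbT.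
have := key h h0.
have hsplit : h ^+ 2 = h `^ alpha * h `^ (2 - alpha).
  rewrite -powRD; last by rewrite (gt_eqF h0) implybT.
  by rewrite addrCA subrr addr0 powR_mulrn// ltW.
have ha : 0 < h `^ alpha by rewrite powR_gt0.
have b0 : 0 <= h `^ (2 - alpha) by rewrite powR_ge0.
move: h1 h2 ha b0; rewrite hsplit; move: (h `^ alpha) (h `^ (2 - alpha)) => a b.
move=> ha hb a0 b0.
have M1 : 0 < M ^+ 2 + 1 by rewrite ltr_wpDl// sqr_ge0.
have hb' : 2 * b * (M ^+ 2 + 1) <= t.
  by move: hb; rewrite ler_pdivlMr ?mulr_gt0//; lra.
have ta : 0 < t * a by rewrite mulr_gt0.
have ta1 : t * a <= 1 by rewrite mulrC -ler_pdivlMr// mul1r.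
apply/negP; rewrite -ltNge expRN.
apply: (@le_lt_trans _ _ (1 + t * a)^-1).
  by rewrite lef_pV2 ?posrE ?expR_gt0 ?expR_ge1Dx//; lra.
rewrite -div1r ltr_pdivrMr; last lra.
have h1 : b * M ^+ 2 <= t / 2.
  nra.
have h2 : a * (b * M ^+ 2) <= a * (t / 2) by rewrite ler_wpM2l// ltW.
rewrite (_ : a * b * M ^+ 2 / 2 = a * (b * M ^+ 2) / 2); last by field.
move: h2; move: (a * (b * M ^+ 2)) => q h2.
have q2 : q <= t * a / 2 by rewrite (le_trans h2)// mulrCA mulrA.
move: ta ta1 q2; move: (t * a) => v v0 v1 qv.
nra.
Qed.

Lemma supp_all t y : 0 < t -> supp t y.
Proof.
move=> t0; have [y0|y0] := eqVneq (enorm y) 0.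
  apply: (@supp_isotropic _ _ 0) (ltW t0) _ (supp0 t0).
  by rewrite y0 /enorm dotp0l sqrtr0.
have yp : 0 < enorm y by rewrite lt_neqAle eq_sym y0 enorm_ge0.
have [z tz yz] := supp_unbounded (enorm y) t0.
have zp : 0 < enorm z by rewrite (lt_le_trans yp).
pose c := enorm y / enorm z.
have c0 : 0 < c by rewrite divr_gt0.
have c1 : c <= 1 by rewrite ler_pdivrMr// mul1r.
have cz : supp (c `^ alpha * t) y.
  rewrite -{1}[c]gtr0_norm// -[y](@scalerKV _ _ c) ?gt_eqF//.
  apply: suppZ; [by rewrite gt_eqF|exact: ltW|].
  apply: supp_isotropic (ltW t0) _ tz.
  by rewrite enormZ gtr0_norm ?invr_gt0// /c invf_div divfK.
have ca1 : c `^ alpha <= 1.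
  apply: (@le_trans _ _ (1 `^ alpha)); last by rewrite powR1.
  by rewrite ge0_ler_powR ?nnegrE ?(ltW c0) ?(ltW alpha0).
have : c `^ alpha * t <= t by rewrite ler_piMl// ltW.
rewrite le_eqVlt => /predU1P[<-//|lt].
rewrite -[y]addr0 -[t](subrKC (c `^ alpha * t)).
apply: suppD => //; [by rewrite mulr_ge0 ?powR_ge0 ?ltW|by rewrite subr_ge0 ltW|].
by apply: supp0; rewrite subr_gt0.
Qed.

Lemma supp_unif_cube t K e : 0 < t -> 0 < K -> 0 < e ->
  exists2 c : R, 0 < c & forall v, ccube 0 K v -> (c%:E <= P (Y t @^-1` ocube v e))%E.
Proof.
move=> t0 K0 e0.
pose m := (Num.truncn (2 * K / (e / 2))).+1.
pose del := 2 * K / m%:R.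
have m0 : 0 < m%:R :> R by rewrite ltr0n.
have del0 : 0 < del by rewrite divr_gt0// mulr_gt0.
have dele : del < e / 2.
  rewrite /del ltr_pdivrMr// [ltRHS]mulrC -ltr_pdivrMr ?divr_gt0//.
  exact: truncnS_gt.
pose p (a : {ffun 'I_N -> 'I_m.+1}) : 'rV[R]_N := \row_i (- K + (a i)%:R * del).
pose c := \big[Num.min/1]_a fine (P (Y t @^-1` ocube (p a) (e / 2))).
have pfin a r : (fine (P (Y t @^-1` ocube a r)))%:E = P (Y t @^-1` ocube a r).
  rewrite fineK// fin_num_measure//.
  by apply: mpre; [exact: mY (ltW t0)|exact: ocube_measurable].
exists c.
  apply: lt_bigmin => // a _; rewrite -lte_fin pfin.
  by apply: supp_all => //; rewrite divr_gt0.
move=> v vK.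
have am (i : 'I_N) : (Num.truncn ((v 0 i + K) / del)%R < m.+1)%N.
  rewrite ltnS truncn_le_nat (@le_lt_trans _ _ m%:R) ?ltr_nat//.
  rewrite ler_pdivrMr// /del mulrCA divff ?gt_eqF// mulr1.
  by have := vK i; rewrite mxE subr0 ler_norml => /andP[]; lra.
pose a : {ffun 'I_N -> 'I_m.+1} := [ffun i => Ordinal (am i)].
apply: (@le_trans _ _ (P (Y t @^-1` ocube (p a) (e / 2)))).
  by rewrite -pfin lee_fin; exact: bigmin_le.
rewrite le_measure ?inE//; try by apply: mpre; [exact: mY (ltW t0)|exact: ocube_measurable].
move=> w hw i; move: (hw i); rewrite !mxE ffunE /= => h.
have vK0 : 0 <= (v 0 i + K) / del.
  rewrite divr_ge0 ?(ltW del0)//; have := vK i.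
  by rewrite mxE subr0 ler_norml => /andP[]; lra.
have /andP[] := truncn_itv vK0.
move: h; move: (Num.truncn _) => k h.
rewrite ler_pdivlMr// ltr_pdivrMr// -natr1 mulrDl mul1r => k1 k2.
have -> : Y t w 0 i - v 0 i =
  (Y t w 0 i - (- K + k%:R * del)) + (- K + k%:R * del - v 0 i) by ring.
rewrite (le_lt_trans (ler_normD _ _))// (splitr e) ltrD//.
by rewrite ltr_norml; apply/andP; split; lra.
Qed.

(** Chapman-Kolmogorov, as a lower bound. *)
Lemma two_step_ge s t (A C : set (borel_rV R N)) (c : R) :
  0 <= s -> 0 <= t -> measurable A -> measurable C -> 0 <= c ->
  (forall x : 'rV[R]_N, A x ->
     (c%:E <= P (Y t @^-1` [set z : 'rV[R]_N | C (x + z)%R]))%E) ->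
  (c%:E * P (Y s @^-1` A) <= P (Y (s + t) @^-1` C))%E.
Proof.
move=> s0 t0 mA mC c0 Ac.
have st0 : 0 <= s + t by rewrite addr_ge0.
have mI1 := increment_measurable levyY (lexx 0) s0.
have mI2 := increment_measurable levyY s0 st0.
pose X1 : {mfun Omega >-> borel_rV R N} := HB.pack
  (increment Y 0 s : Omega -> borel_rV R N) (isMeasurableFun.Build _ _ _ _ _ mI1).
pose X2 : {mfun Omega >-> borel_rV R N} := HB.pack
  (increment Y s (s + t) : Omega -> borel_rV R N)
  (isMeasurableFun.Build _ _ _ _ _ mI2).
have mX : measurable_fun setT (fun w => (X1 w, X2 w)) by exact: measurable_fun_pair.
pose X : {mfun Omega >-> (borel_rV R N * borel_rV R N)%type} := HB.pack
  (fun w => (X1 w, X2 w)) (isMeasurableFun.Build _ _ _ _ _ mX).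
pose E : set (borel_rV R N * borel_rV R N) :=
  [set u | A u.1 /\ C ((u.1 : 'rV[R]_N) + u.2)].
have mE : measurable E.
  rewrite (_ : E = (fst @^-1` A) `&` ((fun u : borel_rV R N * borel_rV R N =>
     ((u.1 : 'rV[R]_N) + u.2 : borel_rV R N)) @^-1` C))//.
  apply: measurableI; first by rewrite -[X in measurable X]setTI; exact: measurable_fst.
  rewrite -[X in measurable X]setTI.
  suff : measurable_fun setT (fun u : borel_rV R N * borel_rV R N =>
     ((u.1 : 'rV[R]_N) + u.2 : borel_rV R N)) by apply.
  apply: measurable_rV => i; under eq_fun do rewrite mxE.
  by apply: measurable_funD; apply: (measurableT_comp (coord_measurable i)).
have law1 B : measurable B -> distribution P X1 B = P (Y s @^-1` B).
  by move=> mB; rewrite /distribution /pushforward /= (increment_law levyY)// subr0.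
have law2 B : measurable B -> distribution P X2 B = P (Y t @^-1` B).
  move=> mB; rewrite /distribution /pushforward /= (increment_law levyY)//.
    by rewrite addrC addKr.
  by rewrite lerDl.
have -> : P (Y (s + t) @^-1` C) = P (increment Y 0 (s + t) @^-1` C).
  by rewrite (increment_law levyY)// subr0.
apply: (@le_trans _ _ (distribution P X E)); last first.
  rewrite /distribution /pushforward /= le_measure ?inE//.
  - by rewrite -[X in measurable X]setTI; exact: (mX measurableT _ mE).
  - by apply: mpre => //; exact: (increment_measurable levyY).
  move=> w [_ /=]; rewrite /preimage /= (_ : _ + _ = increment Y 0 (s + t) w)//.
  by rewrite /increment addrC addrA subrK.
rewrite -(@product_measure_unique _ _ _ _ _ (distribution P X1)
   (distribution P X2) (distribution P X) _ E mE); last first.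
  move=> B D mB mD; have := increment_indep2 s0 t0 mB mD.
  by rewrite -law1// -law2//; exact.
rewrite /product_measure1 /=.
apply: (@le_trans _ _ (\int[distribution P X1]_x (c%:E * (\1_A x)%:E))%E).
  rewrite integralZl//; last first.
    exact: (bmeas_integrable (distribution P X1) (bmeas_indic mA)).
  by rewrite integral_indic// setIT -law1.
apply: ge0_le_integral => //.
- by move=> x _; rewrite mule_ge0 ?lee_fin.
- apply: emeasurable_funM; first exact: measurable_cst.
  by apply/measurable_EFinP; exact: measurable_indic.
- exact: measurable_fun_xsection.
move=> x _; rewrite indicE; have [/set_mem xA|_] := boolP (x \in A); last first.
  by rewrite mule0.
rewrite mule1 (le_trans (Ac x xA))// -law2; last first.
  rewrite (_ : [set z : 'rV[R]_N | C ((x : 'rV[R]_N) + z)] = xsection E x).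
    exact: measurable_xsection.
  by apply/seteqP; split => z /=; rewrite /xsection /= in_setE; [split|case].
rewrite (_ : xsection E x = [set z : 'rV[R]_N | C ((x : 'rV[R]_N) + z)])//.
by apply/seteqP; split => z /=; rewrite /xsection /= in_setE; [case|split].
Qed.

(** Repeatedly halving the distance to the target, each halving having a
    probability bounded below by self-similarity: the stable process hits a
    cube of radius 2^-k with a probability that is only polynomially small
    in the radius. *)
Lemma hit_cube t K : 0 < t -> 0 < K -> exists2 c : R, 0 < c &
  forall (k : nat) v, ccube 0 K v ->
    ((c ^+ k.+1)%:E <= P (Y t @^-1` ocube v (K / 2 ^+ k)))%E.
Proof.
move=> t0 K0.
pose q : R := 2^-1 `^ alpha.
have q0 : 0 < q by rewrite powR_gt0// invr_gt0.
have q1 : q < 1.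
  apply: (@lt_le_trans _ _ (1 `^ alpha)); last by rewrite powR1.
  by rewrite gt0_ltr_powR ?nnegrE ?invr_ge0// invf_lt1// ltr1n.
have t10 : 0 < (1 - q) * t by rewrite mulr_gt0// subr_gt0.
have [c1 c10 h1] := supp_unif_cube t0 K0 K0.
have [c2 c20 h2] := supp_unif_cube t10 K0 (divr_gt0 K0 (ltr0Sn R 1)).
pose c := Num.min c1 c2.
have c0 : 0 < c by rewrite lt_min c10.
exists c => //; elim=> [|k IHk] v vK.
  rewrite expr1 expr0 divr1; apply: le_trans (h1 _ vK).
  by rewrite lee_fin ge_min lexx.
have -> : t = (1 - q) * t + q * t by ring.
apply: le_trans (two_step_ge (c := c ^+ k.+1) (A := ocube v (K / 2)) _ _ _ _ _ _).
- rewrite exprSr EFinM lee_wpmul2l ?lee_fin ?exprn_ge0 ?(ltW c0)//.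
  by apply: le_trans (h2 _ vK); rewrite lee_fin ge_min lexx orbT.
- exact: ltW.
- by rewrite mulr_ge0 ?ltW.
- exact: ocube_measurable.
- exact: ocube_measurable.
- by rewrite exprn_ge0 ?ltW.
move=> x xv.
have -> : q * t = `|2^-1 : R| `^ alpha * t by rewrite gtr0_norm ?invr_gt0.
rewrite (_ : [set z | _] = ocube (v - x) (K / 2 ^+ k.+1)); last first.
  by apply/seteqP; split => z hz i; move: (hz i); rewrite !mxE opprB addrA [z 0 i + _]addrC.
rewrite -(stable_scaling levyY charY) ?(ltW t0)//; last exact: ocube_measurable.
apply: (le_trans (IHk (2 *: (v - x)) _)).
  move=> i; rewrite !mxE subr0 normrM gtr0_norm// distrC mulrC -ler_pdivlMr//.
  by apply: ltW; exact: xv.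
rewrite le_measure ?inE//.
- by apply: mpre; [exact: mY (ltW t0)|exact: ocube_measurable].
- apply: mpre; last exact: ocube_measurable.
  exact: (measurableT_comp (scale_measurable _) (mY (ltW t0))).
move=> w hw i; move: (hw i); rewrite /= !mxE => h.
have -> : 2^-1 * Y t w 0 i - (v 0 i - x 0 i) =
  2^-1 * (Y t w 0 i - 2 * (v 0 i - x 0 i)) by field.
rewrite normrM gtr0_norm ?invr_gt0// exprS invfM mulrCA ltr_pM2l ?invr_gt0//.
Qed.

End StableSupport.

(** * Powers of symmetric nonnegative kernels *)

Section Kernels.
Context {R : realType} {T : finType}.
Implicit Types (A B : T -> T -> R) (f v : T -> R).

Definition kapply A v a := \sum_b A a b * v b.

Definition kcomp A B a b := \sum_c A a c * B c b.

Definition kform A f := \sum_a f a * kapply A f a.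

(** Only powers with exponent [2 ^ k] are used, since the Cauchy-Schwarz step
    doubles the exponent. *)
Definition kpow2 A k := iter k (fun B => kcomp B B) A.

Lemma kapply_comp A B v : kapply (kcomp A B) v = kapply A (kapply B v).
Proof.
apply/funext => a; rewrite /kapply /kcomp.
under eq_bigr do rewrite mulr_suml.
rewrite exchange_big/=; apply: eq_bigr => c _.
by rewrite mulr_sumr; apply: eq_bigr => b _; rewrite mulrA.
Qed.

Lemma kapply_pow2 A k v : kapply (kpow2 A k) v = iter (2 ^ k) (kapply A) v.
Proof.
elim: k v => [|k IHk] v //=.
by rewrite kapply_comp !IHk expnS mul2n -addnn iterD.
Qed.

Lemma kpow2_sym A k : (forall a b, A a b = A b a) ->
  forall a b, kpow2 A k a b = kpow2 A k b a.
Proof.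
move=> sA; elim: k => [//|k IHk] a b /=.
by apply: eq_bigr => c _; rewrite mulrC IHk [X in _ * X]IHk.
Qed.

Lemma kpow2_ge0 A k : (forall a b, 0 <= A a b) ->
  forall a b, 0 <= kpow2 A k a b.
Proof.
move=> A0; elim: k => [//|k IHk] a b /=.
by apply: sumr_ge0 => c _; rewrite mulr_ge0.
Qed.

(** Cauchy-Schwarz: <f, A f>^2 <= <f, f> <A f, A f> = <f, f> <f, A^2 f>. *)
Lemma kform_sqr_ge A f th : (forall a b, A a b = A b a) -> 0 <= th ->
  th * \sum_a f a ^+ 2 <= kform A f ->
  th ^+ 2 * \sum_a f a ^+ 2 <= kform (kcomp A A) f.
Proof.
move=> sA th0 H; set W := \sum_a _ in H *.
have W0 : 0 <= W by apply: sumr_ge0 => a _; rewrite sqr_ge0.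
have -> : kform (kcomp A A) f = \sum_a kapply A f a ^+ 2.
  rewrite /kform kapply_comp /kapply.
  under eq_bigr do rewrite mulr_sumr.
  rewrite exchange_big/=; apply: eq_bigr => b _; rewrite expr2 mulr_suml.
  by apply: eq_bigr => a _; rewrite mulrCA mulrA sA.
have : 0 <= \sum_a (kapply A f a - th * f a) ^+ 2.
  by apply: sumr_ge0 => a _; rewrite sqr_ge0.
have -> : \sum_a (kapply A f a - th * f a) ^+ 2 =
    \sum_a kapply A f a ^+ 2 - 2 * th * kform A f + th ^+ 2 * W.
  rewrite /kform /W !mulr_sumr -sumrB -big_split/=.
  by apply: eq_bigr => a _; ring.
move=> h; have : th * (th * W) <= th * kform A f by rewrite ler_wpM2l.
by rewrite expr2 in h *; nra.
Qed.

(** Schur's test. *)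
Lemma kform_le_rowsum A f m : (forall a b, A a b = A b a) ->
  (forall a b, 0 <= A a b) -> (forall a, kapply A (fun=> 1) a <= m) ->
  kform A f <= m * \sum_a f a ^+ 2.
Proof.
move=> sA A0 Am.
apply: (@le_trans _ _ (\sum_a f a ^+ 2 * kapply A (fun=> 1) a)); last first.
  rewrite mulr_sumr ler_sum// => a _; rewrite mulrC.
  by rewrite ler_wpM2r ?sqr_ge0.
have E : \sum_a f a ^+ 2 * kapply A (fun=> 1) a =
    \sum_a \sum_b A a b * ((f a ^+ 2 + f b ^+ 2) / 2).
  have S1 : \sum_a f a ^+ 2 * kapply A (fun=> 1) a =
      \sum_a \sum_b A a b * f a ^+ 2.
    apply: eq_bigr => a _; rewrite mulr_sumr; apply: eq_bigr => b _.
    by rewrite mulr1 mulrC.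
  have S2 : \sum_a \sum_b A a b * f a ^+ 2 = \sum_a \sum_b A a b * f b ^+ 2.
    rewrite exchange_big/=; apply: eq_bigr => a _; apply: eq_bigr => b _.
    by rewrite sA.
  transitivity ((\sum_a \sum_b A a b * f a ^+ 2 +
                 \sum_a \sum_b A a b * f b ^+ 2) / 2).
    by rewrite -S2 -S1; field.
  rewrite -big_split mulr_suml; apply: eq_bigr => a _.
  by rewrite -big_split mulr_suml; apply: eq_bigr => b _ /=; field.
rewrite E /kform ler_sum// => a _; rewrite mulr_sumr ler_sum// => b _.
have := sqr_ge0 (f a - f b); have := A0 a b; rewrite !expr2; nra.
Qed.

(** A Rayleigh quotient at least [th] forces some row sum of the n-th power to
    be at least [th ^ n], with no loss in the constant. *)
Lemma exists_large_rowsum A f th k : (forall a b, A a b = A b a) ->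
  (forall a b, 0 <= A a b) -> 0 < \sum_a f a ^+ 2 -> 0 < th ->
  th * \sum_a f a ^+ 2 <= kform A f ->
  exists a, th ^+ (2 ^ k) <= iter (2 ^ k) (kapply A) (fun=> 1) a.
Proof.
move=> sA A0 W0 th0 H.
have Hk : th ^+ (2 ^ k) * \sum_a f a ^+ 2 <= kform (kpow2 A k) f.
  elim: k => [|k IHk]; first by rewrite expr1.
  rewrite expnS mulnC exprM; apply: kform_sqr_ge => //.
    exact: kpow2_sym.
  by rewrite exprn_ge0// ltW.
have [a0 _] : exists a0, f a0 ^+ 2 != 0.
  apply: contrapT => /forallNP f0; move: W0; rewrite big1 ?ltxx// => a _.
  by apply/eqP; have /negP/negPn := f0 a.
pose g := kapply (kpow2 A k) (fun=> 1).
pose a1 := [arg max_(a > a0) g a]%O.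
have ga1 a : g a <= g a1 by rewrite /a1; case: arg_maxP => // i _; exact.
exists a1; rewrite -kapply_pow2 -/g -(ler_pM2r W0).
apply: le_trans Hk _; apply: kform_le_rowsum => //.
- exact: kpow2_sym.
- exact: kpow2_ge0.
Qed.

End Kernels.

(** * Discrete Fourier analysis on a centered grid *)

Lemma cos_sin_addint {R : realType} (x : R) (n : int) :
  cos (x + 2 * pi * n%:~R) = cos x /\ sin (x + 2 * pi * n%:~R) = sin x.
Proof.
have nat_case (y : R) (m : nat) :
    cos (y + 2 * pi * m%:R) = cos y /\ sin (y + 2 * pi * m%:R) = sin y.
  elim: m => [|m [ihc ihs]]; first by rewrite mulr0 addr0.
  have -> : y + 2 * pi * m.+1%:R = y + 2 * pi * m%:R + pi *+ 2.
    by rewrite -natr1 -mulr_natl; ring.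
  by rewrite cosD2pi sinD2pi.
case: n => m; first exact: nat_case.
have [hc hs] := nat_case (x + 2 * pi * (Negz m)%:~R) m.+1.
suff e : x + 2 * pi * (Negz m)%:~R + 2 * pi * m.+1%:R = x by rewrite -hc -hs e.
by rewrite NegzE mulrNz; ring.
Qed.

Lemma cos_lipschitz {R : realType} (x y : R) : `|cos x - cos y| <= `|x - y|.
Proof.
wlog xy : x y / y <= x.
  move=> H; have [/H//|/ltW xy] := leP y x.
  by rewrite distrC [leRHS]distrC; exact: H.
move: xy; rewrite le_eqVlt => /predU1P[->|xy]; first by rewrite !subrr.
have dc (z : R) : is_derive z (1 : R) cos (- sin z) by exact: is_derive_cos.
have [|c _ ->] := @MVT _ (@cos R) (fun z => - sin z) _ _ xy (fun z _ => dc z).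
  by apply: continuous_subspaceT; exact: continuous_cos.
by rewrite normrM normrN ler_piMl// sin_max.
Qed.

Section Grid.
Context {R : realType} {N : nat}.
Variable K : nat.
Local Notation M := (2 * K).+1.

(** The same type indexes positions and frequencies. *)
Definition grid := {ffun 'I_N -> 'I_M}.

Definition lati (a : grid) (i : 'I_N) : int := (a i)%:Z - K%:Z.

Definition lat (a : grid) : 'rV[R]_N := \row_i (lati a i)%:~R.

Definition freq (k : grid) : 'rV[R]_N := (2 * pi / M%:R) *: lat k.

Lemma lat_inj : injective lat.
Proof.
move=> a b /rowP ab; apply/ffunP => i; apply: val_inj.
have := ab i; rewrite !mxE => /intr_inj; rewrite /lati => /addIr.
by move=> [].
Qed.

Lemma lat_ex (c : 'I_N -> int) : (forall i, `|c i| <= K%:Z) ->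
  exists a, forall i, lati a i = c i.
Proof.
move=> cK.
have h i : (absz (c i + K%:Z)%R < M)%N.
  have := cK i; lia.
exists [ffun i => Ordinal (h i)] => i; rewrite /lati ffunE /=.
by have := cK i; lia.
Qed.

Lemma freq_le_pi k i : `|freq k 0 i| <= pi.
Proof.
rewrite !mxE normrM ger0_norm; last first.
  by rewrite divr_ge0 ?mulr_ge0 ?pi_ge0.
have : `|(lati k i)%:~R| <= K%:R :> R.
  rewrite -intr_norm -[K%:R]/((Posz K)%:~R) ler_int /lati.
  by have := ltn_ord (k i); lia.
move=> h; apply: (@le_trans _ _ (2 * pi / M%:R * K%:R)).
  by rewrite ler_wpM2l// divr_ge0 ?mulr_ge0 ?pi_ge0.
rewrite mulrAC ler_pdivrMr ?ltr0n// [2 * pi]mulrC -mulrA ler_wpM2l ?pi_ge0//.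
by rewrite -natrM ler_nat.
Qed.

Let cS (c : 'rV[R]_N) := \sum_k cos (dotp (freq k) c).
Let sS (c : 'rV[R]_N) := \sum_k sin (dotp (freq k) c).

(** Cyclically shifting one coordinate of the frequency rotates the character
    sum by a nontrivial angle, so the sum vanishes. *)
Lemma character_sum0 (c : 'I_N -> int) i : c i != 0 -> `|c i| < M%:Z ->
  cS (\row_i (c i)%:~R) = 0.
Proof.
move=> ci0 ciM; set cv := \row_i _.
pose sh (k : grid) : grid := [ffun j => if j == i then ordS (k j) else k j].
have sh_inj : injective sh.
  move=> k l /ffunP kl; apply/ffunP => j; have := kl j; rewrite !ffunE.
  by case: ifP => // _; exact: ordS_inj.
pose ph : R := 2 * pi / M%:R * (c i)%:~R.
have M0 : (M%:R : R) != 0 by rewrite pnatr_eq0.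
have shE k : exists n : int,
    dotp (freq (sh k)) cv = dotp (freq k) cv + ph + 2 * pi * n%:~R.
  pose wr := (if (k i).+1 == M then - c i else 0) : int.
  exists wr; rewrite /dotp (bigD1 i)//= [in RHS](bigD1 i)//=.
  rewrite (eq_bigr (fun j => freq k 0 j * cv 0 j)); last first.
    by move=> j /negbTE ji; rewrite !mxE /lati ffunE ji.
  have -> : freq (sh k) 0 i * cv 0 i =
      freq k 0 i * cv 0 i + ph + 2 * pi * wr%:~R; last by ring.
  rewrite !mxE /lati ffunE eqxx /ph /wr /=.
  case: eqVneq => [kM|kM].
    rewrite kM modnn.
    have -> : ((k i)%:Z - K%:Z)%:~R = M%:R - 1 - K%:R :> R.
      have -> : M%:R = (k i)%:R + 1 :> R by rewrite natr1 kM.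
      by rewrite intrD mulrNz -!pmulrn; ring.
    by rewrite mulrNz sub0r mulrNz; field.
  rewrite modn_small; last by have := ltn_ord (k i); lia.
  by rewrite !intrD !mulrNz -!pmulrn -natr1; field.
have e1 : cS cv = cS cv * cos ph - sS cv * sin ph.
  rewrite {1}/cS (reindex_inj sh_inj)/= !mulr_suml -sumrB.
  apply: eq_bigr => k _; have [n ->] := shE k.
  by have [-> _] := cos_sin_addint (dotp (freq k) cv + ph) n; rewrite cosD.
have e2 : sS cv = sS cv * cos ph + cS cv * sin ph.
  rewrite {1}/sS (reindex_inj sh_inj)/= !mulr_suml -big_split.
  apply: eq_bigr => k _; have [n ->] := shE k.
  by have [_ ->] := cos_sin_addint (dotp (freq k) cv + ph) n; rewrite sinD.
have h : (cS cv ^+ 2 + sS cv ^+ 2) * (1 - cos ph) = 0.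
  have := congr1 (fun x => x * cS cv) e1; have := congr1 (fun x => x * sS cv) e2.
  rewrite !expr2 => /= ? ?; nra.
have ph0 : 1 - cos ph != 0.
  rewrite onem_cosE mulf_neq0 ?expf_neq0// -normr_gt0.
  have : 0 < sin `|ph / 2|.
    have pi_neq0 : pi != 0 :> R by rewrite gt_eqF// pi_gt0.
    apply: sin_gt0_pi; rewrite normr_gt0 /ph.
    rewrite !mulf_neq0 ?invr_neq0 ?intr_eq0//=.
    have -> : 2 * pi / M%:R * (c i)%:~R / 2 = pi * ((c i)%:~R / M%:R) :> R by field.
    rewrite normrM (gtr0_norm (pi_gt0 R)) gtr_pMr ?pi_gt0//.
    rewrite normrM normfV (gtr0_norm (ltr0Sn _ _)) ltr_pdivrMr// mul1r.
    by rewrite -intr_norm -[M%:R]/((Posz M)%:~R) ltr_int.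
  move=> s0; rewrite normr_gt0; apply/negP => /eqP s1; move: s0.
  by case: (ger0P (ph / 2)) => _; rewrite ?sinN s1 ?oppr0 ltxx.
move/eqP: h; rewrite mulf_eq0 (negbTE ph0) orbF.
by rewrite paddr_eq0 ?sqr_ge0// sqrf_eq0 => /andP[/eqP].
Qed.

Variable f : grid -> R.
(** Differences of points of the support then have coordinates at most [K],
    so that there is no wrap-around modulo [2 K + 1]. *)
Hypothesis suppf : forall a, f a != 0 -> forall i, 2 * `|lati a i| <= K%:Z.

Let W := \sum_a f a ^+ 2.
Let card : R := #|{: grid}|%:R.

(** The normalized power spectrum of [f]. *)
Definition weight k : R := card^-1 *
  ((\sum_a f a * cos (dotp (freq k) (lat a))) ^+ 2 +
   (\sum_a f a * sin (dotp (freq k) (lat a))) ^+ 2).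

Lemma weight_ge0 k : 0 <= weight k.
Proof. by rewrite mulr_ge0 ?invr_ge0 ?ler0n// addr_ge0// sqr_ge0. Qed.

Definition trig_interp (y : 'rV[R]_N) := \sum_k weight k * cos (dotp (freq k) y).

Let card_neq0 : card != 0.
Proof.
rewrite pnatr_eq0 -lt0n; apply/card_gt0P.
by exists [ffun=> ord0].
Qed.

Let trigE y : trig_interp y = \sum_a \sum_b f a * f b *
  (card^-1 * (2^-1 * (cS (lat a - lat b + y) + cS (lat a - lat b - y)))).
Proof.
have E k : weight k * cos (dotp (freq k) y) = \sum_a \sum_b f a * f b *
    (card^-1 * (2^-1 * (cos (dotp (freq k) (lat a - lat b + y)) +
                        cos (dotp (freq k) (lat a - lat b - y))))).
  rewrite /weight !expr2 !big_distrl -big_split/= mulr_sumr mulr_suml.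
  apply: eq_bigr => a _; rewrite !big_distrr -big_split/= mulr_sumr mulr_suml.
  apply: eq_bigr => b _.
  rewrite [dotp _ (_ + y)]dotpDr [dotp _ (_ - y)]dotpBr -cos_mul_cos.
  by rewrite dotpBr cosB; ring.
rewrite /trig_interp; under eq_bigr do rewrite E.
rewrite exchange_big/=; apply: eq_bigr => a _.
rewrite exchange_big/=; apply: eq_bigr => b _.
by rewrite -!mulr_sumr big_split.
Qed.

Let cS_int (c : 'I_N -> int) : (forall i, `|c i| <= (2 * K)%:Z) ->
  card^-1 * cS (\row_i (c i)%:~R) = [forall i, c i == 0]%:R.
Proof.
move=> cK; case: forallP => [c0|/existsNP[i /negP ci]].
  rewrite (_ : \row_i _ = 0); last by apply/rowP => i; rewrite !mxE (eqP (c0 i)).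
  rewrite /cS; under eq_bigr do rewrite dotpC dotp0l cos0.
  by rewrite sumr_const -[_ *+ _]mulr_natl mulr1 mulVf.
by rewrite (character_sum0 ci) ?mulr0//; have := cK i; lia.
Qed.

(** On grid vectors the interpolation is the autocorrelation of [f]. *)
Lemma trig_interp_int (c : 'I_N -> int) : (forall i, `|c i| <= K%:Z) ->
  trig_interp (\row_i (c i)%:~R) =
  \sum_a \sum_b f a * f b * (lat b - lat a == \row_i (c i)%:~R)%:R.
Proof.
move=> cK; set cv := \row_i _.
have latE a b : (lat b - lat a == cv) = [forall i, lati b i - lati a i == c i].
  apply/eqP/forallP => [/rowP h i|h].
    by have := h i; rewrite !mxE -intrB => /intr_inj ->.
  by apply/rowP => i; rewrite !mxE -intrB (eqP (h i)).
have E a b : f a * f b *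
    (card^-1 * (2^-1 * (cS (lat a - lat b + cv) + cS (lat a - lat b - cv)))) =
    2^-1 * (f a * f b * (lat b - lat a == cv)%:R) +
    2^-1 * (f a * f b * (lat a - lat b == cv)%:R).
  have [->|fa] := eqVneq (f a) 0; first by rewrite !mul0r !mulr0 addr0.
  have [->|fb] := eqVneq (f b) 0; first by rewrite !(mulr0, mul0r) addr0.
  have ha := suppf fa; have hb := suppf fb.
  have r1 : lat a - lat b + cv = \row_i (lati a i - lati b i + c i)%:~R.
    by apply/rowP => i; rewrite !mxE [RHS]intrD [in RHS]intrB.
  have r2 : lat a - lat b - cv = \row_i (lati a i - lati b i - c i)%:~R.
    by apply/rowP => i; rewrite !mxE [RHS]intrB [in RHS]intrB.
  rewrite [card^-1 * _]mulrCA mulrDr r1 r2 !cS_int; last first.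
  - by move=> i; have := ha i; have := hb i; have := cK i; lia.
  - by move=> i; have := ha i; have := hb i; have := cK i; lia.
  rewrite !latE.
  have -> : [forall i, lati a i - lati b i + c i == 0] =
            [forall i, lati b i - lati a i == c i].
    by apply: eq_forallb => i; lia.
  have -> : [forall i, lati a i - lati b i - c i == 0] =
            [forall i, lati a i - lati b i == c i].
    by apply: eq_forallb => i; lia.
  by ring.
rewrite trigE; under eq_bigr do under eq_bigr do rewrite E.
under eq_bigr do rewrite big_split/=.
rewrite big_split/= [X in _ + X]exchange_big/=.
rewrite -big_split/=; apply: eq_bigr => a _; rewrite -big_split/=.
by apply: eq_bigr => b _; rewrite [f b * f a]mulrC; field.
Qed.

Lemma sum_weight : \sum_k weight k = W.
Proof.
transitivity (trig_interp (\row_i (0 : int)%:~R)).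
  apply: eq_bigr => k _; rewrite (_ : \row_i _ = 0).
    by rewrite dotpC dotp0l cos0 mulr1.
  by apply/rowP => i; rewrite !mxE.
rewrite trig_interp_int; last by move=> i; rewrite normr0.
apply: eq_bigr => a _; rewrite (bigD1 a)//= big1 ?addr0.
  rewrite (_ : _ == _) ?mulr1 ?expr2//.
  by apply/eqP/rowP => i; rewrite !mxE subrr.
move=> b ba; rewrite (_ : _ == _ = false) ?mulr0//.
apply/negP => /eqP/rowP h; move/negP: ba; apply; apply/eqP/lat_inj/rowP => i.
by apply/eqP; rewrite -subr_eq0; have := h i; rewrite !mxE => ->.
Qed.

Lemma trig_interp_le y : trig_interp y <= W.
Proof.
rewrite -sum_weight ler_sum// => k _.
by rewrite ler_piMr ?weight_ge0// cos_le1.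
Qed.

(** Discrete Plancherel for the gradient. *)
Lemma weight_energy :
  \sum_k weight k * (\sum_i (2 - 2 * cos (freq k 0 i))) =
  \sum_i (2 * W - 2 * trig_interp (delta_mx 0 i)).
Proof.
under eq_bigr do rewrite mulr_sumr.
rewrite exchange_big/=; apply: eq_bigr => i _.
rewrite -sum_weight /trig_interp !mulr_sumr -sumrB; apply: eq_bigr => k _.
by rewrite [dotp _ (delta_mx _ _)]dotpC -[delta_mx 0 i]scale1r dotp_delta mul1r; ring.
Qed.

End Grid.

(** * The Rayleigh quotient of the discretised stable step *)

Lemma powR_le_tangent {R : realType} (r b : R) : 0 <= r -> 0 < b < 1 ->
  r `^ b <= 1 + b * (r - 1).
Proof.
move=> r0 /andP[b0 b1].
have := @conjugate_powR _ (r `^ b) 1 b^-1 (1 - b)^-1.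
rewrite powR_ge0 ler01 !invr_gt0 subr_gt0 b0 b1 !invrK mulr1 powR1 -powRrM.
rewrite mulfV ?gt_eqF// powRr1// addrC subrK => /(_ isT isT isT isT erefl).
by rewrite mul1r; lra.
Qed.

(** The tangent line at [lam ^ 2] of the convex function
    [q |-> exp (- tau q^(alpha/2))], with [q = x ^ 2]. *)
Lemma stretched_exp_tangent {R : realType} (tau alpha lam : R) :
  0 < tau -> 0 < alpha < 2 -> 0 < lam ->
  exists2 s : R, 0 < s & forall x, 0 <= x ->
    expR (- (tau * lam `^ alpha)) - s * (x ^+ 2 - lam ^+ 2) <=
    expR (- (tau * x `^ alpha)).
Proof.
move=> t0 /andP[a0 a2] l0.
pose u := tau * lam `^ alpha; have u0 : 0 < u by rewrite mulr_gt0// powR_gt0.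
exists (expR (- u) * (u * (alpha / 2)) / lam ^+ 2).
  by rewrite divr_gt0 ?exprn_gt0// mulr_gt0 ?expR_gt0// mulr_gt0// divr_gt0.
move=> x x0; pose r := x ^+ 2 / lam ^+ 2.
have xr : tau * x `^ alpha = u * r `^ (alpha / 2).
  have -> : r = (x / lam) `^ 2.
    by rewrite powR_mulrn ?divr_ge0 ?(ltW l0)// /r exprMn exprVn.
  rewrite -powRrM mulrCA divff// mulr1 /u -mulrA; congr (_ * _).
  rewrite -powRM ?divr_ge0 ?(ltW l0)//; congr (_ `^ _).
  by rewrite mulrC divfK// gt_eqF.
have r0 : 0 <= r by rewrite divr_ge0 ?sqr_ge0.
have := @powR_le_tangent _ r (alpha / 2) r0.
rewrite divr_gt0// ltr_pdivrMr// mul1r a2 => /(_ isT) h.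
rewrite xr.
have e : expR (- u) * (1 - u * (alpha / 2) * (r - 1)) <= expR (- (u * r `^ (alpha / 2))).
  apply: (@le_trans _ _ (expR (- u) * expR (- (u * (alpha / 2) * (r - 1))))).
    by rewrite ler_wpM2l ?expR_ge0// (le_trans _ (expR_ge1Dx _)).
  rewrite -expRD ler_expR -opprD lerN2.
  have : u * r `^ (alpha / 2) <= u * (1 + alpha / 2 * (r - 1)).
    by rewrite ler_wpM2l// ltW.
  by lra.
apply: le_trans e; rewrite le_eqVlt; apply/orP; left; apply/eqP.
by rewrite /r; field; rewrite gt_eqF.
Qed.

Lemma enorm_sqrE {R : realType} {N : nat} (x : 'rV[R]_N) :
  enorm x ^+ 2 = \sum_i x 0 i ^+ 2.
Proof. by rewrite enorm_sqr; apply: eq_bigr => i _; rewrite expr2. Qed.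

(** For small mesh the symbol of the discrete Laplacian may replace
    [|xi| ^ 2] in the tangent line: low frequencies are barely changed, and at
    high frequencies the right-hand side is negative. *)
Lemma symbol_tangent {R : realType} {N : nat} (tau alpha lam e : R) :
  0 < tau -> 0 < alpha < 2 -> 0 < lam -> 0 < e ->
  exists2 s : R, 0 < s & exists2 d0 : R, 0 < d0 &
    forall (dl : R) (th : 'rV[R]_N), 0 < dl <= d0 ->
      (forall i, `|th 0 i| <= pi) ->
      expR (- (tau * lam `^ alpha)) - e -
        s * ((\sum_i (2 - 2 * cos (th 0 i))) / dl ^+ 2 - lam ^+ 2) <=
      expR (- (tau * enorm (dl^-1 *: th) `^ alpha)).
Proof.
move=> t0 a02 l0 e0.
have [s s0 tang] := stretched_exp_tangent t0 a02 l0.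
exists s => //.
pose Q := 12 * (1 + s * lam ^+ 2) / s.
have Q0 : 0 < Q by rewrite divr_gt0// mulr_gt0// ltr_pwDl// mulr_ge0 ?sqr_ge0 ?ltW.
exists (Num.min 1 (12 * e / (s * Q ^+ 2))).
  by rewrite lt_min ltr01/= divr_gt0// mulr_gt0// exprn_gt0.
move=> dl th /andP[d0]; rewrite le_min => /andP[d1 d2] thpi.
have dd0 : 0 < dl ^+ 2 by rewrite exprn_gt0.
set x := enorm _; set E := \sum_i _.
pose S := \sum_i th 0 i ^+ 2.
have xS : x ^+ 2 = S / dl ^+ 2.
  rewrite enorm_sqrE /S mulr_suml; apply: eq_bigr => i _.
  by rewrite mxE exprMn exprVn mulrC.
have S0 : 0 <= S by apply: sumr_ge0 => i _; rewrite sqr_ge0.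
have SE : S <= 12 * E.
  by rewrite /E mulr_sumr ler_sum// => i _; exact: sqr_le_cos.
have SE2 : S - S ^+ 2 / 12 <= E.
  apply: (@le_trans _ _ (\sum_i (th 0 i ^+ 2 - th 0 i ^+ 4 / 12))); last first.
    by apply: ler_sum => i _; exact: sqr_sub_cos_le.
  rewrite sumrB lerD2l lerN2 -mulr_suml ler_wpM2r ?invr_ge0//.
  rewrite expr2 {1}/S mulr_suml ler_sum// => i _.
  rewrite (_ : th 0 i ^+ 4 = th 0 i ^+ 2 * th 0 i ^+ 2); last by ring.
  rewrite ler_wpM2l ?sqr_ge0// /S (bigD1 i)//= lerDl.
  by apply: sumr_ge0 => j _; rewrite sqr_ge0.
have x0 : 0 <= x by rewrite enorm_ge0.
have [qQ|qQ] := leP (x ^+ 2) Q; last first.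
  apply: (@le_trans _ _ 0); last exact: expR_ge0.
  have h1 : x ^+ 2 / 12 <= E / dl ^+ 2.
    by rewrite xS mulrAC ler_wpM2r ?invr_ge0 ?(ltW dd0)// ler_pdivrMr// mulrC.
  have h2 : 1 + s * lam ^+ 2 <= s * (E / dl ^+ 2).
    apply: (@le_trans _ _ (s * (Q / 12))).
      by rewrite /Q le_eqVlt; apply/orP; left; apply/eqP; field; rewrite gt_eqF.
    by rewrite ler_wpM2l ?(ltW s0)// (le_trans _ h1)// ler_wpM2r// ltW.
  have h3 : expR (- (tau * lam `^ alpha)) <= 1.
    by rewrite -expR0 ler_expR oppr_le0 mulr_ge0 ?powR_ge0 ?ltW.
  lra.
apply: le_trans (tang _ x0).
have h1 : x ^+ 2 - E / dl ^+ 2 <= dl ^+ 2 * Q ^+ 2 / 12.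
  have : x ^+ 2 - E / dl ^+ 2 <= dl ^+ 2 * (x ^+ 2) ^+ 2 / 12.
    have -> : dl ^+ 2 * (x ^+ 2) ^+ 2 / 12 = (S ^+ 2 / 12) / dl ^+ 2.
      by rewrite xS; field; rewrite gt_eqF.
    by rewrite xS -mulrBl ler_wpM2r ?invr_ge0 ?(ltW dd0)//; lra.
  move=> /le_trans; apply; rewrite ler_wpM2r ?invr_ge0// ler_wpM2l ?(ltW dd0)//.
  by rewrite ler_pXn2r ?nnegrE ?sqr_ge0 ?(ltW Q0).
have h2 : s * (dl ^+ 2 * Q ^+ 2 / 12) <= e.
  have : dl ^+ 2 <= 12 * e / (s * Q ^+ 2).
    by rewrite (le_trans _ d2)// expr2 ger_pMl.
  have -> : s * (dl ^+ 2 * Q ^+ 2 / 12) = dl ^+ 2 * (s * Q ^+ 2) / 12 by field.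
  rewrite ler_pdivlMr; last by rewrite mulr_gt0// exprn_gt0.
  by rewrite ler_pdivrMr// [e * 12]mulrC.
have : s * (x ^+ 2 - E / dl ^+ 2) <= e by rewrite (le_trans _ h2)// ler_wpM2l// ltW.
lra.
Qed.

(** Rounding towards zero, chosen because it is an odd function: rounded
    symmetric vectors are symmetric. *)
Definition round0 {R : realType} (x : R) : int :=
  (Num.truncn x)%:Z - (Num.truncn (- x))%:Z.

Section Rounding.
Context {R : realType}.
Implicit Types x y : R.

Lemma round0N x : round0 (- x) = - round0 x.
Proof. by rewrite /round0 opprK opprB. Qed.

Lemma round0_itv x : 0 <= x -> (round0 x)%:~R <= x < (round0 x)%:~R + 1.
Proof.
move=> x0; rewrite /round0 (_ : Num.truncn (- x) = 0%N).
  by rewrite subr0 -pmulrn natr1; exact: truncn_itv.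
by apply/truncn0Pn; rewrite -ltNge; lra.
Qed.

Lemma dist_round0 x : `|x - (round0 x)%:~R| <= 1.
Proof.
wlog x0 : x / 0 <= x.
  move=> H; have [/H//|x0] := leP 0 x.
  have := H (- x); rewrite round0N mulrNz -opprD normrN; apply; lra.
by have /andP[h1 h2] := round0_itv x0; rewrite ger0_norm; lra.
Qed.

Lemma le_norm_round0 x : `|(round0 x)%:~R| <= `|x|.
Proof.
wlog x0 : x / 0 <= x.
  move=> H; have [/H//|x0] := leP 0 x.
  have := H (- x); rewrite round0N mulrNz !normrN; apply; lra.
have /andP[h1 h2] := round0_itv x0; rewrite [leRHS]ger0_norm// ger0_norm//.
by rewrite /round0 (_ : Num.truncn (- x) = 0%N) ?subr0// ?ler0n//;
  apply/truncn0Pn; rewrite -ltNge; lra.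
Qed.

Lemma le_round0 x y : x <= y -> round0 x <= round0 y.
Proof.
move=> xy; rewrite /round0 lerB// lez_nat le_truncn//.
by rewrite lerN2.
Qed.

Lemma round0_preimage_measurable (n : int) : measurable [set x : R | round0 x = n].
Proof.
apply: is_interval_measurable => x y xn yn z /andP[/le_round0 xz /le_round0 zy].
by apply/eqP; rewrite eq_le -{1}yn -xn xz zy.
Qed.

End Rounding.

Definition roundv {R : realType} {N : nat} (dl : R) (x : 'rV[R]_N) : 'rV[R]_N :=
  \row_i (round0 (x 0 i / dl))%:~R.

Lemma roundv_preimage_measurable {R : realType} {N : nat} (dl : R) (c : 'rV[R]_N) :
  measurable ([set x | roundv dl x = c] : set (borel_rV R N)).
Proof.
pose S i : set (borel_rV R N) := [set x : 'rV[R]_N | (round0 (x 0 i / dl))%:~R = c 0 i].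
rewrite (_ : [set x | _] = \bigcap_(i in [set: 'I_N]) S i); last first.
  apply/seteqP; split => x /= h; first by move=> i _; rewrite /S /= -h mxE.
  by apply/rowP => i; rewrite mxE; exact: h.
apply: fin_bigcap_measurable => // i _.
have [[n cn]|nc] := pselect (exists n : int, n%:~R = c 0 i).
  rewrite (_ : S i = (fun x : 'rV[R]_N => x 0 i / dl) @^-1` [set y | round0 y = n]).
    rewrite -[X in measurable X]setTI.
    have : measurable_fun setT (fun x : borel_rV R N => (x : 'rV[R]_N) 0 i / dl).
      by apply: measurable_funM; [exact: coord_measurable|exact: measurable_cst].
    by apply => //; exact: round0_preimage_measurable.
  apply/seteqP; split => x; rewrite /S /= -cn; first by move/intr_inj.
  by move=> ->.
rewrite (_ : S i = set0)//; apply/seteqP; split => // x h; apply: nc.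
by exists (round0 ((x : 'rV[R]_N) 0 i / dl)).
Qed.

(** The mesh bound [d0] precedes the base point, so that one test function serves
    all lattices: the mesh is only chosen once the number of steps is known. *)
Definition discrete_subsolution {R : realType} {N : nat} (lam : R)
    (f : 'rV[R]_N -> R) : Prop :=
  [/\ forall x, 0 <= f x,
      forall x, f x != 0 -> forall i, `|x 0 i| <= 1 &
      exists2 d0 : R, 0 < d0 & forall (dl : R) x, 0 < dl <= d0 -> f x != 0 ->
        \sum_i (2 * f x - f (x + dl *: delta_mx 0 i) - f (x - dl *: delta_mx 0 i))
        <= dl ^+ 2 * lam ^+ 2 * f x].

Section LatticeRayleigh.
Context {R : realType} {N : nat} {d : measure_display} {Omega : measurableType d}.
Variables (P : probability Omega R) (Z : Omega -> 'rV[R]_N) (alpha tau lam : R).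
Hypotheses (alpha02 : 0 < alpha < 2) (tau0 : 0 < tau) (lam0 : 0 < lam).
Hypothesis mZ : measurable_fun setT (Z : Omega -> borel_rV R N).
Hypothesis cosZ : forall xi,
  \int[P]_w cos (dotp xi (Z w)) = expR (- (tau * enorm xi `^ alpha)).
Variable f : 'rV[R]_N -> R.
Hypothesis subf : discrete_subsolution lam f.

Let f0 x : 0 <= f x. Proof. by have [+ _ _] := subf; exact. Qed.

Let sample (dl : R) (K : nat) (a : grid K) := f (dl *: lat a).

(** Summation by parts turns the energy into the sum of [f] times its discrete
    Laplacian, translates by one mesh staying inside the grid. *)
Let energy_le : exists2 d0 : R, 0 < d0 & forall (dl : R) K, 0 < dl <= d0 ->
  2 / dl + 2 <= K%:R ->
  (forall a : grid K, sample dl a != 0 -> forall i, 2 * `|lati a i| <= K%:Z) /\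
  \sum_k weight (@sample dl K) k * (\sum_i (2 - 2 * cos (freq k 0 i))) <=
  dl ^+ 2 * lam ^+ 2 * \sum_a @sample dl K a ^+ 2.
Proof.
have [_ fs [d0 d00 fe]] := subf.
exists d0 => // dl K dl0 KL; set F := @sample dl K.
have dlp : 0 < dl by have /andP[] := dl0.
have latF (a : grid K) : F a != 0 -> forall i, `|(lati a i)%:~R : R| <= dl^-1.
  move=> /fs h i; have := h i; rewrite !mxE normrM gtr0_norm// => h'.
  by rewrite -div1r ler_pdivlMr// mulrC.
have suppF (a : grid K) : F a != 0 -> forall i, 2 * `|lati a i| <= K%:Z - 2.
  move=> /latF h i; have := h i; rewrite -(ler_int R) intrM intr_norm.
  by rewrite intrB -!pmulrn; lra.
have suppF' a : F a != 0 -> forall i, 2 * `|lati a i| <= K%:Z.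
  by move=> h i; have := suppF a h i; lia.
split=> //; rewrite (weight_energy suppF').
pose e i : 'rV[R]_N := delta_mx 0 i.
have K2 : (2 <= K)%N.
  rewrite -(ler_nat R); have : 0 <= 2 / dl by rewrite divr_ge0// ltW.
  by lra.
have sumshift (a : grid K) (sg : int) i : `|sg| = 1 -> F a != 0 ->
    \sum_b F b * (lat b - lat a == sg%:~R *: e i)%:R =
    f (dl *: lat a + (sg%:~R * dl : R) *: e i).
  move=> sg1 Fa.
  have [|b hb] := @lat_ex N K (fun j => lati a j + sg * (j == i)%:Z).
    move=> j; have h1 := suppF a Fa j.
    have h2 : `|sg * (j == i)%:Z| <= 1 by rewrite normrM sg1; case: (j == i).
    by move: h1 h2; move: (lati a j) (sg * _) => u v; clear; lia.
  have lb : lat b = lat a + sg%:~R *: e i :> 'rV[R]_N.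
    by apply/rowP => j; rewrite !mxE hb eqxx /= [LHS]intrD intrM.
  rewrite (bigD1 b)//= big1 ?addr0.
    rewrite lb [lat a + _]addrC addrK eqxx mulr1 /F /sample lb scalerDr scalerA.
    by rewrite [dl * _]mulrC [X in f X]addrC.
  move=> b' bb'; rewrite (_ : _ == _ = false) ?mulr0//.
  apply/negP => /eqP h; move/negP: bb'; apply; apply/eqP/(@lat_inj R).
  by rewrite lb -h addrC subrK.
have eE i : e i = \row_j ((j == i)%:Z)%:~R.
  by apply/rowP => j; rewrite !mxE eqxx.
have tE i : trig_interp F (e i) =
    \sum_a \sum_b F a * F b * (lat b - lat a == e i)%:R.
  by rewrite eE (trig_interp_int suppF')// => j; case: (j == i); clear -K2; lia.
have t1 i : trig_interp F (e i) = \sum_a F a * f (dl *: lat a + dl *: e i).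
  rewrite tE; apply: eq_bigr => a _.
  have [->|Fa] := eqVneq (F a) 0; first by rewrite mul0r big1// => b _; rewrite !mul0r.
  have := @sumshift a 1 i erefl Fa; rewrite mul1r scale1r => <-.
  by rewrite mulr_sumr; apply: eq_bigr => b _; rewrite mulrA.
have t2 i : trig_interp F (e i) = \sum_a F a * f (dl *: lat a - dl *: e i).
  rewrite tE exchange_big/=; apply: eq_bigr => a _.
  have [->|Fa] := eqVneq (F a) 0; first by rewrite mul0r big1// => b _; rewrite mulr0 mul0r.
  have := @sumshift a (-1) i erefl Fa.
  rewrite (_ : (-1)%:~R = -1 :> R)// mulN1r [- dl *: _]scaleNr => <-.
  rewrite mulr_sumr; apply: eq_bigr => b _; rewrite mulrA [F a * _]mulrC.
  congr (_ * _%:R); rewrite -[lat b - _]opprB -[lat a - lat b == _](inj_eq oppr_inj).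
  by rewrite scaleN1r.
apply: (@le_trans _ _ (\sum_a F a * \sum_i (2 * F a - f (dl *: lat a + dl *: e i)
    - f (dl *: lat a - dl *: e i)))).
  rewrite le_eqVlt; apply/orP; left; apply/eqP.
  under [RHS]eq_bigr do rewrite mulr_sumr.
  rewrite exchange_big/=; apply: eq_bigr => i _.
  have -> : 2 * trig_interp F (e i) = trig_interp F (e i) + trig_interp F (e i) by ring.
  rewrite {1}t1 t2 mulr_sumr -big_split/= -sumrB; apply: eq_bigr => a _; ring.
rewrite mulr_sumr ler_sum// => a _.
have [->|Fa] := eqVneq (F a) 0; first by rewrite mul0r expr0n mulr0.
rewrite expr2 mulrCA; apply: ler_wpM2l; first exact: f0.
exact: fe.
Qed.

Let mprob (B : set (borel_rV R N)) : measurable B -> measurable (Z @^-1` B).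
Proof. by move=> mB; rewrite -[X in measurable X]setTI; exact: mZ. Qed.

Let tail_small (e dl : R) : 0 < e -> 0 < dl ->
  exists K0 : nat, forall K, (K0 <= K)%N ->
    fine (P (Z @^-1` (~` ccube 0 (K%:R * dl)))) <= e.
Proof.
move=> e0 dl0.
pose B (K : nat) := Z @^-1` ccube 0 (K%:R * dl).
have mB K : measurable (B K) by apply: mprob; exact: ccube_measurable.
have ndB : nondecreasing_seq B.
  move=> m n mn; apply/subsetPset => w h i; rewrite (le_trans (h i))//.
  by rewrite ler_wpM2r ?(ltW dl0)// ler_nat.
have UB : \bigcup_n B n = setT.
  apply/seteqP; split => // w _.
  exists (Num.truncn ((\sum_i `|Z w 0 i|) / dl)).+1 => // i.
  rewrite mxE subr0 -ler_pdivrMr//.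
  apply: (@le_trans _ _ ((\sum_i `|Z w 0 i|) / dl)); last by rewrite ltW// truncnS_gt.
  by rewrite ler_wpM2r ?invr_ge0 ?(ltW dl0)// (bigD1 i)//= lerDl sumr_ge0.
have mU : measurable (\bigcup_n B n) by rewrite UB.
have PU : P (\bigcup_n B n) = 1%:E by rewrite UB; exact: probability_setT.
have cP : P (B K) @[K --> \oo] --> 1%:E.
  by rewrite -PU; exact: nondecreasing_cvg_mu mB mU ndB.
move: cP => /fine_cvg/cvgrPdist_le /(_ e e0)[K0 _ hK].
exists K0 => K K0K; have := hK K K0K => /=.
have -> : P (Z @^-1` (~` ccube 0 (K%:R * dl))) = (1 - fine (P (B K)))%:E.
  rewrite -[Z @^-1` _]/(~` B K) EFinB fineK ?fin_num_measure//.
  exact: probability_setC.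
rewrite /=.
exact: le_trans (ler_norm _).
Qed.

Let trig_measurable K (F : grid K -> R) dl :
  bmeas (fun w => trig_interp F (dl^-1 *: Z w)).
Proof.
apply: bmeas_sum => k _; apply: bmeasZ.
have := bmeas_comp mZ (bmeas_cos (dl^-1 *: freq k) 0).
by congr bmeas; apply/funext => w; rewrite addr0 dotpZr dotpZl.
Qed.

(** The double sum on the right is the expectation of the autocorrelation of
    the sampled [f] at the rounded step. By Fourier inversion on the grid it is,
    without the rounding, the average of the characteristic function over the
    power spectrum of [f]; the tangent line of the symbol turns this average into
    the energy of [f]. Rounding costs [O(dl)], because the energy also
    controls the increments of the interpolation, and the periodicity of the interpolation costs the
    probability that the step leaves the grid. *)
Theorem lattice_rayleigh (e : R) : 0 < e -> exists2 d0 : R, 0 < d0 &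
  forall dl : R, 0 < dl <= d0 -> exists K : nat, 2 / dl + 2 <= K%:R /\
    (expR (- (tau * lam `^ alpha)) - e) * \sum_(a : grid K) f (dl *: lat a) ^+ 2
    <= \sum_(a : grid K) \sum_(b : grid K) f (dl *: lat a) * f (dl *: lat b) *
         fine (P (Z @^-1` [set x | roundv dl x = lat b - lat a])).
Proof.
move=> e0; have e30 : 0 < e / 3 by rewrite divr_gt0.
have [s s0 [d1 d10 tang]] := symbol_tangent (N := N) tau0 alpha02 lam0 e30.
have [d2 d20 energy] := energy_le.
pose D := N%:R + 12 * lam ^+ 2 : R.
have D0 : 0 < D + 1 by rewrite /D; have := sqr_ge0 lam; have := ler0n R N; lra.
exists (Num.min (Num.min d1 d2) (e / 3 / (D + 1))).
  by rewrite !lt_min d10 d20 divr_gt0.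
move=> dl /andP[dl0]; rewrite !le_min => /andP[/andP[dl1 dl2] dl3].
have [K0 hK0] := tail_small e30 dl0.
pose K := maxn K0 (Num.truncn (2 / dl + 2)).+1.
have KL : 2 / dl + 2 <= K%:R.
  by rewrite (le_trans (ltW (truncnS_gt _)))// ler_nat leq_maxr.
have tailK : fine (P (Z @^-1` (~` ccube 0 (K%:R * dl)))) <= e / 3.
  by apply: hK0; rewrite leq_maxl.
exists K; split => //.
rewrite -/(@sample dl K); pose F := @sample dl K.
have [suppF] := energy dl K (introT andP (conj dl0 dl2)) KL.
rewrite -/F => nrg.
set W := \sum_a _ ^+ 2 in nrg *.
have W0 : 0 <= W by apply: sumr_ge0 => a _; rewrite sqr_ge0.
pose E (k : @grid N K) : R := \sum_i (2 - 2 * cos ((freq k : 'rV[R]_N) 0 i)).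
pose Ev (a b : grid K) := Z @^-1` [set x | roundv dl x = lat b - lat a :> 'rV[R]_N].
have mEv (a b : grid K) : measurable (Ev a b).
  by apply: mprob; exact: roundv_preimage_measurable.
pose Tl := Z @^-1` (~` ccube 0 (K%:R * dl)).
have mTl : measurable Tl by apply: mprob; apply: measurableC; exact: ccube_measurable.
have FF0 (a b : grid K) : 0 <= F a * F b by rewrite mulr_ge0 ?f0.
(* The expectation of the interpolation, from the characteristic function. *)
have expG : \int[P]_w trig_interp F (dl^-1 *: Z w) =
    \sum_k weight F k * expR (- (tau * enorm (dl^-1 *: freq k : 'rV[R]_N) `^ alpha)).
  have bc (k : grid K) : bmeas (fun w => cos (dotp (freq k) (dl^-1 *: Z w))).
    have := bmeas_comp mZ (bmeas_cos (dl^-1 *: freq k) 0).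
    by congr bmeas; apply/funext => w; rewrite addr0 dotpZr dotpZl.
  rewrite exp_sum; last by move=> k _; exact: bmeasZ.
  apply: eq_bigr => k _; rewrite expZ// -cosZ.
  congr (_ * _); apply: eq_Rintegral => w _.
  by rewrite dotpZr (dotpZl dl^-1).
have sumW : \sum_k weight F k = W := sum_weight suppF.
have lower : (expR (- (tau * lam `^ alpha)) - e / 3) * W <=
    \int[P]_w trig_interp F (dl^-1 *: Z w).
  rewrite expG -sumW.
  have h (k : grid K) := tang dl (freq k) (introT andP (conj dl0 dl1)) (freq_le_pi k).
  apply: (@le_trans _ _ (\sum_k weight F k * (expR (- (tau * lam `^ alpha)) - e / 3
     - s * (E k / dl ^+ 2 - lam ^+ 2)))); last first.
    by apply: ler_sum => k _; apply: ler_wpM2l; [exact: weight_ge0|exact: h].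
  have -> : \sum_k weight F k * (expR (- (tau * lam `^ alpha)) - e / 3
     - s * (E k / dl ^+ 2 - lam ^+ 2)) =
     (expR (- (tau * lam `^ alpha)) - e / 3) * (\sum_k weight F k) +
     s * (lam ^+ 2 * (\sum_k weight F k) - (\sum_k weight F k * E k) / dl ^+ 2).
    rewrite !mulr_sumr mulr_suml -sumrB mulr_sumr -big_split/=.
    by apply: eq_bigr => k _; ring.
  rewrite lerDl mulr_ge0 ?(ltW s0)// subr_ge0 ler_pdivrMr ?exprn_gt0//.
  rewrite (le_trans nrg)// sumW le_eqVlt; apply/orP; left; apply/eqP; ring.
have upper : \int[P]_w trig_interp F (dl^-1 *: Z w) <=
    \int[P]_w (\sum_a \sum_b F a * F b * \1_(Ev a b) w + W * \1_Tl w + dl * D * W).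
  have bS : bmeas (fun w => \sum_a \sum_b F a * F b * \1_(Ev a b) w).
    apply: bmeas_sum => a _; apply: bmeas_sum => b _; apply: bmeasZ.
    exact: bmeas_indic.
  apply: le_exp.
  - exact: trig_measurable.
  - apply: bmeasD; last exact: bmeas_cst.
    by apply: bmeasD => //; apply: bmeasZ; exact: bmeas_indic.
  move=> w; pose r := roundv dl (Z w).
  have step : trig_interp F (dl^-1 *: Z w) <= trig_interp F r + dl * D * W.
    apply: (@le_trans _ _ (trig_interp F r +
        \sum_k weight F k * (N%:R * dl + 12 / dl * E k))).
      rewrite /trig_interp -big_split/=; apply: ler_sum => k _.
      rewrite -mulrDr ler_wpM2l ?weight_ge0// addrC -lerBlDr.
      apply: (le_trans (ler_norm _)); apply: (le_trans (cos_lipschitz _ _)).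
      rewrite -dotpBr (le_trans (ler_norm_sum _ _ _))//.
      apply: (@le_trans _ _ (\sum_i (dl + 12 / dl * (2 - 2 * cos (freq k 0 i))))).
        apply: ler_sum => i _; rewrite normrM.
        apply: (@le_trans _ _ `|freq k 0 i|).
          rewrite ler_piMr// !mxE mulrC; exact: dist_round0.
        have := @sqr_le_cos R _ (@freq_le_pi R N K k i); set x := freq k 0 i => hx.
        have : `|x| * dl <= dl ^+ 2 + x ^+ 2.
          rewrite -[x ^+ 2]real_normK ?num_real//.
          have := sqr_ge0 (`|x| - dl); have := normr_ge0 x; rewrite !expr2; nra.
        move=> hxd; have : `|x| * dl <= (dl + 12 / dl * (2 - 2 * cos x)) * dl.
          rewrite mulrDl -expr2 mulrAC divfK ?gt_eqF//; lra.
        by rewrite ler_pM2r.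
      rewrite big_split/= sumr_const card_ord -mulr_sumr /E.
      by rewrite -[_ *+ N]mulr_natl.
    rewrite lerD2l.
    have -> : \sum_k weight F k * (N%:R * dl + 12 / dl * E k) =
       N%:R * dl * (\sum_k weight F k) + 12 / dl * (\sum_k weight F k * E k).
      by rewrite !mulr_sumr -big_split/=; apply: eq_bigr => k _; ring.
    rewrite sumW.
    have : 12 / dl * (\sum_k weight F k * E k) <= 12 / dl * (dl ^+ 2 * lam ^+ 2 * W).
      by rewrite ler_wpM2l ?divr_ge0 ?(ltW dl0).
    have -> : 12 / dl * (dl ^+ 2 * lam ^+ 2 * W) = 12 * dl * lam ^+ 2 * W.
      by field; rewrite gt_eqF.
    rewrite /D; lra.
  apply: (le_trans step); rewrite lerD2r.
  have S0 : 0 <= \sum_a \sum_b F a * F b * \1_(Ev a b) w :> R.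
    by apply: sumr_ge0 => a _; apply: sumr_ge0 => b _; rewrite mulr_ge0.
  have [wT|wT] := pselect (Tl w).
    by rewrite indicE mem_set// mulr1 (le_trans (trig_interp_le suppF r))// lerDr.
  rewrite [\1_Tl w]indicE memNset// mulr0 addr0.
  have wK i : `|Z w 0 i| <= K%:R * dl.
    have : ccube 0 (K%:R * dl) (Z w) by apply: contrapT.
    by move=> /(_ i); rewrite mxE subr0.
  rewrite /r (trig_interp_int suppF); last first.
    move=> i; rewrite -(ler_int R) intr_norm (le_trans (le_norm_round0 _))//.
    by rewrite normrM normfV (gtr0_norm dl0) ler_pdivrMr//; exact: wK.
  apply: ler_sum => a _; apply: ler_sum => b _; rewrite indicE.
  rewrite ler_wpM2l// le_eqVlt; apply/orP; left; apply/eqP; congr (_%:R).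
  by congr nat_of_bool; apply/eqP/idP => [h|/set_mem h]; [apply/mem_set|].
have expS : \int[P]_w (\sum_a \sum_b F a * F b * \1_(Ev a b) w +
      W * \1_Tl w + dl * D * W) =
    \sum_a \sum_b F a * F b * fine (P (Ev a b)) + W * fine (P Tl) + dl * D * W.
  have bI (a b : grid K) : bmeas (fun w => F a * F b * \1_(Ev a b) w).
    by apply: bmeasZ; exact: bmeas_indic.
  have bS : bmeas (fun w => \sum_a \sum_b F a * F b * \1_(Ev a b) w).
    by apply: bmeas_sum => a _; apply: bmeas_sum => b _.
  have bT : bmeas (fun w => W * \1_Tl w) by apply: bmeasZ; exact: bmeas_indic.
  rewrite expD; [|exact: bmeasD|exact: bmeas_cst].
  rewrite expD// exp_cst expZ ?exp_indic//; last exact: bmeas_indic.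
  congr (_ + _ + _); rewrite exp_sum; last by move=> a _; exact: bmeas_sum.
  apply: eq_bigr => a _; rewrite exp_sum//; apply: eq_bigr => b _.
  by rewrite expZ ?exp_indic//; exact: bmeas_indic.
have WT : W * fine (P Tl) <= W * (e / 3) by rewrite ler_wpM2l.
have DD : dl * D * W <= e / 3 * W.
  rewrite ler_wpM2r//; move: dl3; rewrite ler_pdivlMr//.
  have : dl * D <= dl * (D + 1) by rewrite ler_wpM2l ?(ltW dl0)//; lra.
  lra.
move: (le_trans lower upper); rewrite expS.
set S := \sum_a \sum_b _ => h.
have : (expR (- (tau * lam `^ alpha)) - e) * W =
  (expR (- (tau * lam `^ alpha)) - e / 3) * W - W * (e / 3) - e / 3 * W by field.
move=> ->; rewrite /S in h *; lra.
Qed.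

End LatticeRayleigh.

(** * Probability that the process stays in a ball *)

Lemma sum_disjoint_le {R : realType} {d : measure_display} {Omega : measurableType d}
    (P : probability Omega R) (I : finType) (p : pred I) (G : I -> set Omega)
    (U : set Omega) :
  (forall i, measurable (G i)) -> measurable U ->
  (forall i, p i -> G i `<=` U) ->
  (forall i j w, p i -> p j -> G i w -> G j w -> i = j) ->
  \sum_(i | p i) fine (P (G i)) <= fine (P U).
Proof.
move=> mG mU GU disj; rewrite -exp_indic//.
under eq_bigr do rewrite -exp_indic//.
rewrite -exp_sum; last by move=> i _; exact: bmeas_indic.
apply: le_exp.
- by apply: bmeas_sum => i _; exact: bmeas_indic.
- exact: bmeas_indic.
move=> w; have [[i [pi Gi]]|none] := pselect (exists i, p i /\ G i w).
  rewrite (bigD1 i)//= big1 ?addr0.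
    by rewrite !indicE !mem_set//; exact: (GU i).
  move=> j /andP[pj ji]; rewrite indicE memNset// => Gj.
  by move/eqP: ji; apply; exact: disj Gj Gi.
rewrite big1; first by rewrite indicE ler0n.
by move=> i pi; rewrite indicE memNset// => Gi; apply: none; exists i.
Qed.

Section Walk.
Context {R : realType} {N : nat} {d : measure_display} {Omega : measurableType d}.
Variables (P : probability Omega R) (Y : R -> Omega -> 'rV[R]_N).
Hypothesis levyY : is_levy_process P Y.
Variables (K n : nat) (s h : R) (L : set (borel_rV R N)) (Lam : pred (@grid N K)).
Variable u : nat -> R.
Hypotheses (mL : measurable L) (u0 : 0 <= u 0%N) (undec : forall i, u i <= u i.+1).
Hypothesis uh : forall i, (0 < i <= n)%N -> u i.+1 - u i = h.

Let inc i := increment Y (u i) (u i.+1).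

Let u_ge0 i : 0 <= u i.
Proof. by elim: i => // i IHi; exact: le_trans (undec i). Qed.

Let minc i (B : set (borel_rV R N)) : measurable B -> measurable (inc i @^-1` B).
Proof.
move=> mB; rewrite -[X in measurable X]setTI.
exact: (increment_measurable levyY (u_ge0 i) (u_ge0 i.+1)).
Qed.

Definition round_to (c : 'rV[R]_N) : set (borel_rV R N) := [set x | roundv s x = c].

Let mround c : measurable (round_to c).
Proof. exact: roundv_preimage_measurable. Qed.

(** The rounded increments number [m], ..., [m + j - 1] lead from the lattice
    point [a] along points of [Lam], and the next increment is in [L]. *)
Fixpoint walk j m (a : grid K) : set Omega :=
  if j is j'.+1 then
    [set w | exists b, [/\ Lam a && Lam b,
       (inc m @^-1` round_to (lat b - lat a)) w & walk j' m.+1 b w]]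
  else inc m @^-1` L.

Definition walk_kernel (a b : grid K) : R :=
  (Lam a && Lam b)%:R * fine (P (Y h @^-1` round_to (lat b - lat a))).

Lemma walk_measurable j m a : measurable (walk j m a).
Proof.
elim: j m a => [|j IHj] m a /=; first exact: minc.
rewrite (_ : [set w | _] = \bigcup_(b in [set b | Lam a && Lam b])
    (inc m @^-1` round_to (lat b - lat a) `&` walk j m.+1 b)).
  apply: fin_bigcup_measurable; first exact: finite_finset.
  by move=> b _; apply: measurableI => //; exact: minc.
by apply/seteqP; split => w; [move=> [b [? ? ?]]; exists b|move=> [b ? []]; exists b].
Qed.

Let prefix m (B : nat -> set (borel_rV R N)) := \bigcap_(i < m) inc i @^-1` B i.

Let mprefix m B : (forall i, measurable (B i)) -> measurable (prefix m B).
Proof. by move=> mB; apply: bigcap_measurableType => i _; exact: minc. Qed.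

Let prefixE m B : (forall i, measurable (B i)) ->
  fine (P (prefix m B)) = \prod_(i < m) fine (P (inc i @^-1` B i)).
Proof.
move=> mB; have [_ _ indY _ _] := levyY.
rewrite /prefix indY//.
elim: m => [|m IHm]; first by rewrite !big_ord0.
rewrite !big_ord_recr/= fineM ?IHm//; last by rewrite fin_num_measure//; exact: minc.
rewrite -[X in X \is a fin_num](indY m u B)// fin_num_measure//; exact: mprefix.
Qed.

Let prefixS m B C : prefix m.+1 (fun i => if i == m then C else B i) =
  prefix m B `&` inc m @^-1` C.
Proof.
apply/seteqP; split => w.
  move=> hw; split; last by have := hw m (ltnSn m); rewrite eqxx.
  by move=> i im; have := hw i (ltnW im); rewrite (ltn_eqF im).
move=> [hB hC] i; rewrite /= ltnS leq_eqVlt => /orP[/eqP->|im]; first by rewrite eqxx.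
by rewrite (ltn_eqF im); exact: hB.
Qed.

(** Summation over the lattice paths, by induction on the number of remaining
    steps, with arbitrary events imposed on the previous increments. *)
Lemma walk_prob j m a (B : nat -> set (borel_rV R N)) :
  (0 < m)%N -> (m + j <= n.+1)%N -> (forall i, measurable (B i)) ->
  (\prod_(i < m) fine (P (inc i @^-1` B i))) *
    iter j (kapply walk_kernel) (fun=> 1) a * fine (P (inc (m + j) @^-1` L))
  <= fine (P (prefix m B `&` walk j m a)).
Proof.
elim: j m a B => [|j IHj] m a B m0 mj mB.
  rewrite mulr1 addn0 /= -prefixS prefixE => [|i]; last by case: ifP.
  rewrite big_ord_recr/= eqxx le_eqVlt; apply/orP; left; apply/eqP; congr (_ * _).
  by apply: eq_bigr => i _; rewrite ltn_eqF.
rewrite iterS {1}/kapply mulr_sumr mulr_suml.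
pose p b := Lam a && Lam b.
pose B' (b : grid K) (i : nat) := if i == m then round_to (lat b - lat a) else B i.
have mB' b i : measurable (B' b i) by rewrite /B'; case: ifP.
pose G b := prefix m.+1 (B' b) `&` walk j m.+1 b.
have mG b : measurable (G b) by apply: measurableI; [exact: mprefix|exact: walk_measurable].
apply: (@le_trans _ _ (\sum_(b | p b) fine (P (G b)))); last first.
  apply: sum_disjoint_le => //.
  - by apply: measurableI; [exact: mprefix|exact: walk_measurable].
  - by move=> b pb w []; rewrite prefixS => -[hB hr] hw; split => //; exists b.
  - move=> b c w _ _ []; rewrite prefixS => -[_ h1] _ []; rewrite prefixS => -[_ h2] _.
    have /addIr : (lat b - lat a : 'rV[R]_N) = lat c - lat a by rewrite -h1 -h2.
    exact: lat_inj.
rewrite [leRHS]big_mkcond/= ler_sum// => b _.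
rewrite /walk_kernel -/(p b); case: (p b); last by rewrite !mul0r mulr0 mul0r.
rewrite mul1r.
have := IHj m.+1 b (B' b) isT _ (mB' b); rewrite addSnnS => /(_ mj).
apply: le_trans; rewrite big_ord_recr/= le_eqVlt; apply/orP; left; apply/eqP.
rewrite {2}/B' eqxx !mulrA; congr (_ * _ * _ * _).
  by apply: eq_bigr => i _; rewrite /B' ltn_eqF.
rewrite (increment_law levyY)// uh//.
by rewrite m0 -ltnS (leq_trans _ mj)// -addSnnS leq_addr.
Qed.

(** Rounding moves every step by less than one mesh. *)
Lemma walk_close j m a w : 0 < s -> walk j m a w ->
  forall i, (i <= j)%N -> (0 < j)%N -> exists2 c, Lam c &
    forall k, `|(Y (u (m + i)%N) w - Y (u m) w - s *: (lat c - lat a)) 0 k| <= i%:R * s.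
Proof.
move=> s0; elim: j m a => [//|j IHj] m a /= [b [/andP[La Lb] hr hw]] [|i] ij _.
  exists a => // k; rewrite addn0 !subrr scaler0 subr0 mxE normr0 mul0r//.
have close k : `|(inc m w - s *: (lat b - lat a)) 0 k| <= s.
  rewrite -hr !mxE -[X in X - _](divfK (lt0r_neq0 s0)) [s * _]mulrC -mulrBl normrM.
  by rewrite (gtr0_norm s0) ler_piMl ?(ltW s0)// dist_round0.
have [j0|j0] := posnP j.
  have -> : i = 0%N by rewrite j0 in ij; case: i ij.
  by exists b => // k; rewrite addn1 mul1r; exact: close.
have [c Lc hc] := IHj m.+1 b hw i ij j0; exists c => // k.
rewrite addnS -addSn.
have -> : (Y (u (m.+1 + i)%N) w - Y (u m) w - s *: (lat c - lat a)) 0 k =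
   (Y (u (m.+1 + i)%N) w - Y (u m.+1) w - s *: (lat c - lat b)) 0 k +
   (inc m w - s *: (lat b - lat a)) 0 k.
  by rewrite /inc /increment !mxE; ring.
by rewrite -natr1 mulrDl mul1r (le_trans (ler_normD _ _))// lerD.
Qed.

Lemma walk_last j m a w : walk j m a w -> L (inc (m + j) w).
Proof.
elim: j m a => [|j IHj] m a /=; first by rewrite addn0.
by move=> [b [_ _ /IHj]]; rewrite addSnnS.
Qed.

End Walk.

Lemma enorm_continuous {R : realType} {N : nat} (x : 'rV[R]_N) :
  continuous (fun y : 'rV[R]_N => enorm (x + y)).
Proof.
move=> y; apply: (@continuous_comp _ _ _
  (fun y : 'rV[R]_N => dotp (x + y) (x + y)) Num.sqrt); last exact: sqrt_continuous.
rewrite /dotp; move: y; apply: (@continuous_big _ _ _ _ _ (@add_continuous R)) => i _ y.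
have c : (x + z) 0 i @[z --> y] --> (x + y) 0 i.
  under eq_fun do rewrite mxE.
  rewrite mxE; have h := @coord_continuous R 1 N 0 i y.
  exact: (cvgD (cvg_cst (x 0 i)) h).
by apply: (cvgM c); exact: c.
Qed.

Lemma enorm_perturb {R : realType} {N : nat} (p q : 'rV[R]_N) (r eta : R) :
  0 < r -> 0 < eta -> enorm p <= r -> (forall k, `|q 0 k| <= eta * r / N%:R) ->
  enorm (p + q) <= (1 + eta) * r.
Proof.
move=> r0 eta0 pr qr.
have [N0|Npos] := posnP N.
  rewrite /enorm /dotp big1; last by move=> i; have := ltn_ord i; rewrite {2}N0.
  by rewrite sqrtr0 mulr_ge0 ?addr_ge0 ?ltW.
have R0 : 0 <= (1 + eta) * r by rewrite mulr_ge0 ?addr_ge0 ?ltW.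
rewrite -(@ler_pXn2r _ 2) ?nnegrE ?enorm_ge0// enorm_sqr /dotp.
apply: (@le_trans _ _ (\sum_k ((1 + eta) * (p 0 k * p 0 k) +
    (1 + eta^-1) * (eta * r / N%:R) ^+ 2))).
  apply: ler_sum => k _; rewrite !mxE.
  have h1 : q 0 k ^+ 2 <= (eta * r / N%:R) ^+ 2.
    rewrite -[leLHS]real_normK ?num_real// ler_pXn2r ?nnegrE//.
    by rewrite divr_ge0 ?mulr_ge0 ?(ltW r0) ?(ltW eta0).
  have h2 : (1 + eta^-1) * q 0 k ^+ 2 <= (1 + eta^-1) * (eta * r / N%:R) ^+ 2.
    by rewrite ler_wpM2l// addr_ge0// invr_ge0 ltW.
  apply: le_trans (lerD (lexx _) h2).
  have : 0 <= eta^-1 * (eta * p 0 k - q 0 k) ^+ 2.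
    by rewrite mulr_ge0 ?sqr_ge0 ?invr_ge0 ?ltW.
  have -> : eta^-1 * (eta * p 0 k - q 0 k) ^+ 2 =
    eta * (p 0 k * p 0 k) - 2 * p 0 k * q 0 k + eta^-1 * q 0 k ^+ 2.
    by field; rewrite gt_eqF.
  by rewrite expr2; lra.
rewrite big_split/= -mulr_sumr sumr_const card_ord -[X in _ + X]mulr_natl.
rewrite -/(dotp p p) -enorm_sqr.
have pr2 : enorm p ^+ 2 <= r ^+ 2 by rewrite ler_pXn2r ?nnegrE ?enorm_ge0 ?(ltW r0).
have Nr : 1 <= N%:R :> R by rewrite ler1n.
have -> : N%:R * ((1 + eta^-1) * (eta * r / N%:R) ^+ 2) =
    (eta + eta ^+ 2) * r ^+ 2 / N%:R.
  by field; rewrite !gt_eqF// ltr0n.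
apply: (@le_trans _ _ ((1 + eta) * r ^+ 2 + (eta + eta ^+ 2) * r ^+ 2)).
  apply: lerD; first by rewrite ler_wpM2l// addr_ge0// ltW.
  rewrite ler_pdivrMr ?(lt_le_trans ltr01)// ler_peMr// mulr_ge0 ?sqr_ge0//.
  by rewrite addr_ge0 ?sqr_ge0 ?ltW.
by rewrite le_eqVlt; apply/orP; left; apply/eqP; ring.
Qed.

Lemma eball_measurable {R : realType} {N : nat} (x : 'rV[R]_N) (r : R) :
  measurable ([set z | enorm (x + z) <= r] : set (borel_rV R N)).
Proof.
have : measurable_fun setT (fun z : borel_rV R N => enorm (x + z : 'rV[R]_N)).
  have c := @enorm_continuous R N x.
  have := @continuous_borel_measurable R N _ c.
  by [].

move=> m; rewrite -[X in measurable X]setTI.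
rewrite (_ : [set z | _] = (fun z => enorm (x + z)) @^-1` `]-oo, r]).
  exact: m.
by apply/seteqP; split => z /=; rewrite in_itv.
Qed.

Lemma roundvN {R : realType} {N : nat} (dl : R) (x : 'rV[R]_N) :
  roundv dl (- x) = - roundv dl x.
Proof. by apply/rowP => i; rewrite !mxE mulNr round0N intrN. Qed.

Lemma roundvZ {R : realType} {N : nat} (r dl : R) (x : 'rV[R]_N) :
  roundv (r * dl) x = roundv dl (r^-1 *: x).
Proof. by apply/rowP => i; rewrite !mxE invfM mulrA [r^-1 * _]mulrC. Qed.

Section Stay.
Context {R : realType} {N : nat} {d : measure_display} {Omega : measurableType d}.
Variables (P : probability Omega R) (Y : R -> Omega -> 'rV[R]_N) (alpha : R).
Hypotheses (alpha02 : 0 < alpha < 2) (N0 : (0 < N)%N).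
Hypothesis levyY : is_levy_process P Y.
Hypothesis charY : forall (t : R) (xi : 'rV[R]_N), 0 <= t ->
  char_fun P (Y t) xi = real_complex R (expR (- (t * enorm xi `^ alpha))).
Variables (lam lam' : R) (f : 'rV[R]_N -> R).
Hypotheses (lam0 : 0 < lam) (lam12 : lam < lam').
Hypotheses (subf : discrete_subsolution lam f) (f00 : 0 < f 0).
Hypothesis f_ball : forall x, f x != 0 -> enorm x <= 1.

Definition stay_at (x : 'rV[R]_N) (r t1 T : R) (k : nat) : set Omega :=
  [set w | forall i, (i <= 2 ^ k)%N ->
    enorm (x + increment Y 0 (t1 + i%:R * (T / (2 ^ k)%:R)) w) <= r].

Lemma stay_at_measurable x r t1 T k : 0 <= t1 -> 0 <= T ->
  measurable (stay_at x r t1 T k).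
Proof.
move=> t10 T0.
rewrite (_ : stay_at _ _ _ _ _ = \bigcap_(i in [set i | (i <= 2 ^ k)%N])
  (increment Y 0 (t1 + i%:R * (T / (2 ^ k)%:R)) @^-1` [set z | enorm (x + z) <= r])).
  apply: bigcap_measurableType => i _; rewrite -[X in measurable X]setTI.
  apply: (increment_measurable levyY (lexx 0)) => //; last exact: eball_measurable.
  by rewrite addr_ge0 ?mulr_ge0 ?divr_ge0.
by apply/seteqP; split.
Qed.

(** With the optimal starting point of the walk, the probability of staying in
    the ball at [2 ^ k] equally spaced times is bounded below independently
    of [k]: the discretization error is absorbed by the gap between [lam] and
    [lam'], the accumulated rounding errors by the enlargement of the ball. *)
Lemma stay_at_ge x r eta t1 T t3 k (L : set (borel_rV R N)) :
  0 < r -> 0 < eta -> 0 < t1 -> 0 < T -> 0 < t3 -> measurable L ->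
  exists2 v, enorm v <= r &
  fine (P (Y t1 @^-1` ocube (v - x) (eta * r / (2 * N%:R)))) *
    expR (- (T * r^-1 `^ alpha * lam' `^ alpha)) * fine (P (Y t3 @^-1` L))
  <= fine (P (stay_at x ((1 + eta) * r) t1 T k `&`
       increment Y (t1 + T) (t1 + T + t3) @^-1` L)).
Proof.
move=> r0 eta0 t10 T0 t30 mL.
have /andP[alpha0 _] := alpha02.
have mY t : 0 <= t -> measurable_fun setT (Y t : Omega -> borel_rV R N).
  by have [mY _ _ _ _] := levyY; exact: mY.
set n := (2 ^ k)%N; have n0 : (0 < n)%N by rewrite expn_gt0.
have nR0 : 0 < n%:R :> R by rewrite ltr0n.
have NR0 : 0 < N%:R :> R by rewrite ltr0n.
pose h := T / n%:R; have h0 : 0 < h by rewrite divr_gt0.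
have nh : n%:R * h = T by rewrite mulrC divfK ?gt_eqF.
pose tau := `|r^-1| `^ alpha * h.
have rV0 : 0 < r^-1 by rewrite invr_gt0.
have tau0 : 0 < tau by rewrite mulr_gt0// powR_gt0// normr_gt0 gt_eqF.
pose th := expR (- (tau * lam' `^ alpha)).
pose e := expR (- (tau * lam `^ alpha)) - th.
have e0 : 0 < e.
  rewrite subr_gt0 ltr_expR ltrN2 ltr_pM2l// gt0_ltr_powR// nnegrE ltW//.
  exact: lt_trans lam12.
have [d0 d00 ray] := lattice_rayleigh alpha02 tau0 lam0 (mY _ (ltW tau0))
  (fun xi => stable_cos charY xi (ltW tau0)) subf e0.
pose dl := Num.min d0 (eta / (2 * N%:R * n%:R)).
have dl0 : 0 < dl by rewrite lt_min d00/= divr_gt0 ?mulr_gt0.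
have [|K [_ rayK]] := ray dl; first by rewrite dl0 ge_min lexx.
have edl : expR (- (tau * lam `^ alpha)) - e = th by rewrite /e; ring.
rewrite edl in rayK.
pose Lam (a : @grid N K) := f (dl *: lat a) != 0.
pose s := r * dl; have s0 : 0 < s by rewrite mulr_gt0.
pose A := @walk_kernel _ _ _ _ P Y K s h Lam.
have pE (c : 'rV[R]_N) : P (Y h @^-1` round_to s c) = P (Y tau @^-1` [set x | roundv dl x = c]).
  rewrite /tau -(stable_scaling levyY charY _ (ltW h0) (roundv_preimage_measurable _ _)).
  by congr (P _); apply/seteqP; split => w; rewrite /preimage /round_to /= /s roundvZ.
have A0 a b : 0 <= A a b by rewrite mulr_ge0// fine_ge0.
have Asym a b : A a b = A b a.
  rewrite /A /walk_kernel andbC; congr (_ * fine _).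
  rewrite -(stable_sym levyY charY (ltW h0)); last exact: roundv_preimage_measurable.
  congr (P _); apply/seteqP; split => w; rewrite /preimage /round_to /= roundvN.
    by move=> /eqP; rewrite eqr_oppLR opprB => /eqP.
  by move=> ->; rewrite opprB.
have W0 : 0 < \sum_(a : grid K) f (dl *: lat a) ^+ 2.
  have [|a ha] := @lat_ex N K (fun=> 0); first by move=> i; rewrite normr0.
  have la : lat a = 0 :> 'rV[R]_N by apply/rowP => i; rewrite !mxE ha.
  rewrite (bigD1 a)//= la scaler0 ltr_pwDl ?exprn_gt0//.
  by apply: sumr_ge0 => b _; rewrite sqr_ge0.
have kf : th * \sum_(a : grid K) f (dl *: lat a) ^+ 2 <= kform A (fun a => f (dl *: lat a)).
  apply: (le_trans rayK); rewrite le_eqVlt; apply/orP; left; apply/eqP.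
  apply: eq_bigr => a _; rewrite mulr_sumr; apply: eq_bigr => b _.
  rewrite /A /walk_kernel pE /Lam.
  have [->|fa] := eqVneq (f (dl *: lat a)) 0; first by rewrite !mul0r.
  have [->|fb] := eqVneq (f (dl *: lat b)) 0; first by rewrite !(mul0r, mulr0).
  by rewrite mul1r -mulrA; congr (_ * _); rewrite mulrC.
have [a] := exists_large_rowsum k Asym A0 W0 (expR_gt0 _) kf.
rewrite -/n => tha.
have La : Lam a.
  apply: contraTT tha => nLa; rewrite -ltNge -(prednK n0) iterS {1}/kapply big1.
    by rewrite exprn_gt0// expR_gt0.
  by move=> b _; rewrite /A /walk_kernel (negbTE nLa) !mul0r.
have Lam_r c : Lam c -> enorm (s *: lat c : 'rV[R]_N) <= r.
  move=> /f_ball h1.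
  by rewrite /s -scalerA enormZ (gtr0_norm r0) ler_piMr ?(ltW r0).
pose v : 'rV[R]_N := s *: lat a.
exists v; first exact: Lam_r.
pose u i : R := if i is i'.+1 then if (i' <= n)%N then t1 + i'%:R * h else t1 + T + t3
  else 0.
have us i : (i <= n)%N -> u i.+1 = t1 + i%:R * h by rewrite /u => ->.
have ue : u n.+2 = t1 + T + t3 by rewrite /u ltnn.
have und i : u i <= u i.+1.
  case: i => [|i]; first by rewrite /u mul0r addr0 ltW.
  rewrite /u; have [ni|ni] := leqP i.+1 n.
    by rewrite (ltnW ni) lerD2l ler_wpM2r ?(ltW h0)// ler_nat.
  case: leqP => // ni'; rewrite -addrA lerD2l -nh.
  by apply: ler_wpDr; [exact: ltW|rewrite ler_wpM2r ?(ltW h0)// ler_nat].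
have uh i : (0 < i <= n)%N -> u i.+1 - u i = h.
  case: i => // i /andP[_ ni]; rewrite us// us ?(ltnW ni)// -natr1; ring.
have u0 : u 0%N = 0 by [].
clearbody u.
have u1 : u 1%N = t1 by rewrite us// mul0r addr0.
have un : u n.+1 = t1 + T by rewrite us// nh.
pose B (i : nat) : set (borel_rV R N) := ocube (v - x) (eta * r / (2 * N%:R)).
have mB i : measurable (B i) by exact: ocube_measurable.
have u0' : 0 <= u 0%N by rewrite u0.
have ug j : 0 <= u j by elim: j => // j; move/le_trans; apply; exact: und.
have := @walk_prob _ _ _ _ P Y levyY K n s h L Lam u mL u0' und uh n 1 a B isT
  (leqnn _) mB.
rewrite big_ord1 -/A.
have -> : P (increment Y (u (ord0 : 'I_1)) (u (ord0 : 'I_1).+1) @^-1` B (ord0 : 'I_1)) =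
    P (Y t1 @^-1` ocube (v - x) (eta * r / (2 * N%:R))).
  by rewrite (increment_law levyY)// u0 u1 subr0.
have -> : P (increment Y (u (1 + n)%N) (u (1 + n).+1) @^-1` L) = P (Y t3 @^-1` L).
  rewrite (increment_law levyY)// add1n un ue.
  by rewrite [t1 + T + t3 - _]addrAC subrr add0r.
move=> wp.
apply: le_trans (le_trans _ wp) _.
  rewrite ler_wpM2r ?fine_ge0// ler_wpM2l ?fine_ge0//.
  apply: le_trans tha; rewrite -expRM_natl le_eqVlt; apply/orP; left; apply/eqP.
  congr expR; rewrite /tau (gtr0_norm rV0) -nh; ring.
have mS : measurable (stay_at x ((1 + eta) * r) t1 T k `&`
       increment Y (t1 + T) (t1 + T + t3) @^-1` L).
  apply: measurableI; first by apply: stay_at_measurable; exact: ltW.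
  rewrite -[X in measurable X]setTI.
  by apply: (increment_measurable levyY) => //; rewrite !addr_ge0 ?ltW.
have mW : measurable (\bigcap_(i < 1) (increment Y (u i) (u i.+1) @^-1` B i) `&`
    walk Y s L Lam u n 1 a).
  apply: measurableI; last first.
    exact: (walk_measurable levyY s Lam mL u0' und).
  apply: bigcap_measurableType => i _; rewrite -[X in measurable X]setTI.
  by apply: (increment_measurable levyY).
rewrite fine_le ?fin_num_measure// le_measure ?inE// => w [hB hw].
have hB0 := hB 0%N (ltn0Sn 0).
split; last first.
  by have := walk_last hw; rewrite add1n un ue.
move=> i ni.
have [c Lc hc] := walk_close s0 hw ni n0.
set t := t1 + _; have tE : u (1 + i)%N = t by rewrite add1n us.
rewrite tE u1 in hc.
have -> : x + increment Y 0 t w = s *: lat c + ((x + increment Y 0 t1 w - v) +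
    (Y t w - Y t1 w - s *: (lat c - lat a))).
  by apply/rowP => j; rewrite /increment /v !mxE; ring.
apply: enorm_perturb => //; first exact: Lam_r.
move=> j; rewrite mxE (le_trans (ler_normD _ _))//.
have h1 : `|(x + increment Y 0 t1 w - v) 0 j| <= eta * r / (2 * N%:R).
  have := hB0 j; rewrite /= u0 u1 !mxE => /ltW; apply: le_trans.
  by rewrite le_eqVlt; apply/orP; left; apply/eqP; congr (`|_|); ring.
have h2 : i%:R * s <= eta * r / (2 * N%:R).
  apply: (@le_trans _ _ (n%:R * s)); first by rewrite ler_wpM2r ?(ltW s0)// ler_nat.
  have : dl <= eta / (2 * N%:R * n%:R) by rewrite ge_min lexx orbT.
  move=> /(ler_wpM2l (ltW (mulr_gt0 nR0 r0))); rewrite -mulrA -/s => /le_trans; apply.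
  rewrite le_eqVlt; apply/orP; left; apply/eqP; field.
  by rewrite !gt_eqF.
have := lerD h1 (le_trans (hc j) h2) => /le_trans; apply.
by rewrite le_eqVlt; apply/orP; left; apply/eqP; field; rewrite gt_eqF.
Qed.

End Stay.

Section StayContinuous.
Context {R : realType} {N : nat} {d : measure_display} {Omega : measurableType d}.
Variables (P : probability Omega R) (Y : R -> Omega -> 'rV[R]_N).
Hypothesis levyY : is_levy_process P Y.

Lemma stay_at_decreasing x r t1 T (L : set Omega) :
  nonincreasing_seq (fun k => stay_at Y x r t1 T k `&` L).
Proof.
apply/nonincreasing_seqP => k; apply/subsetPset => w [hw Lw]; split => // i ik.
have := hw (2 * i)%N; rewrite expnS leq_pmul2l// => /(_ ik).
rewrite !natrM (_ : 2 * i%:R * _ = i%:R * (T / (2 ^ k)%:R))//.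
by field; rewrite pnatr_eq0 expn_eq0.
Qed.

(** A path that is right-continuous and in a closed ball at all dyadic times
    of an interval never leaves the ball. *)
Lemma stay_right_continuous x r t1 T w s : 0 <= t1 -> 0 < T ->
  (forall t : R, 0 <= t -> Y s w @[s --> t^'+] --> Y t w) ->
  (forall k, stay_at Y x r t1 T k w) -> t1 <= s < t1 + T ->
  enorm (x + increment Y 0 s w) <= r.
Proof.
move=> t10 T0 rcY hw /andP[t1s sT].
rewrite leNgt; apply/negP => rs.
have c : enorm (x + increment Y 0 z w) @[z --> s^'+] --> enorm (x + increment Y 0 s w).
  have := cvg_comp _ _ (rcY s (le_trans t10 t1s)) (@enorm_continuous _ _ (x - Y 0 w) (Y s w)).
  rewrite /increment (_ : x - Y 0 w + Y s w = x + (Y s w - Y 0 w)); last first.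
    by rewrite addrAC addrA.
  apply: cvg_trans; apply: near_eq_cvg; apply: nearW => z /=.
  by rewrite addrAC addrA.
have [e /= e0 he] : \forall z \near s^'+, r < enorm (x + increment Y 0 z w).
  exact: (cvgr_gt _ c).
pose b := Num.min e (t1 + T - s).
have b0 : 0 < b by rewrite lt_min e0 subr_gt0.
have [k hk] : exists k, T / b < 2 ^+ k.
  exists (Num.truncn (T / b)).+1; apply: (lt_trans (truncnS_gt _)).
  by rewrite -natrX ltr_nat ltn_expl.
have k0 : 0 < 2 ^+ k :> R by rewrite exprn_gt0.
pose y := (s - t1) * 2 ^+ k / T.
have y0 : 0 <= y by rewrite divr_ge0 ?mulr_ge0 ?subr_ge0 ?(ltW T0) ?(ltW k0).
have /andP[iy yi] := truncn_itv y0.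
set i := Num.truncn y in iy yi.
pose z := t1 + i.+1%:R * (T / (2 ^ k)%:R).
have Tb : T / 2 ^+ k < b.
  by move: hk; rewrite ltr_pdivrMr// ltr_pdivrMr// mulrC.
have zs : s < z.
  move: yi; rewrite /y ltr_pdivrMr// -ltrBlDl /z natrX mulrA ltr_pdivlMr//.
have zb : z < s + b.
  apply: (@le_lt_trans _ _ (s + T / 2 ^+ k)); last by rewrite ltrD2l.
  rewrite /z natrX -natr1 mulrDl mul1r addrA lerD2r -lerBrDl mulrA ler_pdivrMr//.
  by move: iy; rewrite /y ler_pdivlMr.
have ik : (i.+1 <= 2 ^ k)%N.
  have : z < t1 + T.
    by apply: (lt_le_trans zb); rewrite -lerBrDl ge_min lexx orbT.
  rewrite /z ltrD2l mulrCA -ltr_pdivlMl// mulVf ?gt_eqF// ltr_pdivrMr ?ltr0n ?expn_gt0//.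
  by rewrite mul1r ltr_nat => /ltnW.
have : r < enorm (x + increment Y 0 z w).
  apply: he => //=; rewrite /ball /= ltr0_norm ?subr_lt0// opprB ltrBlDl.
  by rewrite (lt_le_trans zb)// lerD2l ge_min lexx.
by rewrite ltNge hw.
Qed.

(** Monotone limit of the bound at dyadic times. *)
Lemma stay_ge x r t1 T (L : set (borel_rV R N)) (c : R) t2 t3 :
  0 <= t1 -> 0 <= T -> 0 <= t2 -> 0 <= t3 -> measurable L ->
  (forall k, c <= fine (P (stay_at Y x r t1 T k `&` increment Y t2 t3 @^-1` L))) ->
  (c%:E <= P (\bigcap_k (stay_at Y x r t1 T k `&` increment Y t2 t3 @^-1` L)))%E.
Proof.
move=> t10 T0 t20 t30 mL hc.
have mS k : measurable (stay_at Y x r t1 T k `&` increment Y t2 t3 @^-1` L).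
  apply: measurableI; first exact: (stay_at_measurable levyY).
  rewrite -[X in measurable X]setTI; exact: (increment_measurable levyY t20 t30).
have fin0 : (P (stay_at Y x r t1 T 0 `&` increment Y t2 t3 @^-1` L) < +oo)%E.
  by rewrite (le_lt_trans (probability_le1 P (mS 0%N)))// ltry.
have cv := nonincreasing_cvg_mu fin0 mS (bigcap_measurableType (fun k _ => mS k))
  (@stay_at_decreasing x r t1 T (increment Y t2 t3 @^-1` L)).
rewrite -(cvg_lim _ cv)//; apply: lime_ge; first by apply/cvg_ex; eexists; exact: cv.
apply: nearW => k; have := hc k; rewrite -lee_fin fineK//.
exact: fin_num_measure.
Qed.

End StayContinuous.

(** * Entire series with factorial decay *)

Lemma derive_continuous {R : realType} (f df : R -> R) :
  (forall x, is_derive x (1 : R) f (df x)) -> continuous f.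
Proof.
move=> fd x; apply: differentiable_continuous.
by apply/derivable1_diffP; have [] := fd x.
Qed.

Lemma mvt_everywhere {R : realType} (f df : R -> R) a b :
  (forall x, is_derive x (1 : R) f (df x)) -> a < b ->
  exists2 c, a < c < b & f b - f a = df c * (b - a).
Proof.
move=> fd ab; have fc := derive_continuous fd.
have [|c] := @MVT _ f df _ _ ab (fun y _ => fd y); last first.
  by rewrite in_itv => cab fE; exists c.
exact: continuous_subspaceT.
Qed.

Lemma mvt_increment {R : realType} (f df : R -> R) s u :
  (forall x, is_derive x (1 : R) f (df x)) ->
  exists2 c, `|c - s| <= `|u| & f (s + u) - f s = df c * u.
Proof.
move=> fd; have [u0|u0|->] := ltgtP u 0.
- have [|c /andP[c1 c2] h] := mvt_everywhere fd (_ : s + u < s); first by lra.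
  exists c; first by rewrite !ltr0_norm//; lra.
  by rewrite -[LHS]opprB h; ring.
- have [|c /andP[c1 c2] h] := mvt_everywhere fd (_ : s < s + u); first by lra.
  exists c; first by rewrite !gtr0_norm//; lra.
  by rewrite h; ring.
- by exists s; rewrite ?subrr ?normr0// addr0 subrr mulr0.
Qed.

Section EntireSeries.
Context {R : realType}.
Implicit Types (c : R ^nat) (x : R).

Definition fact_bounded c := forall m, `|c m| <= (m`!%:R)^-1.

Definition psum c x := limn (pseries c x).

Lemma fact_bounded_diffs c : fact_bounded c -> fact_bounded (pseries_diffs c).
Proof.
move=> hc m; rewrite /pseries_diffs normrM ger0_norm//.
apply: (le_trans (ler_wpM2l (ler0n _ _) (hc m.+1))).
by rewrite factS natrM invfM mulrA divff ?mul1r// pnatr_eq0.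
Qed.

Let norm_cvg c x : fact_bounded c -> cvgn [normed pseries c x].
Proof.
move=> hc; apply: (@series_le_cvg _ _ (exp_coeff `|x|)) => [n|n|n|].
- exact: normr_ge0.
- by rewrite /exp_coeff/= divr_ge0.
- rewrite /exp_coeff/= normrM normrX mulrC ler_wpM2l ?exprn_ge0//; exact: hc.
- exact: is_cvg_series_exp_coeff.
Qed.

Lemma psum_cvg c x : fact_bounded c -> cvgn (pseries c x).
Proof. by move=> hc; apply: (@normed_cvg _ R^o); exact: norm_cvg. Qed.

Lemma psum_le c x : fact_bounded c -> `|psum c x| <= expR `|x|.
Proof.
move=> hc; have nc := @norm_cvg c x hc.
apply: (le_trans (@lim_series_norm _ R^o _ nc)).
rewrite expRE; apply: lim_series_le => //.
  by have := @is_cvg_series_exp_coeff R `|x|; rewrite exp_coeffE.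
by move=> n /=; rewrite normrM normrX ler_wpM2r ?exprn_ge0.
Qed.

Lemma is_derive_psum c x : fact_bounded c ->
  is_derive x (1 : R) (psum c) (psum (pseries_diffs c) x).
Proof.
move=> hc; have hc1 := fact_bounded_diffs hc; have hc2 := fact_bounded_diffs hc1.
apply: (@pseries_snd_diffs _ _ (`|x| + 1)); try exact: psum_cvg.
by rewrite [ltRHS]ger0_norm ?addr_ge0// ltrDl.
Qed.

Lemma psum0 c : fact_bounded c -> psum c 0 = c 0%N.
Proof.
move=> hc; apply: cvg_lim => //; rewrite -(cvg_shiftn 1)/=.
apply: cvg_near_cst; apply: nearW => n.
rewrite /pseries/= /series/= addn1 big_nat_recl//= expr0 mulr1 big1 ?addr0// => i _.
by rewrite expr0n mulr0.
Qed.

(** Taylor expansion of order two, uniform on bounded sets. *)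
Lemma psum_taylor2 c B s u : fact_bounded c -> `|s| <= B -> `|u| <= 1 ->
  `|psum c (s + u) - psum c s - u * psum (pseries_diffs c) s
    - u ^+ 2 / 2 * psum (pseries_diffs (pseries_diffs c)) s|
  <= expR (B + 1) * `|u| ^+ 3.
Proof.
move=> hc sB u1; set c1 := pseries_diffs c; set c2 := pseries_diffs c1.
have hc1 : fact_bounded c1 by exact: fact_bounded_diffs.
have hc2 : fact_bounded c2 by exact: fact_bounded_diffs.
have hc3 := fact_bounded_diffs hc2.
pose g v := psum c (s + v) - psum c s - v * psum c1 s - v ^+ 2 / 2 * psum c2 s.
pose g1 v := psum c1 (s + v) - psum c1 s - v * psum c2 s.
have dsh k v : fact_bounded k ->
    is_derive v (1 : R) (fun v => psum k (s + v)) (psum (pseries_diffs k) (s + v)).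
  move=> hk; have := @is_derive_psum k (s + v) hk => h.
  by apply: is_derive_eq; rewrite add0r !mulr1.
have dg v : is_derive v (1 : R) g (g1 v).
  have d1 := dsh c v hc.
  apply: is_derive_eq; rewrite /g1 /GRing.scale/= -/c1; lra.
have dg1 v : is_derive v (1 : R) g1 (psum c2 (s + v) - psum c2 s).
  have d1 := dsh c1 v hc1.
  apply: is_derive_eq; rewrite /GRing.scale/= -/c2; lra.
have g0 : g 0 = 0 by rewrite /g addr0 subrr !mul0r expr0n !mul0r !subr0.
have g10 : g1 0 = 0 by rewrite /g1 addr0 subrr mul0r subr0.
have [v vu] := mvt_increment 0 u dg; rewrite add0r g0 subr0 => gE.
have [w wv] := mvt_increment 0 v dg1; rewrite add0r g10 subr0 => g1E.
have [z zw] := mvt_increment s w (fun x => @is_derive_psum c2 x hc2) => c2E.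
rewrite subr0 in vu; rewrite subr0 in wv.
have zB : `|z| <= B + 1.
  have -> : z = s + (z - s) by ring.
  by rewrite (le_trans (ler_normD _ _))// lerD// (le_trans zw)// (le_trans wv)// (le_trans vu).
rewrite -/(g u) gE g1E c2E !normrM -!mulrA.
rewrite ler_pM ?mulr_ge0//.
  by rewrite (le_trans (psum_le _ hc3))// ler_expR.
have wu := le_trans wv vu.
by rewrite !exprS expr0 mulr1; do 2 apply: ler_pM => //; rewrite ?mulr_ge0.
Qed.

End EntireSeries.

(** * The radial eigenfunction and its first zero *)

Section RadialEigenfunction.
Context {R : realType}.
Variable N : nat.
Hypothesis N0 : (0 < N)%N.

(** The series [psi s] of these coefficients is the normalized Bessel function
    at the square root of [s]: [psi (x_1 ^+ 2 + ... + x_N ^+ 2)] is the radial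
    solution of [- Laplacian u = u] with value [1] at the origin. *)
Fixpoint psi_coeff (m : nat) : R :=
  if m is m'.+1 then - psi_coeff m' / (m'.+1%:R * (4 * m'%:R + 2 * N%:R)) else 1.

Definition psi : R -> R := psum psi_coeff.
Definition psi1 : R -> R := psum (pseries_diffs psi_coeff).
Definition psi2 : R -> R := psum (pseries_diffs (pseries_diffs psi_coeff)).

Let NR0 : 0 < N%:R :> R. Proof. by rewrite ltr0n. Qed.

Let den_gt0 (m : nat) : 0 < 4 * m%:R + 2 * N%:R :> R.
Proof. by rewrite ltr_wpDl// ?mulr_ge0 ?mulr_gt0. Qed.

Lemma psi_coeff_bounded : fact_bounded psi_coeff.
Proof.
elim=> [|m IHm]; first by rewrite fact0 invr1 normr1.
rewrite /= normrM normrN normfV [X in _ / X]gtr0_norm ?mulr_gt0//.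
rewrite ler_pdivrMr ?mulr_gt0// (le_trans IHm)// factS natrM invfM.
rewrite [leRHS]mulrAC mulKf ?pnatr_eq0// ler_peMl ?invr_ge0//.
have : 1 <= N%:R :> R by rewrite ler1n.
have := ler0n R m; lra.
Qed.

Let cb := psi_coeff_bounded.
Let cb1 := fact_bounded_diffs cb.
Let cb2 := fact_bounded_diffs cb1.

Lemma psi0 : psi 0 = 1. Proof. exact: psum0. Qed.

Lemma is_derive_psi s : is_derive s (1 : R) psi (psi1 s).
Proof. exact: is_derive_psum. Qed.

Lemma is_derive_psi1 s : is_derive s (1 : R) psi1 (psi2 s).
Proof. exact: is_derive_psum. Qed.

Lemma psi_ode s : 4 * s * psi2 s + 2 * N%:R * psi1 s = - psi s.
Proof.
have cS k : fact_bounded k -> pseries k s n.+1 @[n --> \oo] --> psum k s.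
  move=> hk; have := psum_cvg (x := s) hk.
  by rewrite -(cvg_shiftS (pseries k s)).
pose u n := 4 * s * pseries (pseries_diffs (pseries_diffs psi_coeff)) s n +
  2 * N%:R * pseries (pseries_diffs psi_coeff) s n.+1.
have c1 : u n @[n --> \oo] --> 4 * s * psi2 s + 2 * N%:R * psi1 s.
  apply: cvgD; apply: cvgM; try exact: cvg_cst; last exact: cS.
  exact: psum_cvg.
have c2 : u n @[n --> \oo] --> - psi s.
  have -> : u = (fun n => - pseries psi_coeff s n.+1); last exact: cvgN (cS _ cb).
  apply/funext => n; rewrite /u /pseries /series/= !big_mkord.
  rewrite big_ord_recl [in RHS]big_ord_recl !mulr_sumr opprD -sumrN.
  rewrite mulrDr mulr_sumr addrCA -big_split/=; congr (_ + _).
    rewrite /pseries_diffs/= !expr0 !mulr1; field.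
    by rewrite gt_eqF.
  apply: eq_bigr => i _; rewrite /pseries_diffs /bump !add1n ?add0n/= ?add0n.
  rewrite -![_.+1%:R]natr1.
  have := den_gt0 i.+1; have := den_gt0 i; rewrite -![_.+1%:R]natr1.
  set a := i%:R : R => h1 h2; have a0 : 0 <= a by exact: ler0n.
  by rewrite exprS; field; rewrite !gt_eqF//; lra.
exact: (cvg_unique _ c1 c2).
Qed.

Let y (z : R) := psi (z ^+ 2).
Let W (z : R) := 2 * z ^+ N * psi1 (z ^+ 2).

Let dy (z : R) : is_derive z (1 : R) y (2 * z * psi1 (z ^+ 2)).
Proof.
have h := is_derive_psi (z ^+ 2).
by apply: is_derive_eq; rewrite /GRing.scale/=; ring.
Qed.

Let dX n (z : R) : is_derive z (1 : R) (fun z => z ^+ n) (n%:R * z ^+ n.-1).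
Proof.
rewrite (_ : (fun z : R => z ^+ n) = id ^+ n); last by rewrite exprfctE.
by apply: is_derive_eq; rewrite /GRing.scale/= mulr1.
Qed.

(** The equation in divergence form. *)
Let dW (z : R) : is_derive z (1 : R) W (- (z ^+ N.-1 * y z)).
Proof.
have h := is_derive_psi1 (z ^+ 2).
have ode : - y z = 4 * z ^+ 2 * psi2 (z ^+ 2) + 2 * N%:R * psi1 (z ^+ 2).
  by rewrite -psi_ode.
rewrite -mulrN ode /W; have hX := dX N z; apply: is_derive_eq; rewrite /GRing.scale/=.
have -> : z ^+ N = z * z ^+ N.-1 by rewrite -exprS prednK.
by ring.
Qed.

Let y0 : y 0 = 1. Proof. by rewrite /y expr0n psi0. Qed.

Let W0 : W 0 = 0. Proof. by rewrite /W expr0n gtn_eqF// mulr0 mul0r. Qed.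

Let W_le (a b : R) : 0 <= a <= b -> (forall z : R, a < z < b -> 0 <= y z) -> W b <= W a.
Proof.
move=> /andP[a0 ab] yp; move: ab; rewrite le_eqVlt => /predU1P[->//|ab].
have [c cab E] := mvt_everywhere dW ab.
rewrite -subr_le0 E mulNr oppr_le0 mulr_ge0 ?subr_ge0 ?(ltW ab)//.
by rewrite mulr_ge0 ?yp// exprn_ge0//; case/andP: cab => ? _; lra.
Qed.

Let psi1_le0 (z : R) : 0 < z -> W z <= 0 -> psi1 (z ^+ 2) <= 0.
Proof. by move=> z0; rewrite /W pmulr_rle0// mulr_gt0// exprn_gt0. Qed.

(** Comparison of [y] with the paraboloid [L ^+ 2 - z ^+ 2] through Green's
    formula, using Chebyshev's correlation inequality for the nonincreasing
    functions [y] and [L ^+ 2 - 2 N - z ^+ 2]. *)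
Let y_end (L : R := N%:R + 2) : (forall z : R, 0 <= z <= L -> 0 <= y z) -> y L <= 0.
Proof.
move=> yp.
have L0 : 0 < L by rewrite /L addr_gt0.
have Wn (z : R) : 0 <= z <= L -> W z <= 0.
  move=> /andP[z0 zL]; rewrite -W0; apply: W_le; first by rewrite lexx.
  by move=> t /andP[t0 tz]; apply: yp; lra.
have y_dec (a b : R) : 0 <= a -> a <= b -> b <= L -> y b <= y a.
  move=> a0; rewrite le_eqVlt => /predU1P[->//|ab] bL.
  have [c /andP[ac cb'] E] := mvt_everywhere dy ab.
  have c0 : 0 < c by exact: le_lt_trans ac.
  rewrite -subr_le0 E mulr_le0_ge0 ?subr_ge0 ?(ltW ab)//.
  by rewrite pmulr_rle0 ?mulr_gt0// psi1_le0// Wn; lra.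
pose z0 := Num.sqrt (L ^+ 2 - 2 * N%:R).
have D0 : 0 <= L ^+ 2 - 2 * N%:R by rewrite /L expr2; nra.
have z0E : z0 ^+ 2 = L ^+ 2 - 2 * N%:R by rewrite sqr_sqrtr.
have z00 : 0 <= z0 by exact: sqrtr_ge0.
have z0L : z0 <= L.
  by rewrite -(@ler_pXn2r _ 2) ?nnegrE ?(ltW L0)// z0E gerBl mulr_ge0 ?(ltW NR0).
pose F (z : R) := - 2 * z ^+ N * y z - (L ^+ 2 - z ^+ 2) * W z -
  y z0 * ((L ^+ 2 - 2 * N%:R) / N%:R * z ^+ N - (N%:R + 2)^-1 * z ^+ N.+2).
have dF (z : R) : is_derive z (1 : R) F (z ^+ N.-1 * (z0 ^+ 2 - z ^+ 2) * (y z - y z0)).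
  have h1 := dy z; have h2 := dW z; have h3 := dX N z; have h4 := dX N.+2 z.
  apply: is_derive_eq; rewrite z0E /W /GRing.scale/=.
  have -> : z ^+ N.+1 = z * z * z ^+ N.-1.
    by rewrite -mulrA -!exprS prednK.
  have -> : z ^+ N = z * z ^+ N.-1 by rewrite -exprS prednK.
  have -> : N.+2%:R = N%:R + 2 :> R by rewrite -addn2 natrD.
  field; rewrite !gt_eqF//.
have [c /andP[c0 cL] E] := mvt_everywhere dF L0.
have F0 : F 0 = 0.
  by rewrite /F W0 !expr0n gtn_eqF//= !(mulr0, mul0r, subrr, subr0).
have FL : 0 <= F L.
  move: E; rewrite F0 subr0 => ->; rewrite subr0 mulr_ge0 ?(ltW L0)//.
  rewrite -mulrA mulr_ge0 ?exprn_ge0 ?(ltW c0)//.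
  have [cz|cz] := leP c z0.
    apply: mulr_ge0; rewrite subr_ge0; last by apply: y_dec => //; exact: ltW.
    by rewrite ler_pXn2r ?nnegrE// ltW.
  apply: mulr_le0; rewrite subr_le0; last by apply: y_dec => //; exact: ltW.
  by rewrite ler_pXn2r ?nnegrE ?(ltW c0) ?(ltW cz).
have FE : F L = - 2 * L ^+ N * y L - y z0 * L ^+ N * (4 / N%:R).
  have LN : L ^+ N.+2 = L * L * L ^+ N by rewrite !exprS mulrA.
  rewrite /F LN subrr mul0r subr0; move: (L ^+ N) (y L) (y z0) => a b e.
  by rewrite /L; field; rewrite !gt_eqF.
have : 0 <= y z0 * L ^+ N * (4 / N%:R).
  by rewrite !mulr_ge0 ?exprn_ge0 ?invr_ge0 ?(ltW L0)// yp// z00.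
move: FL; rewrite FE => h1 h2.
have : (2 * L ^+ N) * y L <= 0 by lra.
by rewrite pmulr_rle0// mulr_gt0// exprn_gt0.
Qed.

(** At the first zero the flux [W] is negative, since it decreases as long as [y]
    is positive; so [y] crosses zero there and is negative just after it. *)
Lemma psi_first_zero : exists2 j : R, 0 < j & [/\ psi (j ^+ 2) = 0,
  forall z : R, 0 <= z < j -> 0 < psi (z ^+ 2) &
  forall z0 : R, j < z0 -> exists2 z, j < z <= z0 & psi (z ^+ 2) < 0].
Proof.
pose A := [set z : R | 0 <= z /\ y z <= 0].
have [z1 [z10 yz1]] : exists z, A z.
  apply: contrapT => /forallNP nA.
  have yp (z : R) : 0 <= z -> 0 < y z by move=> z0; rewrite ltNge; apply/negP => ?; exact: (nA z).
  have := y_end (fun z h => ltW (yp z (proj1 (andP h)))).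
  by rewrite leNgt yp// addr_ge0.
have hA : has_inf A by split; [exists z1|exists 0 => z []].
pose j := inf A.
have j0 : 0 <= j by apply: lb_le_inf; [exists z1|move=> z []].
have ypos (z : R) : 0 <= z < j -> 0 < y z.
  move=> /andP[z0 zj]; rewrite ltNge; apply/negP => yz.
  by have := ge_inf hA.2 (conj z0 yz : A z); rewrite leNgt zj.
have yc : continuous y := derive_continuous dy.
have yj_le : y j <= 0.
  rewrite leNgt; apply/negP => yj.
  have [e /= e0 he] : \forall z \near j, 0 < y z by exact: (cvgr_gt _ (yc j)).
  have [a Aa aj] := inf_adherent e0 hA.
  have ja := ge_inf hA.2 Aa; case: Aa => _; rewrite leNgt he//=.
  by rewrite /ball /= ler0_norm ?subr_le0// opprB ltrBlDl.
have jp : 0 < j.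
  by rewrite lt_neqAle j0 andbT; apply/eqP => j0'; move: yj_le; rewrite -j0' y0 ler10.
have yj : y j = 0.
  apply/eqP; rewrite eq_le yj_le/= leNgt; apply/negP => yjn.
  have [e /= e0 he] : \forall z \near j, y z < 0 by exact: (cvgr_lt _ (yc j)).
  pose z := Num.max 0 (j - e / 2).
  have zj : 0 <= z < j by rewrite le_max lexx gt_max jp ltrBlDr ltrDl divr_gt0.
  have := ypos z zj; rewrite ltNge ltW//; apply: he => /=.
  have /andP[_ zj'] := zj.
  rewrite /ball /= gtr0_norm ?subr_gt0// ltrBlDr -ltrBlDl lt_max; apply/orP; right.
  by lra.
have Wj : W j < 0.
  have [c /andP[c0 cj] E] := mvt_everywhere dW jp.
  move: E; rewrite W0 !subr0 => ->; rewrite mulNr oppr_lt0 !mulr_gt0 ?exprn_gt0//.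
  by apply: ypos; rewrite (ltW c0).
exists j => //; split => // z0 jz0; apply: contrapT => none.
have yp (z : R) : j < z <= z0 -> 0 <= y z.
  by move=> jz; rewrite leNgt; apply/negP => yz; apply: none; exists z.
have : 0 <= y z0 by apply: yp; rewrite jz0 lexx.
rewrite leNgt => /negP; apply.
have [c /andP[jc cz]] := mvt_everywhere dy jz0; rewrite yj subr0 => ->.
have c0 : 0 < c by exact: lt_trans jc.
rewrite pmulr_llt0 ?subr_gt0// pmulr_rlt0 ?mulr_gt0//.
have : W c < 0.
  apply: le_lt_trans Wj; apply: W_le; first by rewrite j0 ltW.
  by move=> z /andP[jz zc]; apply: yp; rewrite jz; lra.
by rewrite /W pmulr_rlt0// mulr_gt0// exprn_gt0.
Qed.

End RadialEigenfunction.

(** The radial eigenfunction raised by a constant [kap > 0] is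
    [g = psi (lam ^+ 2 * |x| ^+ 2) + kap], for which
    [- Laplacian g = lam ^+ 2 * (g - kap)]: the surplus [lam ^+ 2 * kap] absorbs
    the discretization error of the Laplacian, and [g] is still negative on the
    unit sphere. *)
Lemma test_function {R : realType} (N : nat) (lam : R) :
  (0 < N)%N -> 0 < lam -> psi N (lam ^+ 2) < 0 ->
  exists f : 'rV[R]_N -> R, [/\ discrete_subsolution lam f, 0 < f 0 &
    forall x, f x != 0 -> enorm x <= 1].
Proof.
move=> N0 lam0 yneg.
have [l2 l2E] : {l2 : R | l2 = lam ^+ 2} by exists (lam ^+ 2).
have l20 : 0 < l2 by rewrite l2E exprn_gt0.
rewrite -l2E in yneg.
have cb := @psi_coeff_bounded R N N0.
pose kap : R := - psi N (l2) / 2.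
have kap0 : 0 < kap by rewrite divr_gt0// oppr_gt0.
have kapE : psi N (l2) = - 2 * kap by rewrite /kap; field.
pose g (x : 'rV[R]_N) := psi N (l2 * dotp x x) + kap.
pose f (x : 'rV[R]_N) : R := if dotp x x <= 1 then Num.max 0 (g x) else 0.
have f_ge0 x : 0 <= f x by rewrite /f; case: ifP => // _; rewrite le_max lexx.
have fneq x : f x != 0 -> dotp x x <= 1 /\ f x = g x.
  rewrite /f; case: ifP => [xx|_]; last by rewrite eqxx.
  by move=> h; split => //; move: h; case: (leP 0 (g x)) => //; rewrite eqxx.
exists f; split; last first.
- move=> x /fneq[xx _]; rewrite -(@ler_pXn2r _ 2) ?nnegrE ?enorm_ge0//.
  by rewrite enorm_sqr expr1n.
- have d0 : dotp (0 : 'rV[R]_N) 0 = 0 by exact: dotp0l.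
  rewrite /f d0 ler01 lt_max; apply/orP; right.
  by rewrite /g d0 mulr0 psi0// addr_gt0.
split => //.
  move=> x /fneq[xx _] i; rewrite -(@ler_pXn2r _ 2) ?nnegrE// expr1n.
  rewrite real_normK ?num_real// (le_trans _ xx)// /dotp (bigD1 i)//= expr2.
  by rewrite lerDl sumr_ge0// => j _; rewrite -expr2 sqr_ge0.
have psic : continuous (psi N : R -> R) := derive_continuous (is_derive_psi N0).
have [e /= e0 he] : \forall s \near l2, psi N s < - kap.
  by apply: (cvgr_lt _ (psic (l2))); rewrite kapE; lra.
pose M : R := expR (l2 + 1); have M0 : 0 < M by exact: expR_gt0.
pose D : R := 3 * l2 + 1; have D0 : 0 < D by rewrite /D; lra.
pose C : R := N%:R * M * (l2 + 54 * l2 ^+ 2).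
have C0 : 0 <= C.
  by rewrite /C !mulr_ge0 ?(ltW M0)// addr_ge0 ?mulr_ge0 ?sqr_ge0 ?(ltW l20).
exists (Num.min (Num.min D^-1 (e / (2 * D))) (kap / (C + 1))).
  by rewrite !lt_min invr_gt0 D0 !divr_gt0 ?mulr_gt0//; lra.
move=> dl x /andP[dl0]; rewrite !le_min => /andP[/andP[dlD dle] dlC] fx.
have [xx fxE] := fneq x fx.
have dl1 : dl <= 1.
  by rewrite (le_trans dlD)// invf_le1//; rewrite /D; lra.
have l2dl : 3 * l2 * dl <= 1.
  have : dl * D <= 1 by rewrite -ler_pdivlMr// div1r.
  by rewrite /D; lra.
have l2dle : 3 * l2 * dl < e.
  have : dl * (2 * D) <= e by rewrite -ler_pdivlMr// mulr_gt0.
  have : 0 < dl * l2 by rewrite mulr_gt0.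
  by rewrite /D; lra.
have Cdl : C * dl <= kap.
  have : dl * (C + 1) <= kap by rewrite -ler_pdivlMr//; lra.
  lra.
have xi i : `|x 0 i| <= 1.
  rewrite -(@ler_pXn2r _ 2) ?nnegrE// expr1n.
  rewrite real_normK ?num_real// (le_trans _ xx)// /dotp (bigD1 i)//= expr2.
  by rewrite lerDl sumr_ge0// => j _; rewrite -expr2 sqr_ge0.
pose s : R := l2 * dotp x x.
have s0 : 0 <= s by rewrite mulr_ge0 ?dotp_ge0 ?(ltW l20).
have sl2 : `|s| <= l2 by rewrite ger0_norm// ler_piMr ?(ltW l20).
pose u (sg : R) i : R := l2 * (2 * (sg * dl) * x 0 i + dl ^+ 2).
have dotE sg i : sg ^+ 2 = 1 -> l2 * dotp (x + (sg * dl) *: delta_mx 0 i)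
    (x + (sg * dl) *: delta_mx 0 i) = s + u sg i.
  move=> sg1; rewrite dotpDl !dotpDr dotp_delta [dotp x (_ *: _)]dotpC !dotp_delta.
  rewrite /s /u; have -> : dl ^+ 2 = sg ^+ 2 * dl ^+ 2 by rewrite sg1 mul1r.
  by rewrite !mxE !eqxx /=; ring.
have u_le sg i : `|sg| = 1 -> `|u sg i| <= 3 * l2 * dl.
  move=> sg1; rewrite /u normrM (gtr0_norm l20).
  have -> : 3 * l2 * dl = l2 * (3 * dl) by ring.
  rewrite ler_wpM2l ?(ltW l20)//.
  rewrite (le_trans (ler_normD _ _))// !normrM sg1 mul1r (gtr0_norm dl0).
  rewrite [`|2|]ger0_norm//.
  have := xi i; have := normr_ge0 (x 0 i); move: `|x 0 i| => a.
  by move: dl0 dl1; clear; nra.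
have fg sg i : sg ^+ 2 = 1 -> `|sg| = 1 ->
    g (x + (sg * dl) *: delta_mx 0 i) <= f (x + (sg * dl) *: delta_mx 0 i).
  move=> sg1 sg1'; rewrite /f; set x' := x + _; case: (leP (dotp x' x') 1) => x'1.
    by rewrite le_max lexx orbT.
  rewrite /g /x' dotE//; have h : psi N (s + u sg i) < - kap; last by lra.
  apply: he => /=; rewrite distrC.
  have h1 : l2 < s + u sg i by rewrite -dotE// -/x' ltr_pMr.
  rewrite gtr0_norm ?subr_gt0//.
  apply: le_lt_trans l2dle; apply: le_trans (u_le sg i sg1').
  have := ler_norm (u sg i); move: sl2; rewrite (ger0_norm s0); lra.
pose p0 : R := psi N s; pose p1 : R := psi1 N s; pose p2 : R := psi2 N s.
have p2M : `|p2| <= M.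
  rewrite (le_trans (psum_le _ (fact_bounded_diffs (fact_bounded_diffs cb))))//.
  by rewrite ler_expR; lra.
have tay sg i : `|sg| = 1 -> p0 + u sg i * p1 + u sg i ^+ 2 / 2 * p2
    - M * (27 * l2 ^+ 3 * dl ^+ 3) <= psi N (s + u sg i).
  move=> sg1; have ul := u_le sg i sg1.
  have := psum_taylor2 cb sl2 (le_trans ul l2dl); rewrite -/M.
  have : M * `|u sg i| ^+ 3 <= M * (27 * l2 ^+ 3 * dl ^+ 3).
    rewrite ler_wpM2l ?(ltW M0)//.
    have -> : 27 * l2 ^+ 3 * dl ^+ 3 = (3 * l2 * dl) ^+ 3 by ring.
    by rewrite lerXn2r ?nnegrE// !mulr_ge0 ?(ltW l20) ?(ltW dl0).
  rewrite -/(psi N) -/(psi1 N) -/(psi2 N) -/p0 -/p1 -/p2.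
  move: (psi N _) (M * _) (M * _) => a b c bc.
  by rewrite ler_norml => /andP[h _]; lra.
have term i : 2 * f x - f (x + dl *: delta_mx 0 i) - f (x - dl *: delta_mx 0 i) <=
    - (2 * l2 * dl ^+ 2 * p1) - l2 ^+ 2 * (4 * dl ^+ 2 * (x 0 i * x 0 i) + dl ^+ 4) * p2
    + 54 * M * l2 ^+ 3 * dl ^+ 3.
  have f1 := fg 1 i (expr1n _ _) (normr1 _).
  have f2 := fg (-1) i (etrans (sqrrN 1) (expr1n _ _)) (normrN1 _).
  have t1 := tay 1 i (normr1 _); have t2 := tay (-1) i (normrN1 _).
  rewrite mul1r in f1; rewrite mulN1r scaleNr in f2.
  have g1 : g (x + dl *: delta_mx 0 i) = psi N (s + u 1 i) + kap.
    by rewrite -dotE ?expr1n// mul1r.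
  have g2 : g (x - dl *: delta_mx 0 i) = psi N (s + u (-1) i) + kap.
    by rewrite -dotE ?sqrrN ?expr1n// mulN1r scaleNr.
  rewrite fxE; rewrite g1 in f1; rewrite g2 in f2.
  have -> : g x = p0 + kap by [].
  have e1 : u 1 i * p1 + u (-1) i * p1 = 2 * l2 * dl ^+ 2 * p1 by rewrite /u; ring.
  have e2 : u 1 i ^+ 2 / 2 * p2 + u (-1) i ^+ 2 / 2 * p2 =
     l2 ^+ 2 * (4 * dl ^+ 2 * (x 0 i * x 0 i) + dl ^+ 4) * p2 by rewrite /u; field.
  have e3 : 54 * M * l2 ^+ 3 * dl ^+ 3 = M * (27 * l2 ^+ 3 * dl ^+ 3) +
     M * (27 * l2 ^+ 3 * dl ^+ 3) by ring.
  rewrite e3 -e2 -e1; move: f1 f2 t1 t2; clear; lra.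
apply: (le_trans (ler_sum _ (fun i _ => term i))).
have cst (a : R) : \sum_(i < N) a = N%:R * a.
  by rewrite sumr_const card_ord mulr_natl.
rewrite !big_split/= !cst sumrN.
have ode := psi_ode N0 s; rewrite -/p0 -/p1 -/p2 in ode.
have -> : \sum_(i < N) l2 ^+ 2 * (4 * dl ^+ 2 * (x 0 i * x 0 i) + dl ^+ 4) * p2 =
    dl ^+ 2 * l2 * (4 * s * p2) + N%:R * (l2 ^+ 2 * dl ^+ 4 * p2).
  under eq_bigr do rewrite mulrDr mulrDl.
  rewrite big_split/= cst; congr (_ + _).
  rewrite -mulr_suml -mulr_sumr -mulr_sumr -/(dotp x x) /s; ring.
rewrite fxE -l2E.
have -> : g x = p0 + kap by [].
have h1 : - p2 <= M by rewrite (le_trans _ p2M)// -normrN ler_norm.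
have h2 : N%:R * (l2 ^+ 2 * dl ^+ 4 * - p2) <= dl ^+ 2 * l2 * (N%:R * M * l2 * dl).
  have -> : N%:R * (l2 ^+ 2 * dl ^+ 4 * - p2) = (N%:R * l2 ^+ 2 * dl ^+ 3) * (dl * - p2).
    by ring.
  have -> : dl ^+ 2 * l2 * (N%:R * M * l2 * dl) = (N%:R * l2 ^+ 2 * dl ^+ 3) * M by ring.
  apply: ler_wpM2l; first by rewrite !mulr_ge0 ?exprn_ge0 ?(ltW dl0) ?(ltW l20).
  have : dl * - p2 <= dl * M by rewrite ler_wpM2l// ltW.
  by have := M0; move: h1; clear -dl0 dl1; nra.
have h3 : dl ^+ 2 * l2 * (C * dl) <= dl ^+ 2 * l2 * kap.
  by rewrite ler_wpM2l// mulr_ge0 ?sqr_ge0 ?(ltW l20).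
have E : 2 * N%:R * p1 = - p0 - 4 * s * p2 by rewrite -ode; ring.
have -> : N%:R * - (2 * l2 * dl ^+ 2 * p1) = - (dl ^+ 2 * l2 * (2 * N%:R * p1)) by ring.
rewrite E; move: h2 h3; rewrite /C; clear; move: (N%:R) => n.
have -> : n * (54 * M * l2 ^+ 3 * dl ^+ 3) = dl ^+ 2 * l2 * (54 * n * M * l2 ^+ 2 * dl) by ring.
lra.
Qed.

(** * The Gamma function at half-integers and Bessel functions *)

Section GammaIntegral.
Context {R : realType}.
Local Notation mu := (@lebesgue_measure R).
Implicit Types (x a b t : R).

Let gint x t := t `^ (x - 1) * expR (- t).

Definition gammaE x : \bar R := \int[mu]_(t in `]0, +oo[) (t `^ (x - 1) * expR (- t))%:E.

Let gint_measurable x (D : set R) : measurable_fun D (EFin \o gint x).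
Proof.
apply/measurable_EFinP; apply: measurable_funTS; apply: measurable_funM.
  exact: measurable_powR.
by apply: measurableT_comp => //; exact: measurableT_comp.
Qed.

Let gint_ge0 x t : 0 <= gint x t.
Proof. by rewrite mulr_ge0 ?powR_ge0 ?expR_ge0. Qed.

Let derivable_segment (F f : R -> R) a b :
  a < b -> (forall t, a <= t -> is_derive t (1 : R) F (f t)) ->
  derivable_oo_LRcontinuous F a b /\ {in `]a, b[, (F^`())%classic =1 f}.
Proof.
move=> ab dF.
have cF t : a <= t -> {for t, continuous F}.
  move=> at_; apply: differentiable_continuous; apply/derivable1_diffP.
  by have [] := dF t at_.
split; last first.
  move=> t; rewrite in_itv/= => /andP[/ltW/dF h _].
  by rewrite derive1E; apply: derive_val.
split.
- by move=> t; rewrite in_itv/= => /andP[/ltW/dF []].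
- by apply: cvg_at_right_filter; apply: cF.
- by apply: cvg_at_left_filter; apply: cF; exact: ltW.
Qed.

Let gammaE_segment x a b : 0 < x -> 0 < a -> a < b ->
  (\int[mu]_(t in `[a, b]) (gint (x + 1) t)%:E =
  (a `^ x * expR (- a) - b `^ x * expR (- b))%:E +
  x%:E * \int[mu]_(t in `[a, b]) (gint x t)%:E)%E.
Proof.
move=> x0 a0 ab.
have d1 t : a <= t -> is_derive t (1 : R) (fun t => t `^ x) (x * t `^ (x - 1)).
  by move=> at_; apply: is_derive1_powR; exact: lt_le_trans at_.
have d1' t : a <= t -> is_derive t (1 : R) (fun t => x * t `^ (x - 1))
    (x * ((x - 1) * t `^ (x - 1 - 1))).
  move=> at_; have h : is_derive t (1 : R) (fun t => t `^ (x - 1))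
      ((x - 1) * t `^ (x - 1 - 1)).
    by apply: is_derive1_powR; exact: lt_le_trans at_.
  by apply: is_derive_eq; rewrite /GRing.scale/=; ring.
have d2 t : a <= t -> is_derive t (1 : R) (fun t => - expR (- t)) (expR (- t)).
  by move=> _; apply: is_derive_eq; rewrite /GRing.scale/=; ring.
have [D1 E1] := derivable_segment ab d1; have [D2 E2] := derivable_segment ab d2.
have cw (f df : R -> R) : (forall t, a <= t -> is_derive t (1 : R) f (df t)) ->
    {within `[a, b], continuous f}.
  move=> df'; apply: derivable_within_continuous => t; rewrite in_itv/= => /andP[/df' h _].
  by have [] := h.
have c1 := cw _ _ d1'.
have c2 : {within `[a, b], continuous (fun t : R => expR (- t))}.
  apply: (cw _ (fun t => - expR (- t))) => t _.
  by apply: is_derive_eq; rewrite /GRing.scale/=; ring.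
have := integration_by_parts ab c1 D1 E1 c2 D2 E2.
have -> : (\int[mu]_(t in `[a, b]) (gint (x + 1) t)%:E =
    \int[mu]_(t in `[a, b]) (t `^ x * expR (- t))%:E)%E.
  by apply: eq_integral => t _; rewrite /gint addrK.
move=> ->; rewrite -ge0_integralZl//; last 3 first.
- exact: gint_measurable.
- by move=> t _; rewrite lee_fin.
- by rewrite lee_fin ltW.
congr (_ + _)%E; first by congr EFin; ring.
under [X in (- X)%E]eq_integral do rewrite mulrN EFinN.
rewrite integral_ge0N ?oppeK; last first.
  by move=> t _; rewrite lee_fin mulr_ge0 ?expR_ge0// mulr_ge0 ?powR_ge0// ltW.
by apply: eq_integral => t _; rewrite -EFinM /gint mulrA.
Qed.

Let bnd (n : nat) : R := n.+2%:R.

Let bnd_gt1 n : 1 < bnd n. Proof. by rewrite ltr1n. Qed.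

Let bnd_cvg (x : R) : 0 < x ->
  (bnd n)^-1 `^ x * expR (- (bnd n)^-1) - bnd n `^ x * expR (- bnd n) @[n --> \oo]
  --> (0 : R).
Proof.
move=> x0; rewrite -[0 in X in _ --> X](subrr 0).
have b0 n : 0 < bnd n by exact: lt_trans (bnd_gt1 n).
have near_le (f : nat -> R) : (forall n, 0 <= f n) ->
    (forall e, 0 < e -> exists M, forall n, M <= bnd n -> f n <= e) ->
    f n @[n --> \oo] --> (0 : R).
  move=> f0 fe; apply/cvgrPdist_le => e e0; have [M hM] := fe e e0.
  exists (Num.truncn M).+1 => // n /= Mn; rewrite sub0r normrN ger0_norm//.
  apply: hM; apply: (le_trans (ltW (truncnS_gt _))).
  by rewrite ler_nat (leq_trans Mn)// -addn2 leq_addr.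
apply: cvgB; apply: near_le.
- by move=> n; rewrite mulr_ge0 ?powR_ge0 ?expR_ge0.
- move=> e e0; have [z z0 hz] := powR_small x0 e0.
  exists z^-1 => n zn; apply: (@le_trans _ _ ((bnd n)^-1 `^ x)).
    rewrite ler_piMr ?powR_ge0// -expR0 ler_expR oppr_le0 invr_ge0; exact: ltW.
  by apply: hz; rewrite invr_gt0 b0 -[z]invrK lef_pV2 ?posrE ?invr_gt0.
- by move=> n; rewrite mulr_ge0 ?powR_ge0 ?expR_ge0.
move=> e e0; pose k := (Num.truncn x).+1.
exists ((k.+1)`!%:R / e) => n; rewrite ler_pdivrMr// => he.
apply: (@le_trans _ _ (bnd n ^+ k * (k.+1`!%:R / bnd n ^+ k.+1))).
  rewrite ler_pM ?powR_ge0 ?expR_ge0//.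
    by rewrite -powR_mulrn ?(ltW (b0 n))// ler_powR ?(ltW (bnd_gt1 n))// ltW// truncnS_gt.
  rewrite expRN -[leRHS]invrK lef_pV2 ?posrE ?expR_gt0 ?invr_gt0 ?divr_gt0 ?exprn_gt0 ?ltr0n ?fact_gt0//.
  rewrite invf_div; apply: le_trans (expR_ge1Dxn k (ltW (b0 n))).
  by rewrite lerDr.
have p0 : 0 < bnd n ^+ k by rewrite exprn_gt0.
rewrite exprS; move: (bnd n ^+ k) p0 (b0 n) he => p p0; move: (bnd n) => b b0' he.
have -> : p * ((k.+1)`!%:R / (b * p)) = (k.+1)`!%:R / b by field; rewrite !gt_eqF.
by rewrite ler_pdivrMr// mulrC.
Qed.

Let gammaE_approx x :
  (\int[mu]_(t in `[((bnd n)^-1)%R, bnd n]) (gint x t)%:E @[n --> \oo] --> gammaE x)%E.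
Proof.
have b0 n : 0 < bnd n by exact: lt_trans (bnd_gt1 n).
have UE : \bigcup_n `[(bnd n)^-1, bnd n]%classic = `]0, +oo[%classic :> set R.
  apply/seteqP; split => t.
    by move=> [n _]; rewrite /= !in_itv/= andbT => /andP[+ _]; apply: lt_le_trans; rewrite invr_gt0.
  rewrite /= in_itv/= andbT => t0.
  exists (maxn (Num.truncn t).+1 (Num.truncn t^-1).+1) => //=; rewrite in_itv/=.
  have h (s : R) : 0 < s -> s <= bnd (Num.truncn s).+1.
    by move=> s0; apply: (le_trans (ltW (truncnS_gt _))); rewrite ler_nat -addn2 leq_addr.
  have mono m n : (m <= n)%N -> bnd m <= bnd n by move=> mn; rewrite ler_nat.
  apply/andP; split; last by apply: (le_trans (h t t0)); rewrite mono// leq_maxl.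
  rewrite -[leRHS]invrK lef_pV2 ?posrE ?invr_gt0//.
  by apply: (le_trans (h _ (_ : 0 < t^-1))); rewrite ?invr_gt0// mono// leq_maxr.
rewrite /gammaE -UE; apply: ge0_nondecreasing_set_cvg_integral => //.
- apply/nondecreasing_seqP => n; apply/subsetPset => t; rewrite /= !in_itv/= => /andP[h1 h2].
  have bb : bnd n <= bnd n.+1 by rewrite ler_nat.
  by rewrite (le_trans h2)// andbT (le_trans _ h1)// lef_pV2 ?posrE.
- by move=> n; exact: gint_measurable.
- by move=> n t _; rewrite lee_fin; exact: gint_ge0.
Qed.

(** Integration by parts on segments exhausting the half-line; since all the
    integrands are nonnegative, finiteness of the integrals is not at issue. *)
Lemma gammaED1 x : 0 < x -> gammaE (x + 1) = (x%:E * gammaE x)%E.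
Proof.
move=> x0; apply: (cvg_unique _ (@gammaE_approx (x + 1))) => //.
have c1 : (((bnd n)^-1 `^ x * expR (- (bnd n)^-1) - bnd n `^ x * expR (- bnd n))%R%:E
    @[n --> \oo] --> 0%:E)%E.
  by apply: cvg_EFin; [exact: nearW|exact: bnd_cvg].
have c2 : (x%:E * \int[mu]_(t in `[((bnd n)^-1)%R, bnd n]) (gint x t)%:E @[n --> \oo] -->
    x%:E * gammaE x)%E.
  by apply: cvgeZl => //; exact: gammaE_approx.
have ad : (0%:E +? x%:E * gammaE x)%E by apply: fin_num_adde_defr.
have c := cvgeD ad c1 c2; rewrite add0e in c.
rewrite /=; under eq_fun => n.
  rewrite gammaE_segment// ?invr_gt0 ?(lt_trans ltr01 (bnd_gt1 n))//; last first.
    by rewrite (lt_trans _ (bnd_gt1 n))// invf_lt1// (lt_trans ltr01 (bnd_gt1 n)).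
  over.
exact: c.
Qed.

Let gammaE_ge0 x : (0 <= gammaE x)%E.
Proof. by apply: integral_ge0 => t _; rewrite lee_fin; exact: gint_ge0. Qed.

Lemma gammaE1 : gammaE 1 = 1%E.
Proof.
rewrite /gammaE integral_itv_obnd_cbnd; last exact: gint_measurable.
under eq_integral do rewrite subrr powRr0 mul1r.
have dF (t : R) : is_derive t (1 : R) (fun t : R => - expR (- t)) (expR (- t)).
  by apply: is_derive_eq; rewrite /GRing.scale/=; ring.
rewrite (@ge0_continuous_FTC2y _ _ (fun t => - expR (- t)) _ 0)//.
- by rewrite oppr0 expR0 EFinN oppeK add0e.
- apply: derivable_within_continuous => t _.
  have : is_derive t (1 : R) (fun t : R => expR (- t)) (- expR (- t)).
    by apply: is_derive_eq; rewrite /GRing.scale/=; ring.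
  by move=> [].
- by rewrite -oppr0; apply: cvgN; exact: cvgr_expR.
- have c0 : continuous (fun t : R => - expR (- t)) := derive_continuous dF.
  by apply/cvg_at_right_filter; exact: c0.
- by move=> t _; rewrite derive1E; apply: derive_val.
Qed.

Let gammaE_le x y z : (forall t, 0 < t -> t `^ (x - 1) <= t `^ (y - 1) + t `^ (z - 1)) ->
  (gammaE x <= gammaE y + gammaE z)%E.
Proof.
move=> h; rewrite /gammaE -ge0_integralD//=; last 4 first.
- by move=> t _; rewrite lee_fin; exact: gint_ge0.
- exact: gint_measurable.
- by move=> t _; rewrite lee_fin; exact: gint_ge0.
- exact: gint_measurable.
apply: ge0_le_integral => //=.
- by move=> t _; rewrite lee_fin; exact: gint_ge0.
- exact: gint_measurable.
- by apply: emeasurable_funD; exact: gint_measurable.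
move=> t; rewrite in_itv/= andbT => t0.
by rewrite -EFinD lee_fin -mulrDl ler_wpM2r ?expR_ge0 ?h.
Qed.

Lemma gammaE_half (n : nat) : (0 < gammaE (n.+1%:R / 2) < +oo)%E.
Proof.
suff base : (0 < gammaE (1 / 2) < +oo)%E.
  have [m] := ubnP n; elim: m n => [n|m IHm n]; first by clear base; rewrite ltn0.
  case: n => [|[|n]] nm; [exact: base| |]; clear base.
    have -> : 2%:R / 2 = 1 :> R by rewrite divff.
    by rewrite gammaE1 lte01 ltry.
  move: (IHm n (ltn_trans (ltnSn n) nm)); clear IHm.
  have -> : n.+3%:R / 2 = n.+1%:R / 2 + 1 :> R.
    by rewrite -addn2 natrD; field.
  have x0 : 0 < n.+1%:R / 2 :> R by rewrite divr_gt0.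
  rewrite gammaED1//; move: (_ / 2) x0 => x x0 /andP[g0 gy].
  have gf : gammaE x \is a fin_num by rewrite ge0_fin_numE// ltW.
  rewrite -(fineK gf) -EFinM ltry andbT lte_fin mulr_gt0//.
  by rewrite fine_gt0// g0 gy.
have e32 : gammaE (1 / 2 + 1) = ((1 / 2)%:E * gammaE (1 / 2))%E.
  by rewrite gammaED1// divr_gt0.
have e2 : gammaE (1 + 1) = 1%E by rewrite gammaED1// gammaE1 mule1.
have pw t : 0 < t -> t `^ (1 / 2) * t `^ (1 / 2) = t.
  by move=> t0; rewrite -powRD ?(gt_eqF t0) ?implybT// -splitr powRr1// ltW.
have up : (gammaE (1 / 2 + 1) <= gammaE 1 + gammaE (1 + 1))%E.
  apply: gammaE_le => t t0; rewrite !addrK subrr powRr0 powRr1 ?(ltW t0)//.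
  have := pw t t0; have := powR_ge0 t (1 / 2); nra.
have low : (gammaE 1 <= gammaE (1 / 2) + gammaE (1 / 2 + 1))%E.
  apply: gammaE_le => t t0; rewrite addrK subrr powRr0.
  have -> : 1 / 2 - 1 = - (1 / 2) :> R by field.
  have p0 : 0 < t `^ (1 / 2) by rewrite powR_gt0.
  rewrite powRN; move: (t `^ _) p0 => p p0.
  rewrite -(@ler_pM2r _ p)// mul1r mulrDl mulVf ?gt_eqF//.
  have := sqr_ge0 (p - 1); rewrite expr2; nra.
have gf : gammaE (1 / 2) \is a fin_num.
  rewrite ge0_fin_numE//; move: up; rewrite e32 gammaE1 e2.
  have := gammaE_ge0 (1 / 2); case: (gammaE (1 / 2)) => [r||]//; first by rewrite ltry.
  by move=> _; rewrite gt0_muley ?lte_fin ?divr_gt0.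
rewrite ltey_eq gf andbT lt0e gammaE_ge0 andbT; apply/eqP => g0.
by move: low; rewrite e32 gammaE1 g0 mule0 adde0 leNgt lte01.
Qed.

End GammaIntegral.

Section BesselFunction.
Context {R : realType}.
Variable N : nat.
Hypothesis N0 : (0 < N)%N.

Lemma Gamma_half_gt0 (m : nat) : 0 < Gamma (m%:R + N%:R / 2 : R).
Proof.
have -> : m%:R + N%:R / 2 = (2 * m + N).-1.+1%:R / 2 :> R.
  by rewrite prednK ?addn_gt0 ?N0 ?orbT// natrD natrM; field.
by have /andP[g0 gy] := @gammaE_half R (2 * m + N).-1; rewrite fine_gt0// g0.
Qed.

Lemma Gamma_halfS (m : nat) : Gamma (m.+1%:R + N%:R / 2 : R) =
  (m%:R + N%:R / 2) * Gamma (m%:R + N%:R / 2).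
Proof.
have x0 : 0 < m%:R + N%:R / 2 :> R by rewrite ltr_wpDl// divr_gt0 ?ltr0n.
rewrite -natr1 addrAC.
rewrite -[LHS]/(fine (gammaE (m%:R + N%:R / 2 + 1))) gammaED1//.
by rewrite -/(fine _) fineM//; have := Gamma_half_gt0 m; rewrite /Gamma /Rintegral -/(gammaE _);
  case: (gammaE _) => //=; rewrite ltxx.
Qed.

(** The functional equation of the Gamma function at the half-integers makes the
    coefficients of both series satisfy the same recursion. *)
Lemma besselJ_psi (z : R) : 0 < z -> besselJ ((N%:R - 2) / 2) z =
  (Gamma (N%:R / 2))^-1 * (z / 2) `^ ((N%:R - 2) / 2) * psi N (z ^+ 2).
Proof.
move=> z0; pose c : R := (Gamma (N%:R / 2))^-1 * (z / 2) `^ ((N%:R - 2) / 2).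
have NR0 : 0 < N%:R :> R by rewrite ltr0n.
have G0 : 0 < Gamma (N%:R / 2 : R) by have := Gamma_half_gt0 0; rewrite add0r.
have coefE (m : nat) : (-1) ^+ m / (m`!%:R * Gamma (m%:R + N%:R / 2)) / 4 ^+ m =
    (Gamma (N%:R / 2))^-1 * psi_coeff N m :> R.
  elim: m => [|m IHm]; first by rewrite fact0 !expr0 add0r mul1r mulr1 divr1 mul1r.
  have e (g p q : R) : g * (- p / q) = - (g * p) / q by ring.
  rewrite Gamma_halfS /= e -IHm factS natrM !exprS.
  have -> : m.+1%:R = m%:R + 1 :> R by rewrite natr1.
  have Gm := Gamma_half_gt0 m; have m0 := ler0n R m.
  have f0 : 0 < m`!%:R :> R by rewrite ltr0n fact_gt0.
  have p0 : 0 < 4 ^+ m :> R by rewrite exprn_gt0.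
  move: (Gamma (m%:R + _)) Gm (m`!%:R) f0 (4 ^+ m) p0 ((-1) ^+ m) => G Gm f f0 p p0 s.
  by move: m0 => m0; field; rewrite !gt_eqF//; lra.
rewrite /besselJ -/c /psi /psum /pseries.
rewrite (_ : series _ = c *: series (fun i => psi_coeff N i * (z ^+ 2) ^+ i)).
  by rewrite limZr//; exact: psum_cvg (psi_coeff_bounded N0).
apply/funext => n; rewrite /series /= [RHS]mulr_sumr; apply: eq_bigr => m _.
have -> : m%:R + (N%:R - 2) / 2 + 1 = m%:R + N%:R / 2 :> R by field.
have zh : 0 < z / 2 by rewrite divr_gt0.
rewrite powRD; last by rewrite (gt_eqF zh) implybT.
rewrite -natrM powR_mulrn ?divr_ge0 ?(ltW z0)// /c.
rewrite expr_div_n -exprM.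
have := coefE m; have -> : 4 ^+ m = 2 ^+ (2 * m) :> R.
  by rewrite exprM; congr (_ ^+ _); rewrite expr2; ring.
move: (2 ^+ (2 * m)) (z ^+ (2 * m)) => p q E.
transitivity (((-1) ^+ m / (m`!%:R * Gamma (m%:R + N%:R / 2)) / p) *
  (q * (z / 2) `^ ((N%:R - 2) / 2))); first by ring.
by rewrite E /GRing.scale/=; ring.
Qed.

Lemma bessel_zero1_psi : exists2 j : R, 0 < j & [/\ bessel_zero1 ((N%:R - 2) / 2) = j &
  forall z0, j < z0 -> exists2 z, j < z <= z0 & psi N (z ^+ 2) < 0].
Proof.
have [j j0 [psij pos neg]] := @psi_first_zero R N N0.
exists j => //; split => //.
have G0 : 0 < Gamma (N%:R / 2 : R) by have := Gamma_half_gt0 0; rewrite add0r.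
have BE (z : R) : 0 < z -> (besselJ ((N%:R - 2) / 2) z == 0) = (psi N (z ^+ 2) == 0).
  move=> z0; rewrite besselJ_psi// mulf_eq0 (negbTE (_ : _ != 0))//.
  by rewrite gt_eqF// mulr_gt0 ?invr_gt0// powR_gt0// divr_gt0.
have zj : first_positive_zero (besselJ ((N%:R - 2) / 2)) j.
  split => //; first by apply/eqP; rewrite BE// psij.
  move=> w /andP[w0 wj]; rewrite BE// gt_eqF//; apply: pos.
  by rewrite (ltW w0).
apply: xget_unique => // z [z0 /eqP Bz nz]; apply/eqP.
have [zj'|jz|//] := ltgtP z j.
  by case: zj => _ _ /(_ z); rewrite z0 zj' => /(_ isT); rewrite Bz.
by have := nz j; rewrite j0 jz BE// psij eqxx => /(_ isT).
Qed.

End BesselFunction.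

(** * Integrals of functions bounded below outside a null set *)

Import HBNNSimple.

(** No measurability of [f] is assumed: the bound follows from the definition
    of the integral as a difference of two suprema over simple functions. *)
Lemma integral_ge_off_null {R : realType} {d : measure_display}
    {T : measurableType d} (mu : {measure set T -> \bar R}) (D A Z : set T)
    (f : T -> \bar R) (C : R) :
  measurable A -> measurable Z -> A `<=` D -> mu Z = 0%E -> 0 <= C ->
  (forall x, D x -> ~ Z x -> (0 <= f x)%E) ->
  (forall x, A x -> ~ Z x -> (C%:E <= f x)%E) ->
  (C%:E * mu A <= \int[mu]_(x in D) f x)%E.
Proof.
move=> mA mZ AD Z0 C0 f0 fC.
have mAZ : mu (A `\` Z) = mu A.
  apply/eqP; rewrite eq_le; apply/andP; split.
    by rewrite le_measure ?inE//; exact: measurableD.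
  apply: (@le_trans _ _ (mu (A `\` Z `|` Z))).
    rewrite le_measure ?inE//; first by apply: measurableU => //; exact: measurableD.
    by move=> x Ax; have [Zx|Zx] := pselect (Z x); [right|left].
  apply: (le_trans (measureU2 mu (measurableD mA mZ) mZ)).
  by rewrite [X in (_ + X)%E]Z0 adde0.
set g := f \_ D.
pose phi x := (C * \1_(A `\` Z) x)%:E.
have phi0 x : (0 <= phi x)%E by rewrite lee_fin mulr_ge0// indicE.
have iphi : (\int[mu]_x phi x = C%:E * mu A)%E.
  under eq_integral do rewrite /phi EFinM.
  rewrite ge0_integralZl//.
    by rewrite integral_indic ?setIT ?mAZ//; exact: measurableD.
  by apply/measurable_EFinP; apply: measurable_indic; exact: measurableD.
have gpos x : (phi x <= g^\+ x)%E.
  rewrite /phi indicE; have [AZ|AZ] := pselect ((A `\` Z) x).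
    rewrite mem_set// mulr1 funeposE /g patchE mem_set; last by apply: AD; case: AZ.
    by case: AZ => Ax Zx; rewrite le_max fC.
  by rewrite memNset// mulr0 funepos_ge0.
have gneg x : ~ Z x -> (g^\- x = 0)%E.
  move=> Zx; rewrite funenegE /g patchE; case: ifPn => [/set_mem Dx|_].
    by apply/max_idPr; rewrite oppe_le0 f0.
  by rewrite oppe0 maxxx.
rewrite -iphi ge0_integralTE// /integral -/g.
set s1 := ereal_sup _; set s2 := ereal_sup _; set s3 := ereal_sup _.
have s12 : (s1 <= s2)%E.
  apply: le_ereal_sup => _ [h hphi <-]; exists h => // x.
  exact: le_trans (gpos x).
have s30 : (s3 <= 0)%E.
  apply: ub_ereal_sup => _ [h hg <-]; rewrite -integralT_nnsfun.
  have -> : (\int[mu]_x (h x)%:E = \int[mu]_x `|(h x)%:E|)%E.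
    by apply: eq_integral => x _; rewrite gee0_abs// lee_fin.
  rewrite le_eqVlt; apply/orP; left; apply/eqP.
  apply/(ae_eq_integral_abs mu measurableT); first exact/measurable_EFinP.
  exists Z; split => // x /= nx; apply: contrapT => Zx; apply: nx => _.
  by have := hg x; rewrite gneg// lee_fin => h0; congr EFin; apply/eqP; rewrite eq_le h0/=.
by apply: (le_trans s12); rewrite leeDl// oppe_ge0.
Qed.

(** * Sets avoided by almost every path at almost every time *)

Section AvoidNullSet.
Context {R : realType} {N : nat} {d : measure_display} {Omega : measurableType d}.
Variables (P : probability Omega R) (Y : R -> Omega -> 'rV[R]_N).
Hypothesis mY : forall t, 0 <= t -> measurable_fun setT (Y t : Omega -> borel_rV R N).
Local Notation mu := (@lebesgue_measure R).

Let next (n : nat) (s : R) : R := (Num.truncn (s * n.+1%:R)).+1%:R / n.+1%:R.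

Let next_itv n s : Num.max 0 s < next n s <= Num.max 0 s + n.+1%:R^-1.
Proof.
rewrite /next ltr_pdivlMr// ler_pdivrMr// mulrDl mulVf ?pnatr_eq0//.
have [s0|s0] := leP 0 s.
  have sn : 0 <= s * n.+1%:R by rewrite mulr_ge0.
  have /andP[h1 h2] := truncn_itv sn.
  by rewrite h2 -natr1 lerD2r.
rewrite (_ : Num.truncn _ = 0%N) ?mul0r ?add0r ?ltr01 ?lexx//.
by apply/truncn0Pn; rewrite -ltNge (lt_trans _ ltr01)// nmulr_rlt0.
Qed.

Let next_cvg s : next n s @[n --> \oo] --> (Num.max 0 s)^'+.
Proof.
move=> A [e /= e0 hA]; exists (Num.truncn e^-1).+1 => // n /= en.
have /andP[h1 h2] := next_itv n s; apply: hA => //=.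
rewrite /ball /= ltr0_norm ?subr_lt0// opprB ltrBlDl (le_lt_trans h2)// ltrD2l.
rewrite invf_plt ?posrE//; apply: (lt_le_trans (truncnS_gt _)).
by rewrite ler_nat leqW.
Qed.

(** Right-continuous paths make the process jointly measurable, as a limit of
    processes that are constant in time on small intervals. *)
Let joint_measurable :
  (forall w t, 0 <= t -> Y s w @[s --> t^'+] --> Y t w) ->
  measurable_fun setT (fun z : R * Omega => Y (Num.max 0 z.1) z.2 : borel_rV R N).
Proof.
move=> rcY; apply: measurable_rV => i.
apply: (@measurable_fun_cvg _ _ _ _ (fun n z => Y (next n z.1) z.2 0 i)); last first.
  move=> [s w] _ /=; have s0 : 0 <= Num.max 0 s by rewrite le_max lexx.
  have c := @coord_continuous R 1 N 0 i (Y (Num.max 0 s) w).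
  exact: (cvg_comp _ _ (cvg_comp _ _ (@next_cvg s) (rcY w _ s0)) c).
move=> n _ B mB; rewrite setTI.
pose G (m : nat) := [set s : R | Num.truncn (s * n.+1%:R) = m].
pose t (m : nat) : R := m.+1%:R / n.+1%:R.
rewrite (_ : _ @^-1` B = \bigcup_m (G m `*` ((fun w => Y (t m) w 0 i) @^-1` B))).
  apply: bigcup_measurable => m _; apply: measurableX.
    apply: is_interval_measurable => x y xm ym z /andP[xz zy].
    apply/eqP; rewrite eqn_leq; apply/andP; split; [rewrite -ym|rewrite -xm].
      by rewrite le_truncn// ler_wpM2r.
    by rewrite le_truncn// ler_wpM2r.
  rewrite -[X in measurable X]setTI.
  have t0 : 0 <= t m by rewrite divr_ge0.
  exact: (measurableT_comp (coord_measurable i) (mY t0)).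
apply/seteqP; split => [[s w]|[s w]] /=.
  by move=> h; exists (Num.truncn (s * n.+1%:R)) => //; split.
by move=> [m _ [/= Gm]]; rewrite /t /next Gm.
Qed.

Lemma ae_avoid_everywhere (B : set (borel_rV R N)) (t : R) :
  (forall w t, 0 <= t -> Y s w @[s --> t^'+] --> Y t w) -> measurable B ->
  (forall s, 0 < s -> P (Y s @^-1` B) = 0%E) ->
  {ae P, forall w, exists Z : set R, [/\ measurable Z, mu Z = 0%E &
    forall s, 0 < s <= t -> B (Y s w) -> Z s]}.
Proof.
move=> rcY mB B0; have jm := joint_measurable rcY.
pose E := [set z : R * Omega | `]0, t]%classic z.1 /\ B (Y (Num.max 0 z.1) z.2)].
have mE : measurable E.
  rewrite (_ : E = (fst @^-1` `]0, t]) `&`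
     ((fun z : R * Omega => Y (Num.max 0 z.1) z.2 : borel_rV R N) @^-1` B))//.
  apply: measurableI; last by rewrite -[X in measurable X]setTI; exact: jm.
  by rewrite -[X in measurable X]setTI; apply: measurable_fst.
have fub := @fubini_tonelli _ _ _ _ _ mu P (fun z => (\1_E z)%:E).
have i0 : (\int[P]_w \int[mu]_s (\1_E (s, w))%:E = 0)%E.
  rewrite -fub; last 2 first.
  - by apply/measurable_EFinP; exact: measurable_indic.
  - by move=> z; rewrite lee_fin indicE.
  rewrite integral0_eq// => s _.
  have [st|st] := pselect (`]0, t]%classic s).
    have s0 : 0 < s by move: st; rewrite /= in_itv/= => /andP[].
    under eq_integral => w _.
      rewrite (_ : \1_E (s, w) = \1_(Y s @^-1` B) w); last first.
        rewrite !indicE; congr (_%:R); congr nat_of_bool; apply/idP/idP => /set_mem h; apply/mem_set.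
          by case: h => _ /=; rewrite max_r ?ltW.
        by split => //=; rewrite max_r ?ltW.
      over.
    rewrite integral_indic// ?setIT; first exact: B0.
    by rewrite -[X in measurable X]setTI; exact: (mY (ltW s0)).
  apply: integral0_eq => w _; rewrite indicE memNset// => -[]//.
have mS : measurable_fun setT (fun w => \int[mu]_s (\1_E (s, w))%:E)%E.
  have m1E : measurable_fun setT (fun z : R * Omega => (\1_E z : R)%:E).
    by apply/measurable_EFinP; exact: measurable_indic.
  have p1E (z : R * Omega) : (0 <= (\1_E z : R)%:E)%E by rewrite lee_fin indicE.
  have h := @measurable_fun_fubini_tonelli_G _ _ _ _ _ mu _ m1E p1E.
  exact: h.
have S0 w : (0 <= \int[mu]_s (\1_E (s, w))%:E)%E.
  by apply: integral_ge0 => s _; rewrite lee_fin indicE.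
have := (ae_eq_integral_abs P measurableT mS).1.
under eq_integral do rewrite gee0_abs//.
move=> /(_ i0); apply: filterS => w /= /(_ I) h.
exists (ysection E w); split.
- exact: measurable_ysection.
- rewrite -h -[ysection E w]setIT -integral_indic//; last exact: measurable_ysection.
  apply: eq_integral => s _; rewrite !indicE; congr ((_%:R)%:E); congr nat_of_bool.
  by rewrite mem_ysection.
- move=> s st Bs; rewrite /ysection /=; apply/mem_set; split => //=.
  by have /andP[/ltW s0 _] := st; rewrite max_r.
Qed.

End AvoidNullSet.

(** On the null set of irregular paths the process is replaced by a constant
    path, which makes all paths right-continuous. *)
Lemma ae_avoid {R : realType} {N : nat} {d : measure_display}
    {Omega : measurableType d} (P : probability Omega R)
    (X : R -> Omega -> 'rV[R]_N) (B : set (borel_rV R N)) (t : R) :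
  (forall t : R, 0 <= t -> measurable_fun setT (X t : Omega -> borel_rV R N)) ->
  right_continuous_paths P X -> measurable B ->
  (forall s : R, 0 < s -> P (X s @^-1` B) = 0%E) ->
  {ae P, forall w, exists Z : set R,
    [/\ measurable Z, lebesgue_measure Z = 0%E &
      forall s : R, 0 < s <= t -> B (X s w) -> Z s]}.
Proof.
move=> mX [M [mM PM sub]] mB B0.
pose Y (s : R) w : 'rV[R]_N := if w \in M then 0 else X s w.
have YX s w : ~ M w -> Y s w = X s w by move=> Mw; rewrite /Y memNset.
have mY (s : R) : 0 <= s -> measurable_fun setT (Y s : Omega -> borel_rV R N).
  move=> s0; apply: measurable_rV => i.
  rewrite (_ : (fun w => Y s w 0 i) = (fun w => \1_(~` M) w * X s w 0 i)).
    apply: measurable_funM; first by apply: measurable_indic; exact: measurableC.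
    exact: (measurableT_comp (coord_measurable i) (mX s s0)).
  apply/funext => w; rewrite /Y indicE in_setC; case: (w \in M) => /=.
    by rewrite mxE mul0r.
  by rewrite mul1r.
have rcY w (s : R) : 0 <= s -> Y z w @[z --> s^'+] --> Y s w.
  rewrite /Y; have [/set_mem Mw|/negP Mw] := boolP (w \in M) => s0; first exact: cvg_cst.
  apply: contrapT => nc; apply: Mw; apply/mem_set; apply: sub => /= h; apply: nc.
  exact: h.
have PY (s : R) : 0 < s -> P (Y s @^-1` B) = 0%E.
  move=> s0; rewrite -(B0 s s0); apply: measure_ae_eq.
  - by rewrite -[X in measurable X]setTI; exact: (mY s (ltW s0)).
  - by rewrite -[X in measurable X]setTI; exact: (mX s (ltW s0)).
  exists M; split => // w /= nw; apply: contrapT => Mw; apply: nw.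
  by rewrite /preimage /= YX.
have h1 := ae_avoid_everywhere mY t rcY mB PY.
have h2 : {ae P, forall w, ~ M w} by exists M; split => // w /= /contrapT.
apply: filterS2 h1 h2 => w [Z [mZ Z0 hZ]] Mw; exists Z; split => // s st.
by have := hZ s st; rewrite YX.
Qed.

Lemma lebesgue_outer_translate {R : realType} {N : nat} (A : set 'rV[R]_N) x :
  lebesgue_outer A = 0%E -> lebesgue_outer [set y | A (x + y)] = 0%E.
Proof.
move=> A0; apply/eqP; rewrite eq_le; apply/andP; split; last first.
  apply: le_ereal_inf_tmp => _ [a [b [_ ->]]]; apply: nneseries_ge0 => k _ _.
  by rewrite lee_fin; apply: prodr_ge0 => i _; rewrite le_max lexx.
rewrite -[leRHS]A0; apply: ereal_inf_le_tmp => _ [a [b [cov ->]]].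
exists (fun k => a k - x), (fun k => b k - x); split.
  move=> y /cov[k _ hk]; exists k => // i; have := hk i; rewrite !mxE.
  by rewrite ltrBlDl lerBrDl.
apply: eq_eseriesr => k _; congr EFin; apply: eq_bigr => i _.
by rewrite !mxE opprB addrA subrK.
Qed.

(** The density is bounded and boxes shrinking to the point have small volume. *)
Lemma stable_no_atom {R : realType} {N : nat} {d : measure_display}
    {T : measurableType d} (P : probability T R) (Z : T -> 'rV[R]_N)
    (alpha tau : R) (p : 'rV[R]_N) : 0 < alpha -> 0 < tau -> (0 < N)%N ->
  measurable_fun setT (Z : T -> borel_rV R N) ->
  (forall xi, \int[P]_w cos (dotp xi (Z w)) = expR (- (tau * enorm xi `^ alpha))) ->
  (forall xi, \int[P]_w sin (dotp xi (Z w)) = 0) ->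
  P (Z @^-1` ccube p 0) = 0%E.
Proof.
move=> a0 t0 N0 mZ cosZ sinZ.
have [C [C0 hC]] := stable_density_bounded a0 t0 mZ cosZ sinZ.
have mp B : measurable (B : set (borel_rV R N)) -> measurable (Z @^-1` B).
  by move=> mB; rewrite -[X in measurable X]setTI; exact: mZ.
apply/eqP; rewrite eq_le measure_ge0 andbT.
apply/lee_addgt0Pr => e e0; rewrite add0e.
pose ep := Num.min 1 (e / (C + 1)).
have C1 : 0 < C + 1 by lra.
have ep0 : 0 < ep by rewrite lt_min ltr01 divr_gt0.
apply: (@le_trans _ _ (P (Z @^-1` box (p - const_mx ep) p))).
  rewrite le_measure ?inE//; [by apply: mp; exact: ccube_measurable|by apply: mp; exact: box_measurable|].
  move=> w h i; have := h i; rewrite normr_le0 subr_eq0 => /eqP ->.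
  by rewrite !mxE lexx andbT ltrBlDr ltrDl.
apply: (le_trans (hC _ _)); rewrite lee_fin.
have -> : box_volume (p - const_mx ep) p = ep ^+ N.
  rewrite /box_volume (eq_bigr (fun=> ep)); last first.
    by move=> i _; rewrite !mxE opprB addrC subrK max_r// ltW.
  by rewrite prodr_const card_ord.
have epN : ep ^+ N <= ep.
  rewrite -(prednK N0) exprS ler_piMr ?(ltW ep0)// exprn_ile1 ?(ltW ep0)//.
  by rewrite ge_min lexx.
have : ep * (C + 1) <= e by rewrite -ler_pdivlMr// ge_min lexx orbT.
have : C * ep ^+ N <= C * ep by rewrite ler_wpM2l.
lra.
Qed.

Lemma lt_liminf_right {R : realType} (g : R -> R) (c : R) :
  (c%:E < limf_einf (fun r => (g r)%:E) 0^'+)%E ->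
  exists2 l, c < l & exists2 r1 : R, 0 < r1 & forall r, 0 < r < r1 -> l <= g r.
Proof.
rewrite /limf_einf /limf_esup lteNr => /ereal_inf_lt[_ [A [r1 /= r10 hA] <-]] supA.
have hg l r : (ereal_sup [set (- (g r)%:E)%E | r in A] <= (- l)%:E)%E ->
    0 < r < r1 -> l <= g r.
  move=> hl /andP[r0 rr1]; have Ar : A r.
    by apply: hA => //=; rewrite /ball /= sub0r normrN gtr0_norm.
  have := le_trans (ereal_sup_ubound (ex_intro2 _ _ r Ar erefl)) hl.
  by rewrite -EFinN lee_fin lerN2.
move: supA hg; case: (ereal_sup _) => [s||] //= sc hg.
  exists (- s); first by rewrite ltrNr -lte_fin EFinN.
  by exists r1 => // r; apply: hg; rewrite opprK.
by exists (c + 1); [rewrite ltrDl|exists r1 => // r; apply: hg; rewrite leNye].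
Qed.

Lemma exp_exp_unbounded {R : realType} (c D b M : R) (k0 : nat) :
  0 < c -> 0 < D -> 1 < b ->
  exists2 k, (k0 <= k)%N & M <= c ^+ k.+1 * expR (D * b ^+ k).
Proof.
move=> c0 D0 b1; pose kap := `|ln c|; pose be := b - 1.
have be0 : 0 < be by rewrite subr_gt0.
have ckap : expR (- kap) <= c.
  rewrite -[leRHS](lnK (_ : c \in Num.pos)) ?posrE// ler_expR.
  by rewrite lerNl /kap -normrN ler_norm.
pose i := maxn k0 (Num.truncn ((3 * kap + `|M|) / (D * be ^+ 2))).+1.
have i0 : (0 < i)%N by rewrite leq_max orbT.
have iR : 1 <= i%:R :> R by rewrite ler1n.
have ib : 3 * kap + `|M| <= i%:R * (D * be ^+ 2).
  rewrite -ler_pdivrMr ?mulr_gt0 ?exprn_gt0//.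
  by rewrite (le_trans (ltW (truncnS_gt _)))// ler_nat leq_maxr.
exists (2 * i)%N.
  by rewrite (@leq_trans i) ?leq_maxl// leq_pmull.
apply: (@le_trans _ _ (expR (- kap) ^+ (2 * i).+1 * expR (D * b ^+ (2 * i)))); last first.
  by rewrite ler_wpM2r ?expR_ge0// lerXn2r ?nnegrE ?expR_ge0 ?(ltW c0).
rewrite -expRM_natl -expRD; apply: le_trans (expR_ge1Dx _).
have bi : i%:R * be <= b ^+ i.
  have be1 : -1 <= be by lra.
  have h := @bernoulli_ineq _ be i be1.
  have -> : b = 1 + be by rewrite /be; ring.
  by rewrite (le_trans _ h)// lerDr.
have b2 : i%:R ^+ 2 * be ^+ 2 <= b ^+ (2 * i).
  rewrite mulnC exprM -exprMn ler_pXn2r ?nnegrE ?exprn_ge0 ?mulr_ge0 ?(ltW be0)//.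
  by rewrite (le_trans ler01 (ltW b1)).
have Db : D * (i%:R ^+ 2 * be ^+ 2) <= D * b ^+ (2 * i) by rewrite ler_wpM2l ?(ltW D0).
have ii : i%:R * (3 * kap + `|M|) <= i%:R * (i%:R * (D * be ^+ 2)) by rewrite ler_wpM2l.
have kap0 : 0 <= kap by exact: normr_ge0.
have iM : `|M| <= i%:R * `|M| by rewrite ler_peMl.
have ik : kap <= i%:R * kap by rewrite ler_peMl.
have MM := ler_norm M.
rewrite -natr1 natrM.
move: Db ii; have -> : D * (i%:R ^+ 2 * be ^+ 2) = i%:R * (i%:R * (D * be ^+ 2)) by ring.
have -> : i%:R * (3 * kap + `|M|) = 3 * (i%:R * kap) + i%:R * `|M| by ring.
have -> : (2%:R * i%:R + 1) * - kap = - 2 * (i%:R * kap) - kap by ring.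
move: iM ik MM kap0; move: (D * b ^+ _) (i%:R * (i%:R * _)) (i%:R * kap) (i%:R * `|M|).
clear ckap ib; clearbody kap; clear - M kap.
by move: `|M| kap => m l *; lra.
Qed.

Lemma le_coord_enorm {R : realType} {N : nat} (x : 'rV[R]_N) i : `|x 0 i| <= enorm x.
Proof.
rewrite -(@ler_pXn2r _ 2) ?nnegrE ?enorm_ge0// enorm_sqr.
rewrite real_normK ?num_real// /dotp (bigD1 i)//= expr2.
by rewrite lerDl sumr_ge0// => j _; rewrite -expr2 sqr_ge0.
Qed.

Lemma enorm_gt0 {R : realType} {N : nat} (x : 'rV[R]_N) : x != 0 -> 0 < enorm x.
Proof.
move=> x0; rewrite lt_neqAle enorm_ge0 andbT; apply: contra x0 => /eqP e0.
apply/eqP/rowP => i; rewrite mxE; apply/eqP; rewrite -normr_le0 e0.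
exact: le_coord_enorm.
Qed.

(** * Blow-up of the exponential functional *)

Section Blowup.
Context {R : realType} {N : nat} {d : measure_display} {Omega : measurableType d}.
Variables (P : probability Omega R) (X : R -> Omega -> 'rV[R]_N) (alpha : R).
Variable x : 'rV[R]_N.
Local Notation Y := (fun t w => X t w - x).
Hypotheses (alpha02 : 0 < alpha < 2) (N0 : (0 < N)%N).
Hypothesis rcX : right_continuous_paths P X.
Hypothesis levyY : is_levy_process P Y.
Hypothesis charY : forall (t : R) (xi : 'rV[R]_N), 0 <= t ->
  char_fun P (Y t) xi = real_complex R (expR (- (t * enorm xi `^ alpha))).

Lemma stay_at_shift z r t1 T k : stay_at Y z r t1 T k = stay_at X z r t1 T k.
Proof.
apply/funext => w; apply/propext; split => h i ik; have := h i ik;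
  congr (enorm _ <= _); apply/rowP => j; rewrite /increment !mxE; ring.
Qed.

Let mX (t : R) : 0 <= t -> measurable_fun setT (X t : Omega -> borel_rV R N).
Proof.
move=> t0; have [mY _ _ _ _] := levyY; apply: measurable_rV => i.
rewrite (_ : (fun w => X t w 0 i) = (fun w => (X t w - x) 0 i + x 0 i)).
  apply: measurable_funD; last exact: measurable_cst.
  exact: (measurableT_comp (coord_measurable i) (mY t t0)).
by apply/funext => w; rewrite !mxE subrK.
Qed.

(** The exceptional set and the origin are Lebesgue-null, and the law of the
    process at each positive time has a bounded density; Fubini exchanges path
    and time. *)
Lemma ae_potential_ge (nu : R -> R) (V : 'rV[R]_N -> R) t :
  lebesgue_outer [set z | ~ (nu (enorm z) <= V z)] = 0%E ->
  {ae P, forall w, exists Z : set R,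
    [/\ measurable Z, lebesgue_measure Z = 0%E & forall s : R, 0 < s <= t -> ~ Z s ->
      0 < enorm (X s w) /\ nu (enorm (X s w)) <= V (X s w)]}.
Proof.
move=> /(lebesgue_outer_translate x)/lebesgue_null_hull[B [mB AB B0]].
have /andP[alpha0 _] := alpha02.
have [mY _ _ _ _] := levyY.
pose B' : set (borel_rV R N) := (fun z : 'rV[R]_N => z - x) @^-1` (B `|` ccube (- x) 0).
have mB2 : measurable (B `|` ccube (- x) 0 : set (borel_rV R N)).
  by apply: measurableU => //; exact: ccube_measurable.
have mB' : measurable B'.
  have msub : measurable_fun setT (fun z : borel_rV R N => (z : 'rV[R]_N) - x : borel_rV R N).
    apply: measurable_rV => i; under eq_fun do rewrite !mxE.
    by apply: measurable_funB; [exact: coord_measurable|exact: measurable_cst].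
  by rewrite -[X in measurable X]setTI; exact: msub.
have B'0 (s : R) : 0 < s -> P (X s @^-1` B') = 0%E.
  move=> s0; have mYs := mY s (ltW s0).
  have cY := fun xi => stable_cos charY xi (ltW s0).
  have sY := fun xi => stable_sin charY xi (ltW s0).
  have h1 := B0 _ _ P (Y s) alpha s alpha0 s0 mYs cY sY.
  have h2 := @stable_no_atom _ _ _ _ P (Y s) alpha s (- x) alpha0 s0 N0 mYs cY sY.
  have m1 : measurable (Y s @^-1` B) by rewrite -[X in measurable X]setTI; exact: mYs.
  have m2 : measurable (Y s @^-1` ccube (- x) 0).
    rewrite -[X in measurable X]setTI; apply: mYs => //; exact: ccube_measurable.
  apply/eqP; rewrite eq_le measure_ge0 andbT.
  apply: (@le_trans _ _ (P (Y s @^-1` B `|` Y s @^-1` ccube (- x) 0))) => //.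
  by apply: (le_trans (measureU2 P m1 m2)); rewrite [X in (X + _)%E]h1 [X in (_ + X)%E]h2 adde0.
have := @ae_avoid _ _ _ _ P X B' t mX rcX mB' B'0.
apply: filterS => w [Z [mZ Z0 hZ]]; exists Z; split => // s st nZ.
have nB : ~ B' (X s w) by move=> h; apply: nZ; exact: hZ.
split.
  apply: enorm_gt0; apply/eqP => X0; apply: nB; right => i.
  by rewrite X0 add0r subrr normr0.
apply: contrapT => nV; apply: nB; left; apply: AB => /=.
by rewrite addrC subrK.
Qed.

(** Only the second third of the time interval contributes; elsewhere the
    potential is merely bounded below by [0]. *)
Lemma functional_ge (nu : R -> R) (V : 'rV[R]_N -> R) (T rho C r0 : R) w (Z : set R) :
  (forall r, 0 < r -> 0 <= nu r) -> {in `]0, r0] &, nonincreasing_fun nu} ->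
  0 < T -> 0 < rho <= r0 -> 0 <= C -> C <= nu rho ->
  measurable Z -> lebesgue_measure Z = 0%E ->
  (forall s : R, 0 < s <= T + T + T -> ~ Z s ->
      0 < enorm (X s w) /\ nu (enorm (X s w)) <= V (X s w)) ->
  (forall s : R, T <= s < T + T -> enorm (X s w) <= rho) ->
  ((C * T)%:E <= \int[lebesgue_measure]_(s in `[0%R, (T + T + T)%R]) (V (X s w))%:E)%E.
Proof.
move=> nu0 num T0 /andP[rho0 rhor0] C0 Cnu mZ Z0 hV hX.
have TT : T < T + T by rewrite ltrDl.
have -> : (C * T)%:E = (C%:E * lebesgue_measure `[T, (T + T)%R[)%E.
  by rewrite lebesgue_measure_itv/= lte_fin TT -EFinD addrK.
have m0 : measurable [set (0 : R)] by exact: measurable_set1.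
apply: (@integral_ge_off_null R _ _ (@lebesgue_measure R) `[0, T + T + T] `[T, T + T[
  (Z `|` [set 0]) (fun s => (V (X s w))%:E) C) => //.
- exact: measurableU.
- move=> s; rewrite /= !in_itv/= => /andP[h1 h2].
  by apply/andP; split; [exact: le_trans (ltW T0) h1|rewrite (le_trans (ltW h2))// lerDl ltW].
- apply/eqP; rewrite eq_le measure_ge0 andbT.
  apply: (le_trans (measureU2 (@lebesgue_measure R) mZ m0)).
  by rewrite [X in (X + _)%E]Z0 [X in (_ + X)%E]lebesgue_measure_set1 adde0.
- move=> s; rewrite /= in_itv/= => /andP[s0 st] nZ.
  have s1 : 0 < s by rewrite lt_neqAle s0 andbT; apply/eqP => s0'; apply: nZ; right.
  have [||e0 hVs] := hV s; first by rewrite s1.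
    by move=> Zs; apply: nZ; left.
  by rewrite lee_fin (le_trans _ hVs)// nu0.
- move=> s; rewrite /= in_itv/= => /andP[sT st] nZ.
  have s1 : 0 < s := lt_le_trans T0 sT.
  have [||e0 hVs] := hV s.
  - by rewrite s1 (le_trans (ltW st))// lerDl ltW.
  - by move=> Zs; apply: nZ; left.
  have er : enorm (X s w) <= rho by apply: hX; rewrite sT.
  rewrite lee_fin (le_trans Cnu)// (le_trans _ hVs)//.
  by apply: num => //; rewrite in_itv/= ?rho0 ?e0// (le_trans er).
Qed.

End Blowup.

Theorem theorem3p1 (R : realType) (alpha : R) (N : nat)
    (nu : R -> R) (V u0 : 'rV[R]_N -> R)
    (d : measure_display) (Omega : measurableType d)
    (X : R -> Omega -> 'rV[R]_N) (P : 'rV[R]_N -> probability Omega R)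
    (halpha : 0 < alpha < 2)
    (hN : (1 <= N)%N)
    (hNalpha : alpha < N%:R)
    (hnu_ge0 : forall r : R, 0 < r -> 0 <= nu r)
    (hnu_meas : lebesgue_measurable_fun lebesgue_measure `]0, +oo[ nu)
    (hnu_mono : nonincreasing_near_origin nu)
    (hV_meas : lebesgue_measurable_fun lebesgue_outer [set: 'rV[R]_N] V)
    (hu0_cont : continuous u0)
    (hu0_supp : compactly_supported u0)
    (hu0_ge0 : forall x, 0 <= u0 x)
    (hu0_neq0 : exists x, u0 x != 0)
    (hX : is_rot_inv_stable_process alpha X P)
    (hliminf : ((bessel_zero1 ((N%:R - 2) / 2) `^ alpha)%:E <
                limf_einf (fun r : R => (r `^ alpha * nu r)%:E) 0^'+)%E)
    (hV_ge : lebesgue_outer [set x | ~ (nu (enorm x) <= V x)] = 0%E) :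
  forall (x : 'rV[R]_N) (t : R), 0 < t ->
    (\int[P x]_w ((u0 (X t w))%:E *
       expeR (\int[lebesgue_measure]_(s in `[0%R, t]) (V (X s w))%:E)) = +oo)%E.
Proof.
move=> x t t0; have /andP[alpha0 alpha2] := halpha.
have pw2 k : (2 ^+ k) `^ alpha = (2 `^ alpha) ^+ k :> R.
  by rewrite -powR_mulrn// -[RHS]powR_mulrn ?powR_ge0// -!powRrM [_ * alpha]mulrC.
have [rcX levyY charY] := hX x.
have [j j0 [jE jneg]] := @bessel_zero1_psi R N hN.
rewrite jE in hliminf.
have [l jl [r1 r10 hl]] := lt_liminf_right hliminf.
have [r0 r00 numono] := hnu_mono.
have l0 : 0 < l by apply: le_lt_trans jl; exact: powR_ge0.
pose m := l `^ alpha^-1.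
have aV0 : 0 < alpha^-1 by rewrite invr_gt0.
have malpha : m `^ alpha = l.
  by rewrite /m -powRrM mulVf ?gt_eqF// powRr1// ltW.
have jm : j < m.
  have -> : j = (j `^ alpha) `^ alpha^-1.
    by rewrite -powRrM divff ?gt_eqF// powRr1// ltW.
  by rewrite gt0_ltr_powR ?nnegrE ?powR_ge0// ltW.
have [lam /andP[jlam lamle] psineg] : exists2 lam, j < lam <= j + (m - j) / 4 &
    psi N (lam ^+ 2) < 0.
  by apply: jneg; rewrite ltrDl divr_gt0// subr_gt0.
(* [j < lam < lam' < m], with room for the factor [1 + eta] below [m]: [lam] is
   the rate on the lattice, [lam'] the rate after passing to the process, [m]
   the rate of growth of the functional *)
pose lam' := (m + j) / 2.
have lam0 : 0 < lam by exact: lt_trans jlam.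
have lam12 : lam < lam' by rewrite /lam'; lra.
have lam'0 : 0 < lam' by exact: lt_trans lam12.
pose eta := (m - j) / (2 * (m + j)).
have mj0 : 0 < m + j by lra.
have eta0 : 0 < eta by rewrite divr_gt0 ?mulr_gt0 ?subr_gt0.
have eta1 : 0 < 1 + eta by lra.
have lam'm : lam' * (1 + eta) < m.
  have -> : lam' * (1 + eta) = (3 * m + j) / 4 by rewrite /lam' /eta; field; rewrite gt_eqF.
  lra.
have gap : lam' `^ alpha * (1 + eta) `^ alpha < l.
  rewrite -powRM ?(ltW lam'0) ?(ltW eta1)// -malpha gt0_ltr_powR ?nnegrE ?(ltW (lt_trans j0 jm))//.
  by rewrite mulr_ge0 ?(ltW lam'0) ?(ltW eta1).
have [f [subf f00 fball]] := test_function hN lam0 psineg.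
pose T := t / 3; have T0 : 0 < T by rewrite divr_gt0.
have tE : t = T + T + T by rewrite /T; field.
have [z uz] := hu0_neq0.
have uz0 : 0 < u0 z by rewrite lt_neqAle eq_sym uz hu0_ge0.
pose c0 := u0 z / 2; have c00 : 0 < c0 by rewrite divr_gt0.
have [e e0 he] : exists2 e : R, 0 < e & ocube z e `<=` [set y | c0 < u0 y].
  apply: ocube_nbhs; apply: (cvgr_gt _ (hu0_cont z)).
  by rewrite /c0; lra.
pose L : set (borel_rV R N) := ocube z (e / 2).
have mL : measurable L by exact: ocube_measurable.
pose Y (s : R) w := X s w - x.
pose p3 := fine (P x (Y T @^-1` L)).
have p30 : 0 < p3.
  have := @supp_all _ _ _ _ (P x) Y alpha alpha0 alpha2 hN levyY charY T z T0 (e / 2).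
  rewrite divr_gt0// => /(_ isT) h; rewrite fine_gt0// h/=.
  by rewrite (le_lt_trans (probability_le1 _ _)) ?ltry//;
    rewrite -[X in measurable X]setTI; have [mY _ _ _ _] := levyY; exact: (mY _ (ltW T0)).
pose K := 1 + \sum_i `|x 0 i|.
have K0 : 0 < K by rewrite ltr_pwDl// sumr_ge0.
have [c cp hit] := @hit_cube _ _ _ _ (P x) Y alpha alpha0 alpha2 hN levyY charY T K T0 K0.
have NR0 : 0 < N%:R :> R by rewrite ltr0n.
(* the scale [a] makes the cube to be hit, of radius [eta * r / (2 * N)] when
   [r = (a * 2 ^ k)^-1], equal to the one of [hit_cube], of radius [K / 2 ^ k] *)
pose a := eta / (2 * N%:R * K).
have a0 : 0 < a by rewrite divr_gt0// !mulr_gt0.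
pose D := T * a `^ alpha * (l * (1 + eta)^-1 `^ alpha - lam' `^ alpha).
have eaV : (1 + eta) `^ alpha * (1 + eta)^-1 `^ alpha = 1.
  by rewrite -powRM ?invr_ge0 ?(ltW eta1)// divff ?gt_eqF// powR1.
have D0 : 0 < D.
  rewrite !mulr_gt0 ?powR_gt0// subr_gt0.
  have -> : lam' `^ alpha = lam' `^ alpha * (1 + eta) `^ alpha * (1 + eta)^-1 `^ alpha.
    by rewrite -mulrA eaV mulr1.
  by rewrite ltr_pM2r// powR_gt0// invr_gt0.
have b1 : 1 < 2 `^ alpha :> R.
  apply: (@le_lt_trans _ _ (1 `^ alpha)); first by rewrite powR1.
  by rewrite gt0_ltr_powR ?nnegrE// ltr1n.
(* the radii are at most [S], which makes all the local hypotheses available *)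
pose S := Num.min (Num.min r0 (r1 / 2)) (Num.min (e / 2) 1).
have S0 : 0 < S by rewrite !lt_min r00 !divr_gt0 ?ltr01.
apply/eqyP => M M0.
(* the logarithm of the cost [c ^ k] of reaching the ball is linear in [k], while
   the gain [D] from the time spent in it is multiplied by [2 `^ (alpha * k)] *)
have [k k0k hk] := @exp_exp_unbounded R c D (2 `^ alpha) (M / (c0 * p3))
  (Num.truncn ((1 + eta) / a / S)).+1 cp D0 b1.
have k20 : 0 < 2 ^+ k :> R by rewrite exprn_gt0.
pose r := (a * 2 ^+ k)^-1; have rp : 0 < r by rewrite invr_gt0 mulr_gt0.
pose rho := (1 + eta) * r.
have rho0 : 0 < rho by rewrite mulr_gt0.
have rhoS : rho <= S.
  have h1 : (1 + eta) / a / S <= 2 ^+ k.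
    apply: (le_trans (ltW (truncnS_gt _))); apply: (@le_trans _ _ k%:R); first by rewrite ler_nat.
    by rewrite -natrX ler_nat ltnW// ltn_expl.
  rewrite ler_pdivrMr// in h1.
  by rewrite /rho /r invfM mulrA ler_pdivrMr// [leRHS]mulrC.
move: (rhoS); rewrite /S !le_min => /andP[/andP[rho_r0 rho_r1] /andP[rho_e rho_1]].
have r_rho : r <= rho by rewrite /rho ler_peMl ?(ltW rp)// lerDl ltW.
have width : eta * r / (2 * N%:R) = K / 2 ^+ k.
  by rewrite /r /a; field; rewrite !gt_eqF.
pose stay_prob := c ^+ k.+1 * expR (- (T * r^-1 `^ alpha * lam' `^ alpha)) * p3.
have stay_le kk : stay_prob <= fine (P x (stay_at Y x rho T T kk `&`
    increment Y (T + T) (T + T + T) @^-1` L)).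
  have [v vr] := @stay_at_ge _ _ _ _ (P x) Y alpha halpha hN levyY charY lam lam' f
    lam0 lam12 subf f00 fball x r eta T T T kk L rp eta0 T0 T0 T0 mL.
  apply: le_trans; rewrite ler_wpM2r ?(ltW p30)// ler_wpM2r ?expR_ge0//.
  rewrite width -lee_fin fineK; last first.
    rewrite fin_num_measure// -[X in measurable X]setTI; have [mY _ _ _ _] := levyY.
    by apply: (mY _ (ltW T0)) => //; exact: ocube_measurable.
  apply: hit => i; rewrite !mxE subr0 (le_trans (ler_normB _ _))// /K lerD//.
    by rewrite (le_trans (le_coord_enorm _ _))// (le_trans vr)// (le_trans r_rho).
  by rewrite (bigD1 i)//= lerDl sumr_ge0.
have TT0 : 0 <= T + T by rewrite addr_ge0 ?ltW.
have TTT0 : 0 <= T + T + T by rewrite addr_ge0 ?(ltW T0).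
have EP := @stay_ge _ _ _ _ (P x) Y levyY x rho T T L stay_prob (T + T) (T + T + T)
  (ltW T0) (ltW T0) TT0 TTT0 mL stay_le.
(* [E]: the process is in the ball of radius [rho] at the dyadic times of the
   second third of [0, t], and its last increment brings it near [z] *)
set E := \bigcap_k _ in EP.
have mE : measurable E.
  apply: bigcap_measurableType => kk _; apply: measurableI.
    by apply: (stay_at_measurable levyY); exact: ltW.
  by rewrite -[X in measurable X]setTI; exact: (increment_measurable levyY TT0 TTT0).
have potE := @ae_potential_ge _ _ _ _ (P x) X alpha x halpha hN rcX levyY charY nu V t hV_ge.
have [_ Y0 _ _ _] := levyY.
have [Z [mZ PZ sZ]] : {ae P x, forall w, [/\
    (forall s : R, 0 <= s -> X s' w @[s' --> s^'+] --> X s w), X 0 w = x & exists Z : set R,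
    [/\ measurable Z, lebesgue_measure Z = 0%E & forall s : R, 0 < s <= t -> ~ Z s ->
      0 < enorm (X s w) /\ nu (enorm (X s w)) <= V (X s w)]]}.
  apply: filterS3 rcX Y0 potE => w rcw Y0w potw; split => //.
  by apply/eqP; rewrite -subr_eq0; apply/eqP.
pose C := l * rho^-1 `^ alpha.
have C0 : 0 <= C by rewrite mulr_ge0 ?powR_ge0 ?(ltW l0).
have Cnu : C <= nu rho.
  have h := hl rho; rewrite rho0 in h.
  have {}h := h (le_lt_trans rho_r1 _); rewrite /C.
  have rr : rho `^ alpha * rho^-1 `^ alpha = 1.
    by rewrite -powRM ?invr_ge0 ?(ltW rho0)// divff ?gt_eqF// powR1.
  apply: (@le_trans _ _ (rho `^ alpha * nu rho * rho^-1 `^ alpha)).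
    rewrite ler_wpM2r ?powR_ge0// h//; first by rewrite ltr_pdivrMr// ltr_pMr// ltr1n.
  by rewrite mulrAC rr mul1r.
have main : ((c0 * expR (C * T))%:E * P x E <= \int[P x]_w ((u0 (X t w))%:E *
       expeR (\int[lebesgue_measure]_(s in `[0%R, t]) (V (X s w))%:E)))%E.
  apply: (integral_ge_off_null mE mZ) => //.
  - by rewrite mulr_ge0 ?expR_ge0 ?(ltW c00).
  - by move=> w _ _; rewrite mule_ge0 ?lee_fin ?expeR_ge0.
  move=> w Ew nZ.
  have [rcw X0w [Zw [mZw Zw0 hZw]]] : [/\
      (forall s : R, 0 <= s -> X s' w @[s' --> s^'+] --> X s w), X 0 w = x & exists Z : set R,
      [/\ measurable Z, lebesgue_measure Z = 0%E & forall s : R, 0 < s <= t -> ~ Z s ->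
      0 < enorm (X s w) /\ nu (enorm (X s w)) <= V (X s w)]].
    by apply: contrapT => h; apply: nZ; exact: sZ.
  have hst kk : stay_at X x rho T T kk w.
    by rewrite -(stay_at_shift X x); have [] := Ew kk I.
  have incX s : x + increment X 0 s w = X s w by rewrite /increment X0w addrC subrK.
  have ball s : T <= s < T + T -> enorm (X s w) <= rho.
    move=> sT; rewrite -incX.
    exact: (stay_right_continuous (ltW T0) T0 rcw hst sT).
  rewrite tE in hZw.
  have Vint := functional_ge hnu_ge0 numono T0 (introT andP (conj rho0 rho_r0)) C0 Cnu
    mZw Zw0 hZw ball.
  have uX : c0 <= u0 (X t w).
    apply/ltW/he => i.
    have end_ball : enorm (X (T + T) w) <= rho.
      have := hst 0%N 1%N isT; rewrite expn0 divr1 mul1r; by rewrite incX.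
    have [_ Linc] := Ew 0%N I.
    have := Linc i; rewrite /increment /Y !mxE.
    have := le_trans (le_coord_enorm (X (T + T) w) i) end_ball.
    rewrite -tE; move: (X t w 0 i) (X (T + T) w 0 i) (x 0 i) (z 0 i) => p q y zz h1 h2.
    have -> : p - zz = q + (p - y - (q - y) - zz) by ring.
    rewrite (le_lt_trans (ler_normD _ _))//; lra.
  rewrite EFinM lee_pmul ?lee_fin ?(ltW c00) ?expR_ge0//.
  rewrite -[leLHS]/(expeR (C * T)%:E) lee_expeR [X in `[0%R, X]]tE.
  exact: Vint.
apply: le_trans main.
have -> : M%:E = ((c0 * expR (C * T))%:E * (M / (c0 * expR (C * T)))%:E)%E.
  by rewrite -EFinM mulrC divfK// gt_eqF// mulr_gt0// expR_gt0.
rewrite lee_pmul2l ?lte_fin ?mulr_gt0 ?expR_gt0//.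
apply: le_trans EP; rewrite lee_fin ler_pdivrMr ?mulr_gt0 ?expR_gt0//.
rewrite ler_pdivrMr ?mulr_gt0// in hk.
apply: (le_trans hk); rewrite le_eqVlt; apply/orP; left; apply/eqP.
have -> : D * (2 `^ alpha) ^+ k = C * T - T * r^-1 `^ alpha * lam' `^ alpha.
  have rE : r^-1 `^ alpha = a `^ alpha * (2 `^ alpha) ^+ k.
    by rewrite /r invrK powRM ?(ltW a0) ?(ltW k20)// pw2.
  have rhoE : rho^-1 `^ alpha = (1 + eta)^-1 `^ alpha * r^-1 `^ alpha.
    by rewrite /rho invfM powRM// invr_ge0; exact: ltW.
  by rewrite /D /C rhoE rE; ring.
rewrite expRD /stay_prob; ring.
Qed.
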